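(* Let $L$ be a locally compact field with respect to a nontrivial absolute value $|\cdot|$ such that $L$ is not algebraically closed (equivalently, $L$ is not isomorphic to $\mathbb{C}$), and assume $|\cdot|$ is normalized to coincide with the modulus of additive Haar measure on $L$. For $x=(x_0:x_1),\,y=(y_0:y_1)\in\mathbb{P}^1(L)$ put \[\delta(x,y)=\frac{|x_0y_1-y_0x_1|}{\max\{|x_0|,|x_1|\}\max\{|y_0|,|y_1|\}},\] and for a Borel probability measure $\nu$ on $\mathbb{P}^1(L)$ put $I(\nu)=\iint_{\mathbb{P}^1(L)\times\mathbb{P}^1(L)}-\log\delta(x,y)\,d\nu(x)\,d\nu(y)$. Then: (a) There exists a unique Borel probability measure $\mu_L$ on $\mathbb{P}^1(L)$ such that $I(\nu)\ge I(\mu_L)$ for all Borel probability measures $\nu$ on $\mathbb{P}^1(L)$. Moreover, if $\{\nu_n\}$ is a sequence of Borel probability measures on $\mathbb{P}^1(L)$ with $I(\nu_n)\to I(\mu_L)$, then $\nu_n\to\mu_L$ weakly. (b) If $L=\mathbb{R}$, then $\mu_{\mathbb{R}}$ is given by $d\mu_{\mathbb{R}}(x)=\frac{1}{\pi^2x}\log\left|\frac{x+1}{x-1}\right|\,dx$ on $\mathbb{R}\subset\mathbb{P}^1(\mathbb{R})$, and $I(\mu_{\mathbb{R}})=\frac{7\zeta(3)}{2\pi^2}=0.426278\ldots$, where $\zeta(3)=\sum_{n\ge1}n^{-3}$. (c) If $L$ is non-archimedean, then $\mu_L$ is the unique $\mathrm{PGL}_2(\mathcal{O}_L)$-invariant Borel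 probability measure on $\mathbb{P}^1(L)$, and $I(\mu_L)=\frac{q\log q}{q^2-1}$, where $q$ is the number of elements of the residue field of $L$.
   Context: $\mathcal{O}_L=\{\alpha\in L:|\alpha|\le1\}$ denotes the ring of integers of $L$ in the non-archimedean case; $\mathrm{PGL}_2(\mathcal{O}_L)$ acts on $\mathbb{P}^1(L)$ by Möbius transformations. The energy $I(\nu)$ takes values in $(-\infty,+\infty]$. *)

(* Defs.v *)
From HB Require Import structures.
From mathcomp Require Import all_boot all_order all_algebra.
From mathcomp Require Import generic_quotient.
From mathcomp Require Import all_classical all_reals all_analysis.

Set Implicit Arguments.
Unset Strict Implicit.
Unset Printing Implicit Defensive.

Import Order.TTheory GRing.Theory Num.Theory.
Import numFieldNormedType.Exports.

Local Open Scope classical_set_scope.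
Local Open Scope ring_scope.

(* The library's [normedZmodType] is not usable here: its axiom
   [`|x *+ n| = `|x| *+ n] excludes every non-archimedean absolute value. *)
Record absolute_value (R : realType) (L : fieldType) := AbsoluteValue {
  absv :> L -> R ;
  absv_ge0 : forall x, 0 <= absv x ;
  absv_eq0 : forall x, absv x = 0 <-> x = 0 ;
  absvM : forall x y, absv (x * y) = absv x * absv y ;
  absvD : forall x y, absv (x + y) <= absv x + absv y
}.

(* The field [L] with the metric [`|x - y|] defined by [v]. *)
Definition valued (R : realType) (L : fieldType) (v : absolute_value R L)
  : Type := L.

Section ValuedTopology.
Context {R : realType} {L : fieldType} (v : absolute_value R L).

HB.instance Definition _ := GRing.Field.on (valued v).
HB.instance Definition _ := isPointed.Build (valued v) 0.

Let dist (x y : valued v) : R := v (x - y).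

Let distxx x : dist x x = 0.
Proof. by rewrite /dist subrr; apply/absv_eq0. Qed.

Let dist_positivity x y : dist x y = 0 -> x = y.
Proof. by move=> /absv_eq0/eqP; rewrite subr_eq0 => /eqP. Qed.

Let absvN x : v (- x) = v x.
Proof.
apply/eqP; rewrite -(eqrXn2 (ltn0Sn 1)) ?absv_ge0//.
by rewrite !expr2 -!absvM mulrNN.
Qed.

Let dist_sym x y : dist x y = dist y x.
Proof. by rewrite /dist -opprB absvN. Qed.

Let dist_triangle y x z : dist x z <= dist x y + dist y z.
Proof. by rewrite /dist -(subrKA y); exact: absvD. Qed.

HB.instance Definition _ := @isMetric.Build R (valued v) dist
  distxx dist_positivity dist_sym dist_triangle.

End ValuedTopology.

Notation borel T := (g_sigma_algebraType (@open T)).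

Section LocalField.
Context {R : realType} {L : fieldType} (v : absolute_value R L).

Definition nontrivial_absv := exists2 x : L, x != 0 & v x != 1.

Definition nonarchimedean := forall x y : L, v (x + y) <= Num.max (v x) (v y).

Record is_haar (m : {measure set (borel (valued v)) -> \bar R}) : Prop := {
  haar_nonzero : m setT != 0%E ;
  haar_translation : forall (a : L) (A : set (borel (valued v))),
    measurable A -> m [set a + x | x in A] = m A ;
  haar_compact : forall K : set (valued v), compact K -> (m K < +oo)%E ;
  haar_outer_regular : forall A : set (borel (valued v)), measurable A ->
    m A = ereal_inf
      [set m U | U in [set U : set (valued v) | open U /\ A `<=` U]] ;
  haar_inner_regular : forall U : set (valued v), open U ->
    m U = ereal_sup
      [set m K | K in [set K : set (valued v) | compact K /\ K `<=` U]]
}.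

Definition is_haar_modulus :=
  exists2 m : {measure set (borel (valued v)) -> \bar R}, is_haar m &
    forall (a : L) (A : set (borel (valued v))), a != 0 -> measurable A ->
      m [set a * x | x in A] = ((v a)%:E * m A)%E.

(* The underlying set of the residue field O_L / m_L: the cosets a + m_L of
   m_L = {|x| < 1} with a in O_L = {|x| <= 1}. *)
Definition residue_field : set (set L) :=
  [set [set y | v (y - a) < 1] | a in [set a : L | v a <= 1]].

(* GL_2(O_L): matrices over O_L that have an inverse over O_L. *)
Definition GL2_integers : set 'M[L]_2 := [set M | [/\ M \in unitmx,
  (forall i j, v (M i j) <= 1) & (forall i j, v (invmx M i j) <= 1)]].

End LocalField.

Section ProjectiveLine.
Context {R : realType} {L : fieldType} (v : absolute_value R L).

Definition nzpair : set (valued v * valued v) := [set x | x != 0].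

Definition proportional (x y : nzpair) : bool :=
  `[< exists2 c : L, c != 0 & \val y = (c * (\val x).1, c * (\val x).2) >].

Lemma proportional_refl : reflexive proportional.
Proof.
move=> x; apply/asboolP; exists 1; first exact: oner_neq0.
by rewrite !mul1r; case: (\val x).
Qed.

Lemma proportional_sym : symmetric proportional.
Proof.
suff H x y : proportional x y -> proportional y x.
  by move=> x y; apply/idP/idP; exact: H.
move=> /asboolP[c c0 e]; apply/asboolP; exists c^-1; first by rewrite invr_eq0.
by rewrite e /= !mulKf//; case: (\val x).
Qed.

Lemma proportional_trans : transitive proportional.
Proof.
move=> y x z /asboolP[c c0 e] /asboolP[d d0 f]; apply/asboolP.
exists (d * c); first by rewrite mulf_neq0.
by rewrite f e /= !mulrA.
Qed.

Canonical proportional_equiv :=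
  EquivRel proportional proportional_refl proportional_sym proportional_trans.

(* Pairs (x_0, x_1) != (0, 0) up to scaling, with the quotient topology. *)
Definition P1 : Type := quotient_topology {eq_quot proportional}%qT.

HB.instance Definition _ := Topological.on P1.
HB.instance Definition _ := Quotient.on P1.

Lemma nzpair10 : ((1, 0) : valued v * valued v) \in nzpair.
Proof.
by rewrite inE /nzpair/= -[0 in X in _ != X]/(0, 0) xpair_eqE oner_eq0.
Qed.

(* The point (a : b), with the junk value (1 : 0) when a = b = 0. *)
Definition hpoint (a b : L) : P1 :=
  (\pi_P1 (insubd (exist _ (1, 0) nzpair10 : nzpair) (a, b)))%qT.

HB.instance Definition _ := isPointed.Build P1 (hpoint 1 0).

Definition hcoord (p : P1) : L * L := \val (repr p).

Lemma hcoord_hpoint (a b : L) : (a, b) != (0, 0) ->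
  exists2 c : L, c != 0 & hcoord (hpoint a b) = (c * a, c * b).
Proof.
move=> ab0; have ab : ((a, b) : valued v * valued v) \in nzpair by rewrite inE.
rewrite /hcoord /hpoint /insubd insubT/=.
case: piP => y /eqmodP/asboolP[c c0 e]; exists c => //.
Qed.

Definition chordal (x y : L * L) : R :=
  v (x.1 * y.2 - y.1 * x.2) /
  (Num.max (v x.1) (v x.2) * Num.max (v y.1) (v y.2)).

Definition delta (p q : P1) : R := chordal (hcoord p) (hcoord q).

Lemma delta_hpoint (a b c d : L) : (a, b) != (0, 0) -> (c, d) != (0, 0) ->
  delta (hpoint a b) (hpoint c d) = chordal (a, b) (c, d).
Proof.
move=> /hcoord_hpoint[s s0 es] /hcoord_hpoint[t t0 et].
rewrite /delta es et /chordal/= !absvM -!maxr_pMr ?absv_ge0//.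
rewrite mulrACA (mulrACA t) (mulrC t s) -mulrBr !absvM.
rewrite [X in _ / X]mulrACA -mulf_div divff ?mul1r// mulf_neq0//.
  by apply/eqP => /absv_eq0/eqP; rewrite (negPf s0).
by apply/eqP => /absv_eq0/eqP; rewrite (negPf t0).
Qed.

Definition mobius (M : 'M[L]_2) (p : P1) : P1 :=
  let: (x0, x1) := hcoord p in
  hpoint (M ord0 ord0 * x0 + M ord0 ord_max * x1)
         (M ord_max ord0 * x0 + M ord_max ord_max * x1).

(* Scalar matrices act trivially, so this is invariance under
   PGL_2(O_L) = GL_2(O_L) / O_L^*. *)
Definition PGL2_invariant (nu : probability (borel P1) R) :=
  forall M, GL2_integers v M ->
  forall A : set (borel P1), measurable A -> nu (mobius M @^-1` A) = nu A.

(* [lne 0 = -oo], so the integrand is [+oo] on the diagonal. *)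
Definition energy (nu : probability (borel P1) R) : \bar R :=
  (\int[nu \x nu]_z - lne (delta z.1 z.2)%:E)%E.

Definition minimizes_energy (mu : probability (borel P1) R) :=
  forall nu : probability (borel P1) R, (energy mu <= energy nu)%E.

End ProjectiveLine.

(* Measures of the library are functions on all subsets, so equality of two
   Borel measures is equality on the measurable sets. *)
Definition same_measure d (T : measurableType d) (R : realType)
    (mu nu : probability T R) :=
  forall A : set T, measurable A -> mu A = nu A.

Definition weakly_converges (R : realType) (T : ptopologicalType)
    (nu : nat -> probability (borel T) R) (mu : probability (borel T) R) :=
  forall f : T -> R, continuous f -> bounded_fun f ->
    (\int[nu n]_x (f x)%:E)%E @[n --> \oo] --> (\int[mu]_x (f x)%:E)%E.

Definition zeta3 (R : realType) : R :=
  limn (fun N => \sum_(1 <= n < N) (n%:R ^- 3 : R)).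

Definition density_R (R : realType) (x : R) : R :=
  (pi ^+ 2 * x)^-1 * ln `|(x + 1) / (x - 1)|.

(* Main.v *)
(* Both cases rest on an identity
     - ln (delta x y) + g x + g y = \int a(s, x) a(s, y) ds
   with a kernel [a >= 0] and a bounded [g].  Let [F_nu s] be the integral of
   [a(s, .)] against [nu].  If the potential of [mu] is a constant [c], then
     I(nu) = c + \int (F_nu - F_mu) ^ 2 ds,
   so [mu] is a minimizer and [I(mu) = c].  If moreover there are functions [h]
   with [\int h(s) a(s, x) ds = 1] such that [h(s) a(s, .)] is supported near a
   point [ctr s], then continuous functions are approximated by combinations of
   the [a(s, .)]; hence [I(nu_n) --> c] forces weak convergence, and applied to
   constant sequences this gives uniqueness.

   If [L] is non-archimedean then [- ln delta] is [ln q] times the number of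
   [k >= 1] with [delta <= q ^ -k], the [a(s, .)] are multiples of indicators of
   balls, [g = 0], and [mu] gives the same mass to all balls of the same radius.

   If [L] is archimedean then [|n| = n] for every integer [n]: otherwise the
   integers below [b ^ k] would be packed in a ball of too small Haar measure.
   Hence [L] contains the real numbers, and it is equal to them because
   otherwise a two-dimensional lattice would be packed in balls whose Haar
   measure grows linearly.  For the points [(cos s : sin s)], [delta] is
   [|sin (s - t)|] divided by sup norms, and
     - ln (sin d) = \int_d^(pi / 2) (t - d) / sin t ^ 2 dt
   exhibits the logarithm as a superposition of indicators of arcs.  The measure
   [mu] is the law of [(cos s : cos t)] for independent uniform angles; its
   potential is constant because
     |cos g - cos s| / 2 = |sin ((s + g) / 2)| |sin ((s - g) / 2)|,
   and evaluating it at infinity gives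
     I(mu) = \int ln (max 1 |y|) dmu(y) = 4 / pi ^ 2 * \sum_k (2 k + 1) ^ -3. *)
Require Import Defs.
From HB Require Import structures.
From mathcomp Require Import all_boot all_order all_algebra.
From mathcomp Require Import finmap.
From mathcomp Require Import ring lra.
From mathcomp Require Import all_classical all_reals all_analysis.
From mathcomp Require Import measurable_realfun.

Set Implicit Arguments.
Unset Strict Implicit.
Unset Printing Implicit Defensive.

Import Order.TTheory GRing.Theory Num.Theory.
Import numFieldNormedType.Exports.

Local Open Scope classical_set_scope.
Local Open Scope ring_scope.

(** * Energies of positive kernels *)

(** Two obstacles shape the proof. The first is infinity: [I(nu)] may be [+oo], and over the reals
    [- ln delta] also takes negative values, since [delta] reaches 2. The kernel is therefore
    shifted by a constant, all double integrals are those of nonnegative functions, and identities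
    are written as sums without subtraction. Cancellation is legitimate because the mixed energy of
    any [nu] with [mu] is finite, the potential of [mu] being constant. The second is the sup norm
    in [delta], which is not rotation-invariant: only the Euclidean part of [- ln delta] is a
    superposition of arcs. The correction [g] involves one variable at a time and drops out of
    [I(nu) = c + gap], but it is the reason why the real equilibrium measure is not the
    rotation-invariant one. The normalization of the absolute value gives the mass of residue
    classes in the non-archimedean case; in the archimedean case it excludes the complex numbers,
    whose modulus [|z| ^ 2] violates the triangle inequality. *)

Section NonnegIntegral.
Context d1 (T1 : measurableType d1) d2 (T2 : measurableType d2) (R : realType).

Lemma nn_integralD (m : {measure set T1 -> \bar R}) (f g : T1 -> \bar R) :
  (forall x, 0 <= f x)%E -> (forall x, 0 <= g x)%E ->
  measurable_fun setT f -> measurable_fun setT g ->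
  (\int[m]_x (f x + g x) = \int[m]_x f x + \int[m]_x g x)%E.
Proof. by move=> f0 g0 mf mg; rewrite ge0_integralD. Qed.

Lemma nn_integralZ (m : {measure set T1 -> \bar R}) (k : R) (f : T1 -> \bar R) :
  0 <= k -> (forall x, 0 <= f x)%E -> measurable_fun setT f ->
  (\int[m]_x (k%:E * f x) = k%:E * \int[m]_x f x)%E.
Proof. by move=> k0 f0 mf; rewrite ge0_integralZl_EFin. Qed.

Lemma nn_integral_le (m : {measure set T1 -> \bar R}) (f g : T1 -> \bar R) :
  (forall x, 0 <= f x)%E -> measurable_fun setT f -> measurable_fun setT g ->
  (forall x, f x <= g x)%E -> (\int[m]_x f x <= \int[m]_x g x)%E.
Proof.
by move=> f0 mf mg fg; apply: ge0_le_integral.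
Qed.

Lemma probability_integral_cst (P : probability T1 R) (c : R) :
  (\int[P]_x c%:E = c%:E)%E.
Proof.
rewrite integral_cst; last exact: measurableT.
by rewrite [X in (_ * X)%E](@probability_setT _ _ _ P) mule1.
Qed.

Lemma tonelli (m1 : {sigma_finite_measure set T1 -> \bar R})
    (m2 : {sigma_finite_measure set T2 -> \bar R}) (f : T1 * T2 -> \bar R) :
  measurable_fun setT f -> (forall z, 0 <= f z)%E ->
  (\int[m1]_x \int[m2]_y f (x, y) = \int[m2]_y \int[m1]_x f (x, y))%E.
Proof. by move=> mf f0; rewrite -/(fubini_F m2 f) -/(fubini_G m1 f); exact: fubini_tonelli. Qed.

Lemma integral_section_meas (m2 : {sigma_finite_measure set T2 -> \bar R})
    (f : T1 * T2 -> \bar R) :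
  measurable_fun setT f -> (forall z, 0 <= f z)%E ->
  measurable_fun setT (fun x => \int[m2]_y f (x, y))%E.
Proof. by move=> mf f0; exact: measurable_fun_fubini_tonelli_F. Qed.

End NonnegIntegral.

(** * Superpositions of positive kernels and the L2 distance of features *)

Section PositiveKernel.
Context d (X : measurableType d) d' (W : measurableType d') (R : realType).
Context (w : {sigma_finite_measure set W -> \bar R}).
Variable a : W * X -> R.
Hypothesis a_ge0 : forall z, 0 <= a z.
Hypothesis a_meas : measurable_fun setT a.
Hypothesis a_bnd : forall s, exists M, forall x, a (s, x) <= M.

Implicit Types nu mu : probability X R.

Definition feature nu s : \bar R := (\int[nu]_x (a (s, x))%:E)%E.

Let a_pair dT (T : measurableType dT) (p : T -> W) (q : T -> X) :
  measurable_fun setT p -> measurable_fun setT q ->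
  measurable_fun setT (fun t => a (p t, q t)).
Proof. by move=> mp mq; exact: measurableT_comp a_meas (measurable_fun_pair mp mq). Qed.

Let a1_meas s : measurable_fun setT (fun x => (a (s, x))%:E).
Proof. by apply/measurable_EFinP; apply: a_pair. Qed.

Lemma feature_ge0 nu s : (0 <= feature nu s)%E.
Proof. by apply: integral_ge0 => x _; rewrite lee_fin. Qed.

Lemma feature_fin nu s : feature nu s \is a fin_num.
Proof.
rewrite ge0_fin_numE ?feature_ge0//; have [M aM] := a_bnd s.
apply: (@le_lt_trans _ _ (\int[nu]_x M%:E)%E).
  by apply: nn_integral_le => // x; rewrite lee_fin.
by rewrite probability_integral_cst ltry.
Qed.

Lemma feature_meas nu : measurable_fun setT (feature nu).
Proof.
apply: (@integral_section_meas _ W _ X R nu (EFin \o a)) => //.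
exact/measurable_EFinP.
Qed.

Definition gram (z : X * X) : \bar R :=
  (\int[w]_s (a (s, z.1) * a (s, z.2))%:E)%E.

Lemma gram_ge0 z : (0 <= gram z)%E.
Proof. by apply: integral_ge0 => s _; rewrite lee_fin mulr_ge0. Qed.

Lemma gram_meas : measurable_fun setT gram.
Proof.
apply: (@integral_section_meas _ _ _ W R w
  (fun t : (X * X) * W => (a (t.2, t.1.1) * a (t.2, t.1.2))%:E)).
  apply/measurable_EFinP; apply: measurable_funM; apply: a_pair => //.
  - exact: measurableT_comp measurable_fst measurable_fst.
  - exact: measurableT_comp measurable_snd measurable_fst.
by move=> t; rewrite lee_fin mulr_ge0.
Qed.

Lemma gram_double_integral nu mu : (\int[nu]_x \int[mu]_y gram (x, y) =
  \int[w]_s (feature nu s * feature mu s))%E.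
Proof.
have step1 x : (\int[mu]_y gram (x, y) =
    \int[w]_s ((a (s, x))%:E * feature mu s))%E.
  rewrite /gram/= (@tonelli _ _ _ _ _ mu w (fun t : X * W => (a (t.2, x) * a (t.2, t.1))%:E)).
  - by apply: eq_integral => s _; rewrite -nn_integralZ// => y; rewrite lee_fin.
  - by apply/measurable_EFinP; apply: measurable_funM; apply: a_pair.
  - by move=> t; rewrite lee_fin mulr_ge0.
under eq_integral do rewrite step1.
rewrite (@tonelli _ _ _ _ _ nu w
  (fun t : X * W => ((a (t.2, t.1))%:E * feature mu t.2)%E)).
- apply: eq_integral => s _/=; rewrite ge0_integralZr// ?feature_ge0//.
  by move=> y _; rewrite lee_fin.
- apply: emeasurable_funM; first by apply/measurable_EFinP; apply: a_pair.
  exact: measurableT_comp (feature_meas mu) measurable_snd.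
- by move=> t; rewrite mule_ge0 ?lee_fin ?feature_ge0.
Qed.

(** The squared L2 distance between the features. They are finite by [a_bnd], so [fine] loses
    nothing, while the integral itself may be [+oo]. *)
Definition gap nu mu : \bar R :=
  (\int[w]_s ((fine (feature nu s) - fine (feature mu s)) ^+ 2)%:E)%E.

Let gap_meas nu mu : measurable_fun setT
  (fun s => ((fine (feature nu s) - fine (feature mu s)) ^+ 2)%:E).
Proof.
apply/measurable_EFinP; apply: measurable_funX; apply: measurable_funB;
  by apply: measurableT_comp (feature_meas _).
Qed.

Let gapi_ge0 nu mu s :
  (0 <= ((fine (feature nu s) - fine (feature mu s)) ^+ 2)%:E)%E.
Proof. by rewrite lee_fin sqr_ge0. Qed.

Lemma gap_ge0 nu mu : (0 <= gap nu mu)%E.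
Proof. by apply: integral_ge0. Qed.

Lemma gapC nu mu : gap nu mu = gap mu nu.
Proof. by apply: eq_integral => s _; rewrite -sqrrN opprB. Qed.

(** Expansion of the square under the integral, with the cross terms on the left-hand side because
    the energies may be infinite. *)
Lemma gap_identity nu mu :
  (gap nu mu + (\int[w]_s (feature nu s * feature mu s) +
                \int[w]_s (feature nu s * feature mu s)) =
   \int[w]_s (feature nu s * feature nu s) +
   \int[w]_s (feature mu s * feature mu s))%E.
Proof.
have mm n m : measurable_fun setT (fun s => feature n s * feature m s)%E.
  by apply: emeasurable_funM; exact: feature_meas.
have nn n m s : (0 <= feature n s * feature m s)%E.
  by rewrite mule_ge0 ?feature_ge0.
rewrite -!nn_integralD//; [|by move=> s; rewrite adde_ge0|exact: emeasurable_funD].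
apply: eq_integral => s _.
rewrite -(fineK (feature_fin nu s)) -(fineK (feature_fin mu s)).
by rewrite -!EFinM -!EFinD/=; congr _%:E; ring.
Qed.

(** * Energy identities for a measure with constant potential *)

Section Potential.
Variables (k : X * X -> \bar R) (g : X -> R) (B C : R).
Hypothesis k_ge0 : forall z, (0 <= k z)%E.
Hypothesis g_ge0 : forall x, 0 <= g x.
Hypothesis g_bnd : forall x, g x <= B.
Hypothesis g_meas : measurable_fun setT g.
Hypothesis C_ge0 : 0 <= C.
Hypothesis kE : forall x y, (k (x, y) + (g x)%:E + (g y)%:E = gram (x, y) + C%:E)%E.

Let eg_meas : measurable_fun setT (fun x => (g x)%:E).
Proof. exact/measurable_EFinP. Qed.

Let eg_ge0 x : (0 <= (g x)%:E)%E.
Proof. by rewrite lee_fin. Qed.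

(** Joint measurability for the product sigma-algebra is read off from [kE]: Gram kernels are
    measurable by Tonelli, and the one-variable terms are real-valued and can be subtracted. *)
Lemma kernel_meas : measurable_fun setT k.
Proof.
have -> : k = fun z => (gram z + C%:E - (g z.1 + g z.2)%:E)%E.
  apply/funext => -[x y].
  by rewrite -kE EFinD -[X in (X - _)%E]addeA addeK// fin_numD.
apply: emeasurable_funB.
  by apply: emeasurable_funD; [exact: gram_meas|exact: measurable_cst].
by apply/measurable_EFinP; apply: measurable_funD;
   apply: measurableT_comp g_meas _.
Qed.

Let k1_meas x : measurable_fun setT (fun y => k (x, y)).
Proof. exact: measurableT_comp kernel_meas (pair1_measurable _). Qed.

Definition shift nu : \bar R := (\int[nu]_x (g x)%:E)%E.

Lemma shift_ge0 nu : (0 <= shift nu)%E.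
Proof. by apply: integral_ge0. Qed.

Lemma shift_fin nu : shift nu \is a fin_num.
Proof.
rewrite ge0_fin_numE ?shift_ge0//.
apply: (@le_lt_trans _ _ (\int[nu]_x B%:E)%E); first exact: nn_integral_le.
by rewrite probability_integral_cst ltry.
Qed.

Let C0 : (0 <= C%:E)%E.
Proof. by rewrite lee_fin. Qed.

Let gramC_double_integral nu mu : (\int[nu]_x \int[mu]_y (gram (x, y) + C%:E) =
  \int[w]_s (feature nu s * feature mu s) + C%:E)%E.
Proof.
have gm x : measurable_fun setT (fun y => gram (x, y)).
  exact: measurableT_comp gram_meas (pair1_measurable _).
rewrite -gram_double_integral.
under eq_integral do rewrite (nn_integralD _ (fun=> gram_ge0 _))// probability_integral_cst.
rewrite (@nn_integralD _ _ _ nu (fun x => \int[mu]_y gram (x, y))%E)//.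
- by rewrite probability_integral_cst.
- by move=> x; apply: integral_ge0 => y _; exact: gram_ge0.
- by apply: (@integral_section_meas _ _ _ _ _ mu gram); [exact: gram_meas|exact: gram_ge0].
Qed.

Let gram1 nu x : (\int[nu]_y (gram (x, y) + C%:E) =
  \int[nu]_y k (x, y) + (g x)%:E + shift nu)%E.
Proof.
under eq_integral do rewrite -kE.
rewrite (@nn_integralD _ _ _ _ (fun y => k (x, y) + (g x)%:E)%E (fun y => (g y)%:E))//.
- by rewrite nn_integralD// probability_integral_cst.
- by move=> y; rewrite adde_ge0.
- by apply: emeasurable_funD => //; exact: k1_meas.
Qed.

Lemma energy_gram nu :
  (\int[nu \x nu]_z k z + shift nu + shift nu =
   \int[w]_s (feature nu s * feature nu s) + C%:E)%E.
Proof.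
rewrite -gramC_double_integral fubini_tonelli1//; last exact: kernel_meas.
rewrite /fubini_F.
under [RHS]eq_integral do rewrite gram1.
have mF : measurable_fun setT (fun x => \int[nu]_y k (x, y))%E.
  by apply: (@integral_section_meas _ _ _ _ _ nu k) => //; exact: kernel_meas.
have F0 x : (0 <= \int[nu]_y k (x, y))%E by apply: integral_ge0.
have [r rE] : exists r, shift nu = r%:E by exists (fine (shift nu)); rewrite fineK// shift_fin.
have r0 : (0 <= r%:E)%E by rewrite -rE shift_ge0.
rewrite [in RHS]rE (@nn_integralD _ _ _ _
  (fun x => \int[nu]_y k (x, y) + (g x)%:E)%E (fun=> r%:E))//.
- rewrite (@nn_integralD _ _ _ nu (fun x => \int[nu]_y k (x, y))%E)//.
  by rewrite probability_integral_cst -/(shift nu) rE.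
- by move=> x; rewrite adde_ge0.
- exact: emeasurable_funD.
Qed.

Variables (mu : probability X R) (c : R).
Hypothesis potential : forall x, (\int[mu]_y k (x, y) = c%:E)%E.

Let c_ge0 : (0 <= c%:E)%E.
Proof. by rewrite -(potential point) integral_ge0. Qed.

(** Integrating the constant potential of [mu] against [nu] gives [c] for every [nu]; in particular
    the mixed term is finite even if the energy of [nu] is not. *)
Lemma mixed_energy nu : (\int[w]_s (feature nu s * feature mu s) + C%:E =
  c%:E + shift nu + shift mu)%E.
Proof.
rewrite -gramC_double_integral.
under eq_integral do rewrite gram1 potential.
rewrite -{1}(fineK (shift_fin mu)).
rewrite (@nn_integralD _ _ _ _ (fun x => c%:E + (g x)%:E)%E).
- by rewrite nn_integralD// !probability_integral_cst fineK// shift_fin.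
- by move=> x; rewrite adde_ge0.
- by move=> x; rewrite fineK ?shift_fin// shift_ge0.
- exact: emeasurable_funD.
- exact: measurable_cst.
Qed.

Lemma energy_potential : (\int[mu \x mu]_z k z = c%:E)%E.
Proof.
have := energy_gram mu; rewrite mixed_energy.
have := shift_fin mu; case: (shift mu) => //= r _.
case: (\int[mu \x mu]_z k z)%E => //= s.
by rewrite -!EFinD => -[] h; congr _%:E; lra.
Qed.

Theorem energy_gap nu : (\int[nu \x nu]_z k z = c%:E + gap nu mu)%E.
Proof.
have := gap_identity nu mu.
have := energy_gram nu; have := energy_gram mu; have := mixed_energy nu.
rewrite energy_potential.
have ge0 n m : (0 <= \int[w]_s (feature n s * feature m s))%E.
  by apply: integral_ge0 => s _; rewrite mule_ge0 ?feature_ge0.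
have := ge0 nu nu; have := ge0 nu mu; have := ge0 mu mu.
have := gap_ge0 nu mu; have : (0 <= \int[nu \x nu]_z k z)%E by exact: integral_ge0.
have := shift_fin mu; have := shift_fin nu.
case: (shift mu) => // r; case: (shift nu) => // s.
move: (\int[nu \x nu]_z k z)%E (gap nu mu)
  (\int[w]_s (feature mu s * feature mu s))%E
  (\int[w]_s (feature nu s * feature mu s))%E
  (\int[w]_s (feature nu s * feature nu s))%E => I t p q n.
move=> _ _ I0 t0 p0 q0 n0.
(* The mixed term [q] and the self-term [p] of [mu] are finite by the preceding identities. Either
   the self-term [n] of [nu] is finite and everything is real arithmetic, or [I] and [t] are both
   [+oo]. *)
case: q q0 => // q _; case: p p0 => // p _; case: n n0 => [n||] // _.
  case: I I0 => // u _; case: t t0 => // t _.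
  by rewrite -!EFinD => -[h1] [h2] [h3] [h4]; congr _%:E; lra.
by case: I I0 => // _; case: t t0.
Qed.

End Potential.

(** * From a small gap to close integrals of test functions *)

Section Smoothing.
Variables (dist : X -> X -> R) (h : W -> R) (ctr : W -> X) (eta : R).
Hypothesis h_ge0 : forall s, 0 <= h s.
Hypothesis h_meas : measurable_fun setT h.
Hypothesis ctr_meas : measurable_fun setT ctr.
Hypothesis h_sq : (\int[w]_s (h s ^+ 2)%:E < +oo)%E.
Hypothesis h_one : forall x, (\int[w]_s (h s * a (s, x))%:E = 1)%E.
Hypothesis h_ctr : forall s x, h s * a (s, x) != 0 -> dist (ctr s) x < eta.

Variables (f : X -> R) (B eps : R).
Hypothesis f_ge0 : forall x, 0 <= f x.
Hypothesis f_bnd : forall x, f x <= B.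
Hypothesis f_meas : measurable_fun setT f.
Hypothesis eps_gt0 : 0 < eps.
Hypothesis f_osc : forall x y, dist x y < eta -> `|f x - f y| <= eps.

(** An average of [f] over points near [x], by [h_one] and [h_ctr]. Unlike [f] itself it is a
    superposition of the functions [a (s, .)], so its integrals are expressed by features. *)
Let smooth (x : X) : \bar R := (\int[w]_s (h s * f (ctr s) * a (s, x))%:E)%E.

Let hf_meas : measurable_fun setT (fun s => h s * f (ctr s)).
Proof. by apply: measurable_funM => //; exact: measurableT_comp f_meas ctr_meas. Qed.

Let hfa_meas : measurable_fun setT
  (fun t : X * W => (h t.2 * f (ctr t.2) * a (t.2, t.1))%:E).
Proof.
apply/measurable_EFinP; apply: measurable_funM; last exact: a_pair.
exact: measurableT_comp hf_meas measurable_snd.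
Qed.

Let ha_meas x : measurable_fun setT (fun s => (h s * a (s, x))%:E).
Proof. by apply/measurable_EFinP; apply: measurable_funM => //; apply: a_pair. Qed.

Let ha_ge0 x s : (0 <= (h s * a (s, x))%:E)%E.
Proof. by rewrite lee_fin mulr_ge0. Qed.

Let cha_meas c x : measurable_fun setT (fun s => c%:E * (h s * a (s, x))%:E)%E.
Proof. by apply: emeasurable_funM => //; exact: measurable_cst. Qed.

Let hfa1_meas x : measurable_fun setT (fun s => (h s * f (ctr s) * a (s, x))%:E).
Proof. by apply/measurable_EFinP; apply: measurable_funM => //; apply: a_pair. Qed.

Let hfa_ge0 x s : (0 <= (h s * f (ctr s) * a (s, x))%:E)%E.
Proof. by rewrite lee_fin !mulr_ge0. Qed.

Let smooth_le x : (smooth x <= (f x + eps)%:E)%E.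
Proof.
have fe : 0 <= f x + eps by rewrite addr_ge0// ltW.
rewrite -[leRHS]mule1 -(h_one x) -nn_integralZ//.
apply: nn_integral_le => // s.
rewrite -EFinM lee_fin mulrAC [leRHS]mulrC.
have [->|/h_ctr/f_osc] := eqVneq (h s * a (s, x)) 0; first by rewrite !mul0r.
rewrite ler_norml => /andP[_ o]; apply: ler_wpM2l; first by rewrite mulr_ge0.
by rewrite -lerBlDl.
Qed.

Let smooth_ge x : ((f x)%:E <= smooth x + eps%:E)%E.
Proof.
have e0 : 0 <= eps by exact: ltW.
rewrite -[(f x)%:E]mule1 -[eps%:E]mule1 -(h_one x) -!nn_integralZ//.
rewrite -nn_integralD//; last by move=> s; rewrite mule_ge0.
apply: nn_integral_le => //.
- by move=> s; rewrite mule_ge0// lee_fin.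
- exact: emeasurable_funD.
move=> s; rewrite -!EFinM -EFinD lee_fin [h s * _ * _]mulrAC [leLHS]mulrC [eps * _]mulrC -mulrDr.
have [->|/h_ctr/f_osc] := eqVneq (h s * a (s, x)) 0; first by rewrite !mul0r.
rewrite ler_norml => /andP[osc _]; apply: ler_wpM2l; first by rewrite mulr_ge0.
by move: osc; lra.
Qed.

Let smooth_ge0 x : (0 <= smooth x)%E.
Proof. exact: integral_ge0. Qed.

Let smooth_meas : measurable_fun setT smooth.
Proof. exact: (@integral_section_meas _ X _ W R w _ hfa_meas). Qed.

Let smooth_integral nu :
  (\int[nu]_x smooth x = \int[w]_s ((h s * f (ctr s))%:E * feature nu s))%E.
Proof.
rewrite /smooth (@tonelli _ _ _ _ _ nu w
  (fun t : X * W => (h t.2 * f (ctr t.2) * a (t.2, t.1))%:E))//.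
apply: eq_integral => s _; rewrite -nn_integralZ//; first by rewrite mulr_ge0.
by move=> x; rewrite lee_fin.
Qed.

(* The bound [h f |D| <= l h^2 + (B^2 / l) D^2] plays the role of the
   Cauchy-Schwarz inequality. *)
Let smooth_compare : exists2 kappa : R, 0 < kappa & forall nu mu,
  (gap nu mu < kappa%:E)%E -> (\int[nu]_x smooth x <= \int[mu]_x smooth x + eps%:E)%E.
Proof.
have B0 : 0 <= B by apply: le_trans (f_ge0 point) (f_bnd point).
pose H := (\int[w]_s (h s ^+ 2)%:E)%E.
have hh0 s : (0 <= (h s ^+ 2)%:E)%E by rewrite lee_fin sqr_ge0.
have H0 : (0 <= H)%E by apply: integral_ge0.
have Hfin : H \is a fin_num by rewrite ge0_fin_numE.
have fH0 : 0 <= fine H by rewrite fine_ge0.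
(* [l] makes [l * H] at most [eps / 2], and the bound [eps / (2 * C)] on the gap does the same for
   [C * gap]. The two [+ 1] keep [l] well defined and [C] positive when [H] or [B] vanishes. *)
pose l := eps / (2 * (fine H + 1)).
have l0 : 0 < l by rewrite divr_gt0// mulr_gt0// ltr_wpDl.
pose C := (B + 1) ^+ 2 / l.
have C0 : 0 < C by rewrite divr_gt0// exprn_gt0// ltr_wpDl.
have l0' := ltW l0; have C0' := ltW C0.
exists (eps / (2 * C)); first by rewrite divr_gt0// mulr_gt0.
move=> nu mu gk; rewrite !smooth_integral.
have mh m : measurable_fun setT (fun s => (h s * f (ctr s))%:E * feature m s)%E.
  apply: emeasurable_funM; last exact: feature_meas.
  exact/measurable_EFinP.
have nh m s : (0 <= (h s * f (ctr s))%:E * feature m s)%E.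
  by rewrite mule_ge0 ?feature_ge0// lee_fin mulr_ge0.
pose D s := ((fine (feature nu s) - fine (feature mu s)) ^+ 2)%:E.
have mD : measurable_fun setT D by exact: gap_meas.
have D0 s : (0 <= D s)%E by exact: gapi_ge0.
have mH2 : measurable_fun setT (fun s => (h s ^+ 2)%:E).
  by apply/measurable_EFinP; exact: measurable_funX.
have mcD : measurable_fun setT (fun s => C%:E * D s)%E.
  by apply: emeasurable_funM => //; exact: measurable_cst.
have mlH : measurable_fun setT (fun s => l%:E * (h s ^+ 2)%:E)%E.
  by apply: emeasurable_funM => //; exact: measurable_cst.
have cD0 s : (0 <= C%:E * D s)%E by rewrite mule_ge0.
have lH0 s : (0 <= l%:E * (h s ^+ 2)%:E)%E by rewrite mule_ge0.
apply: (@le_trans _ _ (\int[w]_s ((h s * f (ctr s))%:E * feature mu s +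
    (l%:E * (h s ^+ 2)%:E + C%:E * D s)))%E).
  apply: nn_integral_le => //.
    by apply: emeasurable_funD => //; apply: emeasurable_funD.
  move=> s; rewrite /D.
  rewrite -(fineK (feature_fin nu s)) -(fineK (feature_fin mu s)) -!EFinM -!EFinD lee_fin /=.
  set p := fine _; set q := fine _; set u := h s; set v := f _.
  have u0 : 0 <= u by exact: h_ge0.
  have v0 : 0 <= v by exact: f_ge0.
  have vB : v <= B by exact: f_bnd.
  have key : u * (B + 1) * `|p - q| <= l * u ^+ 2 + C * (p - q) ^+ 2.
    rewrite /C -(real_normK (num_real (p - q))).
    set E := `|p - q|; have E0 : 0 <= E by exact: normr_ge0.
    have : 0 <= (l * u - (B + 1) * E) ^+ 2 / l by rewrite divr_ge0 ?sqr_ge0.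
    have -> : (l * u - (B + 1) * E) ^+ 2 / l =
      l * u ^+ 2 + (B + 1) ^+ 2 / l * E ^+ 2 - 2 * (u * (B + 1) * E).
      by field; rewrite gt_eqF.
    have : 0 <= u * (B + 1) * E by rewrite !mulr_ge0// addr_ge0.
    lra.
  apply: le_trans (lerD (lexx _) key).
  rewrite -lerBlDl -mulrBr; apply: le_trans (ler_norm _) _.
  rewrite normrM ler_wpM2r// ger0_norm ?mulr_ge0// ler_wpM2l//.
  by rewrite (le_trans vB)// lerDl.
rewrite nn_integralD//; last 2 first.
- by move=> s; rewrite adde_ge0.
- exact: emeasurable_funD.
apply: leeD2l.
rewrite nn_integralD// !nn_integralZ//.
have e2 : eps%:E = ((eps / 2)%:E + (eps / 2)%:E)%E by rewrite -EFinD -splitr.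
rewrite e2; apply: leeD.
  rewrite -/H -(fineK Hfin) -EFinM lee_fin /l.
  rewrite invfM mulrA mulrAC ler_pdivrMr ?ltr_wpDl// ler_wpM2l ?lerDl//.
  by rewrite divr_ge0// ltW.
rewrite -/(gap nu mu).
apply: (@le_trans _ _ (C%:E * (eps / (2 * C))%:E)%E).
  by apply: lee_wpmul2l => //; exact: ltW.
rewrite -EFinM lee_fin le_eqVlt; apply/orP; left; apply/eqP; field.
by rewrite gt_eqF.
Qed.

(** The three errors are [f] against its average, the average under [nu] against that under [mu],
    and the average back to [f]. [kappa] depends on neither measure, so exchanging them yields the
    opposite bound. *)
Lemma gap_controls_integral : exists2 kappa : R, 0 < kappa & forall nu mu,
  (gap nu mu < kappa%:E)%E ->
  (\int[nu]_x (f x)%:E <= \int[mu]_x (f x)%:E + (eps *+ 3)%:E)%E.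
Proof.
have [kappa k0 hk] := smooth_compare; exists kappa => // nu mu gk.
have mf : measurable_fun setT (fun x => (f x)%:E) by exact/measurable_EFinP.
have e0 : (0 <= eps%:E)%E by rewrite lee_fin ltW.
have f0 x : (0 <= (f x)%:E)%E by rewrite lee_fin.
have ms : measurable_fun setT (fun x => smooth x + eps%:E)%E.
  by apply: emeasurable_funD => //; exact: measurable_cst.
have mfe : measurable_fun setT (fun x => (f x)%:E + eps%:E)%E.
  by apply: emeasurable_funD => //; exact: measurable_cst.
apply: (@le_trans _ _ (\int[nu]_x (smooth x + eps%:E))%E).
  exact: nn_integral_le.
rewrite nn_integralD// probability_integral_cst.
apply: (@le_trans _ _ (\int[mu]_x smooth x + eps%:E + eps%:E)%E).
  by apply: leeD2r; exact: hk.
apply: (@le_trans _ _ (\int[mu]_x ((f x)%:E + eps%:E) + eps%:E + eps%:E)%E).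
  by do 2 apply: leeD2r; apply: nn_integral_le.
rewrite nn_integralD// probability_integral_cst -2!addeA.
have -> : (eps%:E + (eps%:E + eps%:E) = (eps *+ 3)%:E)%E.
  by rewrite -!EFinD; congr EFin; ring.
by [].
Qed.

End Smoothing.

End PositiveKernel.

(** * The projective line *)

Lemma borel_measurable_fun d (X : measurableType d) (T : ptopologicalType)
    (f : X -> borel T) :
  (forall U : set T, open U -> measurable (f @^-1` U)) -> measurable_fun setT f.
Proof.
move=> fo; apply: (@measurability _ _ X (borel T) setT f (@open T) erefl).
by move=> _ [U oU <-]; rewrite setTI; exact: fo.
Qed.

Lemma open_borel (T : ptopologicalType) (U : set T) :
  open U -> measurable (U : set (borel T)).
Proof. by move=> oU; exact: sub_sigma_algebra. Qed.

Lemma continuous_borel (R : realType) (T : ptopologicalType) (f : T -> R) :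
  continuous f -> measurable_fun setT (f : borel T -> R).
Proof.
move=> /continuousP cf.
apply: (measurability (D := setT) _ (RGenOInfty.measurableE R)).
move=> _ [_ [x ->] <-]; rewrite setTI; apply: open_borel.
by apply: cf; exact: interval_open.
Qed.

Section AbsoluteValue.
Context {R : realType} {L : fieldType} (v : absolute_value R L).

Lemma absv0 : v 0 = 0.
Proof. exact/absv_eq0. Qed.

Lemma absv_gt0 x : (0 < v x) = (x != 0).
Proof.
rewrite lt_neqAle absv_ge0 andbT eq_sym; congr (~~ _).
by apply/eqP/eqP; [exact: (absv_eq0 v x).1|exact: (absv_eq0 v x).2].
Qed.

Lemma absv1 : v 1 = 1.
Proof.
have v1 : v 1 != 0 by rewrite gt_eqF// absv_gt0 oner_neq0.
by apply: (mulfI v1); rewrite -absvM !mulr1.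
Qed.

Lemma absvN x : v (- x) = v x.
Proof.
apply/eqP; rewrite -(eqrXn2 (ltn0Sn 1)) ?absv_ge0//.
by rewrite !expr2 -!absvM mulrNN.
Qed.

Lemma absv_distC x y : v (x - y) = v (y - x).
Proof. by rewrite -absvN opprB. Qed.

Lemma absvV x : v x^-1 = (v x)^-1.
Proof.
have [->|x0] := eqVneq x 0; first by rewrite invr0 absv0 invr0.
have vx0 : v x != 0 by rewrite gt_eqF// absv_gt0.
by apply: (mulfI vx0); rewrite -absvM !divff// absv1.
Qed.

Lemma absvX x n : v (x ^+ n) = v x ^+ n.
Proof. by elim: n => [|n ih]; rewrite ?expr0 ?absv1// !exprS absvM ih. Qed.

Lemma absvB x y : v (x - y) <= v x + v y.
Proof. by rewrite -(absvN y); exact: absvD. Qed.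

Lemma absv_dist_triangle y x z : v (x - z) <= v (x - y) + v (y - z).
Proof. by rewrite -(subrKA y); exact: absvD. Qed.

Lemma absv_lip x y : `|v x - v y| <= v (x - y).
Proof.
have h1 : v x <= v (x - y) + v y by rewrite -{1}(subrK y x) absvD.
have h2 : v y <= v (x - y) + v x by rewrite absv_distC -{1}(subrK x y) absvD.
by rewrite ler_norml; apply/andP; split; lra.
Qed.

Lemma ball_absv (x : valued v) e (y : valued v) : ball x e y = (v (x - y) < e) :> Prop.
Proof. by rewrite ballEmdist. Qed.

Lemma nbhs_absv (x : valued v) (U : set (valued v)) :
  nbhs x U <-> exists2 e, 0 < e & forall y : valued v, v (x - y) < e -> U y.
Proof.
split=> [/nbhs_ballP[e e0 eU]|[e e0 eU]].
  by exists e => // y xy; apply: eU; rewrite ball_absv.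
by apply/nbhs_ballP; exists e => // y; rewrite ball_absv; exact: eU.
Qed.

Lemma absv_continuous : continuous (v : valued v -> R).
Proof.
move=> x U /nbhs_ballP[e e0 eU]; apply/nbhs_absv; exists e => // y xy; apply: eU.
exact: le_lt_trans (absv_lip _ _) xy.
Qed.

Definition maxnorm (x : L * L) : R := Num.max (v x.1) (v x.2).

Definition wedge (x y : L * L) : L := x.1 * y.2 - y.1 * x.2.

Lemma pair_lip_continuous (C : R) (g : valued v * valued v -> R) :
  (forall x y, `|g x - g y| <= C * (v (x.1 - y.1) + v (x.2 - y.2))) ->
  continuous g.
Proof.
move=> gC x U /nbhs_ballP[e e0 eU].
have C1 : 0 < `|C| + 1 by rewrite ltr_wpDl.
pose d := e / (2 * (`|C| + 1)).
have d0 : 0 < d by rewrite divr_gt0// mulr_gt0.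
exists ([set y : valued v | v (x.1 - y) < d], [set y : valued v | v (x.2 - y) < d]).
  by split; apply/nbhs_absv; exists d.
move=> y [/= h1 h2]; apply: eU; apply: le_lt_trans (gC _ _) _.
have s0 : 0 <= v (x.1 - y.1) + v (x.2 - y.2) by rewrite addr_ge0// absv_ge0.
apply: (@le_lt_trans _ _ ((`|C| + 1) * (v (x.1 - y.1) + v (x.2 - y.2)))).
  by rewrite ler_wpM2r// (le_trans (ler_norm C))// lerDl.
have -> : e = (`|C| + 1) * (d + d) by rewrite /d; field; rewrite gt_eqF.
by rewrite ltr_pM2l// ltrD.
Qed.

Lemma ler_dist_max (a b c d : R) :
  `|Num.max a b - Num.max c d| <= `|a - c| + `|b - d|.
Proof.
have h (x y z w : R) : Num.max x y <= Num.max z w + (`|x - z| + `|y - w|).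
  rewrite ge_max; have a0 := normr_ge0 (x - z); have b0 := normr_ge0 (y - w).
  have := ler_norm (x - z); have := ler_norm (y - w).
  have : z <= Num.max z w by rewrite le_max lexx.
  have : w <= Num.max z w by rewrite le_max lexx orbT.
  by move=> ? ? ? ?; apply/andP; split; lra.
rewrite ler_norml; apply/andP; split.
  by have := h c d a b; rewrite (distrC c) (distrC d); lra.
by have := h a b c d; lra.
Qed.

Lemma maxnorm_continuous : continuous (maxnorm : valued v * valued v -> R).
Proof.
apply: (@pair_lip_continuous 1) => x y; rewrite mul1r.
by apply: le_trans (ler_dist_max _ _ _ _) _; rewrite lerD// absv_lip.
Qed.

Lemma wedge_continuous (x : L * L) :
  continuous ((fun y => v (wedge x y)) : valued v * valued v -> R).
Proof.
apply: (@pair_lip_continuous (v x.1 + v x.2)) => y z.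
apply: le_trans (absv_lip _ _) _.
have -> : wedge x y - wedge x z = x.1 * (y.2 - z.2) - (y.1 - z.1) * x.2.
  by rewrite /wedge; ring.
apply: le_trans (absvB _ _) _; rewrite !absvM.
have := absv_ge0 v x.1; have := absv_ge0 v x.2.
have := absv_ge0 v (y.1 - z.1); have := absv_ge0 v (y.2 - z.2).
nra.
Qed.

Lemma maxnorm_gt0 (x : L * L) : x != (0, 0) -> 0 < maxnorm x.
Proof.
case: x => a b; rewrite xpair_eqE negb_and /maxnorm lt_max !absv_gt0/=.
by case: eqP.
Qed.

(* [(x ^ z) y = (x ^ y) z + (y ^ z) x] in the plane. *)
Lemma wedge_triangle (x y z : L * L) :
  v (wedge x z) * maxnorm y <= v (wedge x y) * maxnorm z + v (wedge y z) * maxnorm x.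
Proof.
rewrite {1}/maxnorm maxr_pMr ?absv_ge0// ge_max -!absvM; apply/andP; split.
  have -> : wedge x z * y.1 = wedge x y * z.1 + wedge y z * x.1.
    by rewrite /wedge; ring.
  apply: le_trans (absvD _ _ _) _; rewrite !absvM.
  by apply: lerD; rewrite ler_wpM2l ?absv_ge0// le_max lexx.
have -> : wedge x z * y.2 = wedge x y * z.2 + wedge y z * x.2.
  by rewrite /wedge; ring.
apply: le_trans (absvD _ _ _) _; rewrite !absvM.
by apply: lerD; rewrite ler_wpM2l ?absv_ge0// le_max lexx orbT.
Qed.

Lemma chordalE (x y : L * L) :
  chordal v x y = v (wedge x y) / (maxnorm x * maxnorm y).
Proof. by []. Qed.

End AbsoluteValue.

(** * The chordal metric and the quotient topology *)

Section ProjectiveLineMetric.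
Context {R : realType} {L : fieldType} (v : absolute_value R L).
Local Notation P := (P1 v).

Lemma hcoord_neq0 (p : P) : hcoord p != (0, 0).
Proof. by rewrite /hcoord; case: (repr p) => x /=; rewrite inE. Qed.

Lemma hpoint_hcoord (p : P) : hpoint v (hcoord p).1 (hcoord p).2 = p.
Proof.
rewrite /hpoint /hcoord -surjective_pairing valKd.
exact: reprK.
Qed.

Lemma hpoint_ind (Q : P -> Prop) :
  (forall a b, (a, b) != (0, 0) -> Q (hpoint v a b)) -> forall p, Q p.
Proof.
move=> QP p; rewrite -(hpoint_hcoord p); apply: QP.
by rewrite -surjective_pairing hcoord_neq0.
Qed.

Lemma hpoint_eq (p q : P) : wedge (hcoord p) (hcoord q) = 0 -> p = q.
Proof.
move=> w0; rewrite -(reprK p) -(reprK q); apply/eqmodP/asboolP.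
have := hcoord_neq0 p; have := hcoord_neq0 q; move: w0.
rewrite /hcoord; case: (val (repr p)) => a b; case: (val (repr q)) => c d.
rewrite /wedge/= !xpair_eqE !negb_and => /eqP; rewrite subr_eq0 => /eqP e cd ab.
have [a0|a0] := eqVneq a 0.
  have b0 : b != 0 by move: ab; rewrite a0 eqxx.
  move: e; rewrite a0 mul0r => /esym/eqP; rewrite mulf_eq0 (negPf b0) orbF => /eqP c0.
  exists (d / b); last by rewrite /= c0 mulr0 divfK.
  by rewrite mulf_neq0 ?invr_eq0//; move: cd; rewrite c0 eqxx.
exists (c / a); last by rewrite /= divfK// mulrAC -e mulrAC divff// mul1r.
rewrite mulf_neq0 ?invr_eq0//; apply/eqP => c0.
move: e cd; rewrite c0 mul0r eqxx/= => /eqP; rewrite mulf_eq0 (negPf a0)/= => /eqP ->.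
by rewrite eqxx.
Qed.

Lemma deltaE (p q : P) : delta p q = v (wedge (hcoord p) (hcoord q)) /
  (maxnorm v (hcoord p) * maxnorm v (hcoord q)).
Proof. by []. Qed.

Lemma delta_ge0 (p q : P) : 0 <= delta p q.
Proof.
by rewrite deltaE divr_ge0 ?absv_ge0// mulr_ge0// ltW// maxnorm_gt0// hcoord_neq0.
Qed.

Lemma deltaC (p q : P) : delta p q = delta q p.
Proof.
rewrite !deltaE [maxnorm v (hcoord q) * _]mulrC -[in RHS]absvN.
by congr (v _ / _); rewrite /wedge; ring.
Qed.

Lemma delta_refl (p : P) : delta p p = 0.
Proof. by rewrite deltaE /wedge subrr absv0 mul0r. Qed.

Lemma delta_eq0 (p q : P) : delta p q = 0 -> p = q.
Proof.
have := maxnorm_gt0 v (hcoord_neq0 p); have := maxnorm_gt0 v (hcoord_neq0 q).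
move=> q0 p0 /eqP; rewrite deltaE mulf_eq0 invr_eq0 mulf_eq0 !(gt_eqF p0) !(gt_eqF q0) !orbF.
by move=> /eqP/absv_eq0; exact: hpoint_eq.
Qed.

Lemma delta_triangle (q p r : P) : delta p r <= delta p q + delta q r.
Proof.
have := maxnorm_gt0 v (hcoord_neq0 p); have := maxnorm_gt0 v (hcoord_neq0 q).
have := maxnorm_gt0 v (hcoord_neq0 r).
have := wedge_triangle v (hcoord p) (hcoord q) (hcoord r).
rewrite !deltaE; set P1 := maxnorm v (hcoord p); set Q1 := maxnorm v (hcoord q).
set R1 := maxnorm v (hcoord r); set A := v _; set B := v _; set C := v _.
move=> ABC R0 Q0 P0.
have -> : B / (P1 * Q1) + C / (Q1 * R1) = (B * R1 + C * P1) / (P1 * R1) / Q1.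
  by field; rewrite !gt_eqF.
by rewrite ler_pdivlMr// mulrAC ler_pM2r// invr_gt0 mulr_gt0.
Qed.

Lemma hpoint_scale c a b : c != 0 -> (a, b) != (0, 0) ->
  hpoint v (c * a) (c * b) = hpoint v a b.
Proof.
move=> c0 ab; apply: delta_eq0; rewrite delta_hpoint//; last first.
  by move: ab; rewrite !xpair_eqE !mulf_eq0 (negPf c0).
rewrite chordalE /wedge/= (_ : _ - _ = 0) ?absv0 ?mul0r//.
by ring.
Qed.

Lemma hpoint_normalized (p : P) :
  (exists2 z, v z <= 1 & p = hpoint v z 1) \/ (exists2 z, v z <= 1 & p = hpoint v 1 z).
Proof.
elim/hpoint_ind: p => a b ab.
have [ab'|ba] := leP (v a) (v b).
  have b0 : b != 0.
    apply: contra_neq ab => b0; congr pair => //.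
    by apply: (absv_eq0 v a).1; apply/eqP; rewrite eq_le absv_ge0 andbT (le_trans ab')// b0 absv0.
  left; exists (b^-1 * a).
    by rewrite absvM absvV mulrC ler_pdivrMr ?absv_gt0// mul1r.
  rewrite -[in RHS](mulVf b0) hpoint_scale ?invr_eq0//.
have a0 : a != 0 by rewrite -(absv_gt0 v) (le_lt_trans (absv_ge0 _ _) ba).
right; exists (a^-1 * b).
  by rewrite absvM absvV mulrC ler_pdivrMr ?absv_gt0// mul1r ltW.
by rewrite -[1](mulVf a0) hpoint_scale ?invr_eq0//.
Qed.

Lemma pair1_neq0 (z : L) : (z, 1) != (0, 0) :> L * L /\ (1, z) != (0, 0) :> L * L.
Proof. by rewrite !xpair_eqE !oner_eq0 andbF. Qed.

Lemma delta_chart1 z z' : delta (hpoint v z 1) (hpoint v z' 1) =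
  v (z - z') / (Num.max (v z) 1 * Num.max (v z') 1).
Proof.
rewrite delta_hpoint ?(pair1_neq0 _).1//.
by rewrite chordalE /wedge /maxnorm/= !mulr1 absv1.
Qed.

Lemma delta_chart2 z z' : delta (hpoint v 1 z) (hpoint v 1 z') =
  v (z - z') / (Num.max 1 (v z) * Num.max 1 (v z')).
Proof.
rewrite delta_hpoint ?(pair1_neq0 _).2// chordalE /wedge /maxnorm/= absv1.
by rewrite !mul1r absv_distC.
Qed.

Lemma pi_hpoint (y : nzpair (v:=v)) :
  (\pi_(quotient_topology {eq_quot (@proportional _ _ v)}) y)%qT =
  hpoint v (\val y).1 (\val y).2.
Proof. by rewrite /hpoint -surjective_pairing valKd. Qed.

Lemma open_delta_ball (p : P) e : open [set q | delta p q < e].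
Proof.
(* Clearing denominators in [delta p q < e] leaves [0 < h z] for any representative [z] of [q]; [h]
   is continuous on the whole plane, so the ball is open in the quotient. *)
pose h (z : valued v * valued v) :=
  e * maxnorm v (hcoord p) * maxnorm v z - v (wedge (hcoord p) z).
have hc : continuous h.
  move=> z; apply: (@cvgB _ _ _ (nbhs z)); last exact: wedge_continuous.
  by apply: (@cvgM _ _ (nbhs z)); [exact: cvg_cst|exact: maxnorm_continuous].
have oC : open [set z | 0 < h z].
  by have /continuousP/(_ _ (@open_gt _ 0)) := hc.
rewrite /open/= /quotient_open.
rewrite [X in open X](_ : _ = set_val @^-1` [set z | 0 < h z]).
  by have /continuousP := @initial_continuous (nzpair (v:=v)) _ set_val; apply.
apply/seteqP; split=> y /=; rewrite pi_hpoint -{1}(hpoint_hcoord p);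
  (have y0 : ((\val y).1, (\val y).2) != (0, 0) by
     rewrite -surjective_pairing; have := set_valP y; rewrite /nzpair/=);
  have p0 := hcoord_neq0 p;
  rewrite delta_hpoint -?surjective_pairing// chordalE /h subr_gt0 -mulrA ltr_pdivrMr//;
  by rewrite mulr_gt0// maxnorm_gt0.
Qed.

Lemma delta_continuous (p : P) : continuous (delta p).
Proof.
move=> q U /nbhs_ballP[e e0 eU].
apply: (filterS (P := [set r | delta q r < e])).
  move=> r qr; apply: eU; rewrite /ball/= ltr_norml.
  have := delta_triangle q p r; have := delta_triangle r p q.
  by rewrite (deltaC r q) /= in qr *; move=> ? ?; apply/andP; split; lra.
apply: open_nbhs_nbhs; split; first exact: open_delta_ball.
by rewrite /= delta_refl.
Qed.

(* If [(c : d)], of norm 1, is close to [(1 : z)] then [c] is not small. *)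
Lemma near_rep (z c d : L) e : v z <= 1 -> Num.max (v c) (v d) = 1 ->
  v (d - c * z) < e -> e <= 1 / 2 -> c != 0 /\ v (z - d / c) < 2 * e.
Proof.
move=> z1 cd de e2.
have c2 : 1 / 2 <= v c.
  have [/eqP|] := leP (v c) (v d); last first.
    by move/ltW/max_idPl; rewrite cd => <-; lra.
  move=> /eqP/max_idPr; rewrite cd => d1.
  have : v d <= v (d - c * z) + v (c * z) by rewrite -{1}(subrK (c * z) d) absvD.
  have : v (c * z) <= v c by rewrite absvM ler_piMr// absv_ge0.
  by rewrite -d1; lra.
have c0 : 0 < v c by lra.
split; first by rewrite -(absv_gt0 v).
rewrite -(ltr_pM2r c0) -absvM mulrBl divfK; last by rewrite -(absv_gt0 v).
have e0 : 0 < e by exact: le_lt_trans (absv_ge0 v _) de.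
by rewrite absv_distC (mulrC z); apply: lt_le_trans de _; nra.
Qed.

Lemma delta_hpoint1 (z c d : L) : v z <= 1 -> Num.max (v c) (v d) = 1 ->
  delta (hpoint v 1 z) (hpoint v c d) = v (d - c * z) /\
  delta (hpoint v z 1) (hpoint v d c) = v (d - c * z).
Proof.
move=> z1 cd.
have c0 : (c, d) != (0, 0).
  by apply/eqP => -[c0 d0]; move: cd; rewrite c0 d0 absv0 maxxx => /esym/eqP; rewrite oner_eq0.
have d0 : (d, c) != (0, 0) by move: c0; rewrite !xpair_eqE andbC.
rewrite !delta_hpoint ?(pair1_neq0 _).1 ?(pair1_neq0 _).2// !chordalE /wedge /maxnorm/=.
rewrite absv1 cd (max_idPl _)// (max_idPr _)// [Num.max (v d) _]maxC cd !mulr1 !invr1 !mulr1.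
by rewrite mul1r (mulrC z c) absv_distC.
Qed.

Lemma hpoint_norm1 (p : P) : exists c d, Num.max (v c) (v d) = 1 /\ p = hpoint v c d.
Proof.
have [[z z1 ->]|[z z1 ->]] := hpoint_normalized p.
  by exists z, 1; rewrite absv1; split=> //; apply/max_idPr.
by exists 1, z; rewrite absv1; split=> //; apply/max_idPl.
Qed.

(** [delta] metrizes the quotient topology: the preimage of an open set contains a neighbourhood of
    the normalized representative of [p], and by [near_rep] every point at small distance from [p]
    has a representative there, with the same coordinate equal to 1. *)
Lemma nbhs_delta (p : P) (U : set P) :
  nbhs p U <-> exists2 e, 0 < e & forall q, delta p q < e -> U q.
Proof.
split; last first.
  move=> [e e0 eU]; apply: (filterS eU); apply: open_nbhs_nbhs.
  by split; [exact: open_delta_ball|rewrite /= delta_refl].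
rewrite nbhsE => -[V [oV Vp] VU].
move: oV; rewrite /open/= /quotient_open => -[W oW WV].
have VW a b (ab : (a, b) != (0, 0)) : V (hpoint v a b) <-> W (a, b).
  have ab' : ((a, b) : valued v * valued v) \in nzpair (v:=v) by rewrite inE.
  have := pi_hpoint (SigSub ab') => /= e.
  by rewrite -e; have /= := (congr1 (fun S => S (SigSub ab')) WV) => ->.
have WN a b : W (a, b) -> exists2 e, 0 < e &
    forall a' b', v (a - a') < e -> v (b - b') < e -> W (a', b').
  move=> Wab; have : nbhs ((a, b) : valued v * valued v) W by exact: open_nbhs_nbhs.
  move=> [[/= A B] [/nbhs_absv[e1 e10 h1] /nbhs_absv[e2 e20 h2]] ABW].
  exists (Num.min e1 e2); first by rewrite lt_min e10.
  move=> a' b'; rewrite !lt_min => /andP[a1 _] /andP[_ b1].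
  by apply: ABW; split=> /=; [exact: h1|exact: h2].
(* The radius is halved because [near_rep] doubles it, and capped at [1 / 2] as [near_rep]
   requires. *)
have hm (e : R) : 0 < e -> let e' := Num.min (e / 2) (1 / 2) in
    [/\ 0 < e', e' <= 1 / 2 & 2 * e' <= e].
  move=> e0 e'; rewrite /e' lt_min ge_min lexx orbT !divr_gt0//; split=> //.
  have : Num.min (e / 2) (1 / 2) <= e / 2 by rewrite ge_min lexx.
  lra.
have [[z z1 pE]|[z z1 pE]] := hpoint_normalized p; move: Vp; rewrite pE => /VW.
- move=> /(_ (pair1_neq0 _).1)/WN[e e0 eW].
  have [e'0 e'2 e'e] := hm e e0.
  exists (Num.min (e / 2) (1 / 2)) => // q.
  have [d [c [dc ->]]] := hpoint_norm1 q; rewrite maxC in dc.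
  rewrite (delta_hpoint1 z1 dc).2 => /near_rep/(_ e'2)[]// c0 zd.
  apply: VU; rewrite -[c]mulr1 -{1}(divfK c0 d) [_ / _ * _]mulrC hpoint_scale ?(pair1_neq0 _).1//.
  apply/VW; first exact: (pair1_neq0 _).1.
  by apply: eW; [exact: lt_le_trans e'e|rewrite subrr absv0].
- move=> /(_ (pair1_neq0 _).2)/WN[e e0 eW].
  have [e'0 e'2 e'e] := hm e e0.
  exists (Num.min (e / 2) (1 / 2)) => // q.
  have [c [d [cd ->]]] := hpoint_norm1 q.
  rewrite (delta_hpoint1 z1 cd).1 => /near_rep/(_ e'2)[]// c0 zd.
  apply: VU; rewrite -[c]mulr1 -{1}(divfK c0 d) [_ / _ * _]mulrC hpoint_scale ?(pair1_neq0 _).2//.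
  apply/VW; first exact: (pair1_neq0 _).2.
  by apply: eW; [rewrite subrr absv0|exact: lt_le_trans e'e].
Qed.

Lemma chart_continuous :
  continuous ((fun z => hpoint v z 1) : valued v -> P) /\
  continuous ((fun z => hpoint v 1 z) : valued v -> P).
Proof.
have h (a b c : R) : 0 <= a -> 1 <= b -> 1 <= c -> a / (b * c) <= a.
  move=> a0 b1 c1; rewrite ler_pdivrMr ?mulr_gt0 ?(lt_le_trans ltr01)//.
  by rewrite ler_peMr// mulr_ege1.
split=> z U /nbhs_delta[e e0 eU]; apply/nbhs_absv; exists e => // z' zz';
  apply: eU; rewrite ?delta_chart1 ?delta_chart2; apply: le_lt_trans zz';
  by apply: h; rewrite ?absv_ge0// le_max lexx ?orbT.
Qed.

(** * Compactness of the projective line *)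

Section CompactP1.
Hypothesis v_nontrivial : nontrivial_absv v.
Hypothesis L_locally_compact : locally_compact [set: valued v].

Lemma small_absv e : 0 < e -> exists2 c : L, c != 0 & v c < e.
Proof.
move=> e0.
have [c c0 c1] : exists2 c : L, c != 0 & v c < 1.
  have [x x0 x1] := v_nontrivial.
  have [|] := ltP (v x) 1; first by exists x.
  rewrite le_eqVlt eq_sym (negPf x1)/= => x2; exists x^-1; first by rewrite invr_eq0.
  by rewrite absvV invf_lt1// absv_gt0.
have : (fun n => v c ^+ n) @ \oo --> 0.
  by apply: cvg_expr; rewrite ger0_norm ?absv_ge0.
move=> /cvgrPdist_lt/(_ _ e0)[n _ /(_ n (leqnn n))].
rewrite sub0r normrN -absvX ger0_norm ?absv_ge0// => cn.
by exists (c ^+ n) => //; rewrite expf_neq0.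
Qed.

Lemma mul_continuous (c : L) : continuous ((fun x => c * x) : valued v -> valued v).
Proof.
move=> x U /nbhs_absv[e e0 eU]; apply/nbhs_absv.
have c1 : 0 < v c + 1 by rewrite ltr_wpDl// absv_ge0.
exists (e / (v c + 1)) => [|y xy]; first by rewrite divr_gt0.
apply: eU; rewrite -mulrBr absvM; move: xy; rewrite ltr_pdivlMr//.
have := absv_ge0 v (x - y); nra.
Qed.

Lemma closed_absv_ball r : closed [set x : valued v | v x <= r].
Proof.
have /continuous_closedP/(_ _ (@closed_le _ r)) := @absv_continuous _ _ v.
exact.
Qed.

(** Multiplication by a large scalar spreads one compact neighbourhood of 0 over the whole ball. *)
Lemma compact_absv_ball r : compact [set x : valued v | v x <= r].
Proof.
have [U /= + [cU _]] := @L_locally_compact (0 : valued v) I.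
move=> /nbhs_absv[e e0 eU'].
have eU (y : valued v) : v (0 - y) < e -> U y by move=> /eU'; exact.
clear eU'.
have r1 : 0 < `|r| + 1 by rewrite ltr_wpDl.
have [c c0 ce] := @small_absv (e / (`|r| + 1)) (divr_gt0 e0 r1).
apply: (@subclosed_compact _ _ ((fun x : valued v => c^-1 * x : valued v) @` U)).
- exact: closed_absv_ball.
- apply: continuous_compact => //; apply: continuous_subspaceT.
  exact: mul_continuous.
- move=> x /= xr; exists (c * x); last by rewrite mulKf.
  apply: eU; rewrite sub0r absvN absvM.
  move: ce; rewrite ltr_pdivlMr//; have := absv_ge0 v c; have := absv_ge0 v x.
  have := ler_norm r; nra.
Qed.

Lemma compact_P1 : compact [set: P].
Proof.
have [c1 c2] := chart_continuous.
have cK := @compact_absv_ball 1.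
rewrite (_ : [set: P] = (fun z : valued v => hpoint v z 1) @` [set x : valued v | v x <= 1] `|`
   (fun z : valued v => hpoint v 1 z) @` [set x : valued v | v x <= 1]).
  apply: compactU; apply: (@continuous_compact (valued v) P) => //;
    exact: continuous_subspaceT.
apply/esym/seteqP; split=> // p _.
by have [[z z1 ->]|[z z1 ->]] := hpoint_normalized p; [left|right]; exists z.
Qed.

Lemma uniformly_continuous_P1 (f : P -> R) e : continuous f -> 0 < e ->
  exists2 d, 0 < d & forall p q, delta p q < d -> `|f p - f q| <= e.
Proof.
move=> cf e0.
have /compact_near_coveringP := compact_P1.
move=> /(_ R (0^'+) (fun d p => forall q, delta p q < d -> `|f p - f q| <= e) _).
case=> [p _|].
  have e2 : 0 < e / 2 by rewrite divr_gt0.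
  have : nbhs p (f @^-1` (ball (f p) (e / 2))) by apply: cf; exact: nbhsx_ballx.
  move=> /nbhs_delta[d d0 dp].
  have d2 : 0 < d / 2 by rewrite divr_gt0.
  exists ([set q | delta p q < d / 2], [set d' | d' < d / 2]) => /=.
    split; last exact: nbhs_right_lt.
    by apply/nbhs_delta; exists (d / 2).
  move=> [q d'] [/= pq dd'] r qr.
  have h1 := dp q; have h2 := dp r; have := delta_triangle q p r.
  rewrite /ball/= in h1 h2; move=> tr.
  have {}h1 : `|f p - f q| < e / 2 by apply: h1; lra.
  have {}h2 : `|f p - f r| < e / 2 by apply: h2; lra.
  have -> : f q - f r = (f p - f r) - (f p - f q) by ring.
  by apply: le_trans (ler_normB _ _) _; lra.
move=> d1 /= d10 hd; exists (d1 / 2); first by rewrite divr_gt0.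
move=> p q pq; apply: (hd (d1 / 2)) => //=.
- by rewrite sub0r normrN gtr0_norm ?divr_gt0//; lra.
- by rewrite divr_gt0.
Qed.

Lemma continuous_bounded_P1 (f : P -> R) : continuous f ->
  exists M, forall p, `|f p| <= M.
Proof.
move=> cf.
have : compact (f @` setT).
  apply: continuous_compact; last exact: compact_P1.
  exact: continuous_subspaceT.
move=> /compact_bounded[M [_ /(_ (M + 1))]].
rewrite ltrDl ltr01 => /(_ isT) h; exists (M + 1) => p.
by apply: h; exists p.
Qed.

End CompactP1.

Lemma delta_le_meas (p : P) r : measurable ([set q | delta p q <= r] : set (borel P)).
Proof.
rewrite (_ : [set _ | _] = ~` [set q | r < delta p q]).
  apply: measurableC; apply: open_borel.
  by have /continuousP/(_ _ (@open_gt _ r)) := @delta_continuous p.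
by apply/seteqP; split=> q /=; rewrite leNgt => /negP.
Qed.

(* The open set is exhausted by the sets where the distance to its
   complement is at least [1 / n]. *)
Lemma open_approx (U : set P) : open U -> exists f : nat -> P -> R,
  [/\ forall n, continuous (f n), forall n p, 0 <= f n p <= 1,
      forall p, {homo f ^~ p : n m / (n <= m)%N >-> n <= m} &
      forall p, f n p @[n --> \oo] --> (\1_U p : R)].
Proof.
move=> oU; have [CU|CU0] := eqVneq (~` U) set0.
  have -> : U = setT by rewrite -(setCK U) CU setC0.
  exists (fun _ _ => 1); split=> //.
  - by move=> n; exact: cst_continuous.
  - by move=> n p; rewrite lexx ler01.
  - by move=> p n m _; exact: lexx.
  - by move=> p; rewrite indicE in_setT; exact: cvg_cst.
have [q0 q0U] : (~` U) !=set0 by exact/set0P.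
pose D p := inf [set delta p q | q in ~` U].
have lbD p : has_lbound [set delta p q | q in ~` U].
  by exists 0 => _ [q _ <-]; exact: delta_ge0.
have neD p : [set delta p q | q in ~` U] !=set0 by exists (delta p q0); exists q0.
have D0 p : 0 <= D p.
  by apply: lb_le_inf => // _ [q _ <-]; exact: delta_ge0.
have DL p r : D p <= delta p r + D r.
  rewrite -lerBlDl; apply: lb_le_inf => // _ [q qU <-].
  rewrite lerBlDl; apply: le_trans (delta_triangle r p q).
  by apply: ge_inf => //; exists q.
have DU p : U p -> 0 < D p.
  move=> Up; have /nbhs_delta[e e0 eU] : nbhs p U by exact: open_nbhs_nbhs.
  apply: lt_le_trans e0 _; apply: lb_le_inf => // _ [q qU <-].
  by rewrite leNgt; apply/negP => /eU.
have DCU p : ~ U p -> D p = 0.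
  move=> Up; apply/eqP; rewrite eq_le D0 andbT -(delta_refl p).
  by apply: ge_inf => //; exists p.
exists (fun n p => Num.min 1 (n%:R * D p)); split.
- move=> n p V /nbhs_ballP[e e0 eV]; apply/nbhs_delta.
  exists (e / n.+1%:R) => [|r pr]; first by rewrite divr_gt0.
  apply: eV; move: pr; rewrite /ball/= ltr_pdivlMr// => pr.
  apply: le_lt_trans pr.
  have mm (a b : R) : `|Num.min 1 a - Num.min 1 b| <= `|a - b|.
    rewrite ler_norml; have := ler_norm (a - b); have := ler_norm (b - a).
    rewrite (distrC b a); rewrite /Num.min; do 2 case: ifPn; rewrite -?leNgt => *;
    by apply/andP; split; lra.
  apply: le_trans (mm _ _) _; rewrite -mulrBr normrM ger0_norm// mulrC.
  apply: ler_pM => //.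
    rewrite ler_norml; have := DL p r; have := DL r p; rewrite (deltaC r p).
    by move=> ? ?; apply/andP; split; lra.
  by rewrite ler_nat.
- by move=> n p; rewrite le_min ler01 mulr_ge0// ge_min lexx.
- move=> p n m nm; rewrite le_min ge_min lexx/= ge_min.
  by rewrite ler_wpM2r ?orbT// ler_nat.
- move=> p; rewrite indicE; case: (boolP (p \in U)) => [|].
    rewrite inE => /DU Dp; apply: cvg_near_cst.
    exists (Num.truncn (D p)^-1).+1 => // n /= nD.
    apply/min_idPl.
    rewrite -ler_pdivrMr// mul1r ltW//; apply: lt_le_trans (_ : n%:R >= (Num.truncn (D p)^-1).+1%:R).
      exact: truncnS_gt.
    by rewrite ler_nat.
  rewrite notin_setE => /DCU Dp; apply: cvg_near_cst; exists 0%N => // n _.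
  by rewrite Dp mulr0; apply/min_idPr.
Qed.

(** Open sets form a pi-system generating the Borel sets, and [open_approx] presents the indicator
    of an open set as an increasing limit of continuous functions. *)
Lemma same_measure_continuous (mu nu : probability (borel P) R) :
  (forall f : P -> R, continuous f -> (forall p, 0 <= f p <= 1) ->
     (\int[mu]_p (f p)%:E = \int[nu]_p (f p)%:E)%E) ->
  same_measure mu nu.
Proof.
move=> H A mA.
apply: (@measure_unique _ R (borel P) (@open P) (fun=> setT) erefl
  (@openI _) (fun=> openT) _ mu nu _ _ A mA).
- by rewrite bigcup_const//; exists 0%N.
- move=> U oU; have [f [cf f01 ndf lf]] := open_approx oU.
  have mU : measurable (U : set (borel P)) by exact: open_borel.
  have I (m : probability (borel P) R) :
      m U = limn (fun n => \int[m]_p (f n p)%:E)%E.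
    rewrite -monotone_convergence//.
    - rewrite -[in LHS](setIT U) -integral_indic//; apply: eq_integral => p _.
      by apply/esym/cvg_lim => //; apply: cvg_EFin; [exact: nearW|exact: lf].
    - by move=> n; apply/measurable_EFinP; exact: continuous_borel.
    - by move=> n p _; rewrite lee_fin; case/andP: (f01 n p).
    - by move=> p _ n n' nn'; rewrite lee_fin; exact: ndf.
  apply: (eq_trans (I mu)); apply: (eq_trans _ (esym (I nu))).
  by congr (limn _); apply/funext => n; exact: H.
- by move=> k; rewrite (le_lt_trans (probability_le1 _ _))// ltry.
Qed.

End ProjectiveLineMetric.

(** * Minimizers from a constant potential *)

(** The integral of a signed function is a difference of two integrals. Here the negative part is at
    most [C], so the difference is meaningful even when the positive part has infinite integral. *)
Lemma integralD_cst_bounded_below d (T : measurableType d) (R : realType)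
    (P : probability T R) (k : T -> \bar R) (C : R) :
  measurable_fun setT k -> 0 <= C -> (forall z, 0 <= k z + C%:E)%E ->
  (\int[P]_z (k z + C%:E) = \int[P]_z k z + C%:E)%E.
Proof.
move=> mk C0 kC.
have n_le z : (k^\- z <= C%:E)%E.
  rewrite funenegE ge_max lee_fin C0 andbT.
  move: (kC z); case: (k z) => [r|_|//]; last exact: leNye.
  by rewrite -EFinD -EFinN !lee_fin => ?; lra.
have mp : measurable_fun setT (k^\+)%E by exact: measurable_funepos.
have mn : measurable_fun setT (k^\-)%E by exact: measurable_funeneg.
have nfin : (\int[P]_z k^\- z)%E \is a fin_num.
  rewrite ge0_fin_numE; last by apply: integral_ge0.
  apply: (@le_lt_trans _ _ (\int[P]_z C%:E)%E); first exact: nn_integral_le.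
  by rewrite probability_integral_cst ltry.
have : (\int[P]_z (k z + C%:E) + \int[P]_z k^\- z =
        \int[P]_z k^\+ z + C%:E)%E.
  rewrite -nn_integralD//; last by apply: emeasurable_funD => //; exact: measurable_cst.
  rewrite -[in RHS](probability_integral_cst P C) -nn_integralD//.
  apply: eq_integral => z _; have := kC z; have := n_le z.
  rewrite funenegE funeposE; case: (k z) => [r||] //=.
    rewrite -!EFin_max -!EFinD !lee_fin => _ _; congr _%:E.
    by rewrite /Num.max; do 2 case: ifPn; rewrite -?leNgt => *; lra.
  by move=> _ _; rewrite (max_idPr (leNye _)) (max_idPl (leey _)) adde0.
rewrite [(\int[P]_z k z)%E]integralE.
have : (0 <= \int[P]_z k^\+ z)%E by apply: integral_ge0.
move: nfin; case: (\int[P]_z k^\- z)%E => // n _.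
case: (\int[P]_z k^\+ z)%E => // [p|] _;
  case: (\int[P]_z (k z + C%:E))%E => // a.
by rewrite -EFinN -!EFinD => -[h]; congr _%:E; lra.
Qed.

Section Minimizer.
Context {R : realType} {L : fieldType} (v : absolute_value R L).
Hypothesis v_nontrivial : nontrivial_absv v.
Hypothesis L_locally_compact : locally_compact [set: valued v].
Local Notation X := (borel (P1 v)).
Context d' (W : measurableType d') (w : {sigma_finite_measure set W -> \bar R}).
Variable a : W * X -> R.
Hypothesis a_ge0 : forall z, 0 <= a z.
Hypothesis a_meas : measurable_fun setT a.
Hypothesis a_bnd : forall s, exists M, forall x, a (s, x) <= M.
Variables (g : X -> R) (B C c : R) (mu : probability X R).
Hypothesis C_ge0 : 0 <= C.
Hypothesis g_ge0 : forall x, 0 <= g x.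
Hypothesis g_bnd : forall x, g x <= B.
Hypothesis g_meas : measurable_fun setT g.

(** The nonnegative version of the energy kernel, to which Tonelli applies; [C] is 0 in the
    non-archimedean case and [ln 2] over the reals. *)
Let k (z : X * X) : \bar R := (- lne (delta z.1 z.2)%:E + C%:E)%E.

Hypothesis k_ge0 : forall z, (0 <= k z)%E.
Hypothesis kE : forall x y,
  (- lne (delta x y)%:E + (g x)%:E + (g y)%:E = gram w a (x, y))%E.
Hypothesis potential : forall x,
  (\int[mu]_y (- lne (delta x y)%:E + C%:E) = (c + C)%:E)%E.
Hypothesis mollifier : forall eta, 0 < eta ->
  exists (h : W -> R) (ctr : W -> X),
  [/\ (forall s, 0 <= h s) /\ measurable_fun setT h,
      measurable_fun setT ctr,
      (\int[w]_s (h s ^+ 2)%:E < +oo)%E,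
      (forall x, (\int[w]_s (h s * a (s, x))%:E = 1)%E) &
      (forall s x, h s * a (s, x) != 0 -> delta (ctr s) x < eta)].

Let kE' x y : (k (x, y) + (g x)%:E + (g y)%:E = gram w a (x, y) + C%:E)%E.
Proof.
rewrite -kE /k/= -!addeA; congr (_ + _)%E.
by rewrite addeC -!addeA addeC.
Qed.

Let k_meas : measurable_fun setT k.
Proof. exact: (@kernel_meas _ _ _ _ _ w a a_ge0 a_meas k g C g_meas kE'). Qed.

Let energyC (nu : probability X R) :
  (\int[nu \x nu]_z k z = energy nu + C%:E)%E.
Proof.
rewrite /k /energy; apply: (integralD_cst_bounded_below (nu \x nu)%E) => //.
rewrite (_ : (fun z => _) = (fun z => k z - C%:E)%E); last first.
  by apply/funext => z; rewrite /k addeK.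
by apply: emeasurable_funB => //; exact: measurable_cst.
Qed.

Lemma energy_minimizer_gap (nu : probability X R) :
  (energy nu = c%:E + gap w a nu mu)%E.
Proof.
have := @energy_gap _ _ _ _ _ w a a_ge0 a_meas a_bnd k g B C k_ge0 g_ge0 g_bnd g_meas
  C_ge0 kE' mu (c + C) potential nu.
rewrite energyC; have := gap_ge0 w a nu mu; case: (gap w a nu mu) => [r||] //.
  by case: (energy nu) => [s||] //= _; rewrite -!EFinD => -[h]; congr _%:E; lra.
by case: (energy nu).
Qed.

Lemma gap_refl (nu : probability X R) : gap w a nu nu = 0%E.
Proof. by rewrite /gap integral0_eq// => s _; rewrite subrr expr0n. Qed.

Lemma energy_minimizer : (energy mu = c%:E)%E.
Proof. by rewrite energy_minimizer_gap gap_refl adde0. Qed.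

Lemma minimizer_minimizes : minimizes_energy mu.
Proof.
move=> nu; rewrite (energy_minimizer_gap nu) energy_minimizer.
by rewrite leeDl// gap_ge0.
Qed.

Let shift_integral (nu : probability X R) (f : P1 v -> R) M :
  continuous f -> (forall p, `|f p| <= M) ->
  (\int[nu]_x (f x + M)%:E = \int[nu]_x (f x)%:E + M%:E)%E.
Proof.
move=> cf fM; under eq_integral do rewrite EFinD.
apply: integralD_cst_bounded_below.
- by apply/measurable_EFinP; exact: continuous_borel.
- exact: le_trans (normr_ge0 _) (fM point).
- move=> x; rewrite -EFinD lee_fin; have := fM x; rewrite ler_norml => /andP[].
  lra.
Qed.

Lemma gap_controls_continuous (f : P1 v -> R) eps : continuous f -> 0 < eps ->
  exists2 kappa : R, 0 < kappa & forall nu mu : probability X R,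
  (gap w a nu mu < kappa%:E)%E ->
  (\int[nu]_x (f x)%:E <= \int[mu]_x (f x)%:E + (eps *+ 3)%:E)%E.
Proof.
move=> cf e0; have [M fM] := continuous_bounded_P1 v_nontrivial L_locally_compact cf.
have [eta eta0 fo] := uniformly_continuous_P1 v_nontrivial L_locally_compact cf e0.
have [h [ctr [[h0 mh] mctr hsq h1 hc]]] := mollifier eta0.
(* Smoothing is stated for nonnegative functions; the shift by [M] cancels because both measures
   have mass 1. *)
pose f1 x := f x + M.
have f10 x : 0 <= f1 x.
  by rewrite /f1; have := fM x; rewrite ler_norml => /andP[]; lra.
have f1M x : f1 x <= M + M.
  by rewrite /f1; have := fM x; rewrite ler_norml => /andP[]; lra.
have mf1 : measurable_fun setT (f1 : X -> R).
  by apply: measurable_funD => //; exact: continuous_borel.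
have f1o x y : delta x y < eta -> `|f1 x - f1 y| <= eps.
  by move=> /fo; rewrite /f1 opprD addrACA subrr addr0.
have [kappa k0 hk] := @gap_controls_integral _ _ _ _ _ w a a_ge0 a_meas a_bnd
  _ h ctr eta h0 mh mctr hsq h1 hc f1 (M + M) eps f10 f1M mf1 e0 f1o.
exists kappa => // nu m /hk; rewrite /f1 !(shift_integral _ cf fM).
rewrite addeAC leeD2rE//.
Qed.

Let integral_fin (nu : probability X R) (f : P1 v -> R) : continuous f ->
  (\int[nu]_x (f x)%:E)%E \is a fin_num.
Proof.
move=> cf; have [M fM] := continuous_bounded_P1 v_nontrivial L_locally_compact cf.
apply: integrable_fin_num => //.
apply: (@le_integrable _ _ _ nu _ _ _ (cst M%:E)) => //.
- by apply/measurable_EFinP; exact: continuous_borel.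
- move=> x _ /=; rewrite lee_fin.
  by apply: le_trans (fM x) _; exact: ler_norm.
- exact: finite_measure_integrable_cst.
Qed.

Lemma gap_cvg_weak (nu : nat -> probability X R) :
  gap w a (nu n) mu @[n --> \oo] --> 0%E -> weakly_converges nu mu.
Proof.
move=> gcv f cf _.
rewrite -(fineK (integral_fin mu cf)).
apply/fine_cvgP; split; first by apply: nearW => n; exact: integral_fin.
apply/cvgrPdist_le => e e0.
have e3 : 0 < e / 3 by rewrite divr_gt0.
have [kappa k0 hk] := gap_controls_continuous cf e3.
have near_gap : \forall n \near \oo, (gap w a (nu n) mu < kappa%:E)%E.
  apply: (gcv [set x | (x < kappa%:E)%E]).
  by apply: open_nbhs_nbhs; split; [exact: open_ereal_lt_ereal|rewrite /= lte_fin].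
near=> n.
have gn : (gap w a (nu n) mu < kappa%:E)%E by near: n.
have h1 := hk _ _ gn; rewrite gapC in gn; have h2 := hk _ _ gn.
move: h1 h2 => /=.
rewrite -(fineK (integral_fin mu cf)) -(fineK (integral_fin (nu n) cf)).
rewrite -!EFinD !lee_fin ler_norml.
have -> : e / 3 *+ 3 = e by rewrite -mulr_natr divfK.
by move=> h1 h2; apply/andP; split; lra.
Unshelve. all: by end_near.
Qed.

Lemma gap0_same_measure (nu : probability X R) :
  gap w a nu mu = 0%E -> same_measure nu mu.
Proof.
move=> g0; apply: same_measure_continuous => f cf f01.
have bf : bounded_fun f.
  exists 1; split => // x x1 p _ /=; case/andP: (f01 p) => f0 f1.
  by rewrite ger0_norm// (le_trans f1)// ltW.
have := @gap_cvg_weak (fun=> nu); rewrite g0 => /(_ (cvg_cst _)) /(_ f cf bf).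
by move/(cvg_unique _ (cvg_cst _)) => /= ->.
Qed.

Theorem kernel_minimizer :
  [/\ minimizes_energy mu,
      forall nu : probability X R, minimizes_energy nu -> same_measure nu mu &
      forall nu : nat -> probability X R,
        energy (nu n) @[n --> \oo] --> energy mu -> weakly_converges nu mu].
Proof.
split; first exact: minimizer_minimizes.
- move=> nu /(_ mu); rewrite energy_minimizer energy_minimizer_gap => h.
  apply: gap0_same_measure; apply/eqP; rewrite eq_le gap_ge0 andbT.
  by rewrite -(leeD2lE _ _ (x := c%:E)) ?adde0.
- move=> nu; rewrite energy_minimizer => hcv; apply: gap_cvg_weak.
  have -> : (fun n => gap w a (nu n) mu) = (fun n => energy (nu n) - c%:E)%E.
    by apply/funext => n; rewrite energy_minimizer_gap addeAC subee// add0e.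
  rewrite -(@subee _ c%:E)//; apply: cvgeB => //; exact: cvg_cst.
Qed.

End Minimizer.

(** * Pushforwards and products of measures *)

Lemma pushforward_measure_exists d1 d2 (T1 : measurableType d1) (T2 : measurableType d2)
  (R : realType) (m : {measure set T1 -> \bar R}) (f : T1 -> T2) :
  measurable_fun setT f ->
  exists m' : {measure set T2 -> \bar R}, forall A, m' A = m (f @^-1` A).
Proof.
move=> mf.
by unshelve eexists (pushforward m f : {measure set T2 -> \bar R}).
Qed.

Lemma pushforward_probability d1 d2 (T1 : measurableType d1) (T2 : measurableType d2)
  (R : realType) (P : probability T1 R) (f : T1 -> T2) :
  measurable_fun setT f ->
  exists m' : probability T2 R, forall A, m' A = P (f @^-1` A).
Proof.
move=> mf.
pose g : {mfun T1 >-> T2} := HB.pack f (isMeasurableFun.Build _ _ _ _ _ mf).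
by exists (distribution P g).
Qed.

Lemma measurable_fun_nat_prod d (T : measurableType d) d' (Y : measurableType d')
  (f : nat * T -> Y) :
  (forall k, measurable_fun setT (fun t => f (k, t))) -> measurable_fun setT f.
Proof.
move=> mf _ B mB; rewrite setTI.
rewrite (_ : _ @^-1` _ = \bigcup_k ([set k] `*` ((fun t => f (k, t)) @^-1` B))).
  apply: bigcupT_measurable => k; apply: measurableX => //.
  by rewrite -[X in measurable X]setTI; exact: mf.
apply/seteqP; split=> [[k t] /= ft|[k t] [j _ [/= -> //]]].
by exists k.
Qed.

Lemma mnormalizeE d (T : measurableType d) (R : realType)
    (mu : {measure set T -> \bar R}) (P : probability T R) (r : R) (U : set T) :
  mu setT = r%:E -> r != 0 -> mnormalize mu P U = (mu U * (r^-1)%:E)%E.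
Proof. by move=> mur r0; rewrite /mnormalize mur eqe (negPf r0). Qed.

HB.instance Definition _ (R : realType) :=
  Measure_isSigmaFinite.Build _ _ _ (@counting nat R) (sigma_finite_counting R).

Definition nat_counting (R : realType) : {sigma_finite_measure set nat -> \bar R} :=
  @counting nat R.

(* The library makes a product of measures sigma-finite only when both factors
   are sub-probabilities. *)
Section ProductWithProbability.
Context d1 d2 (T1 : measurableType d1) (T2 : measurableType d2) (R : realType).
Variables (m : {sigma_finite_measure set T1 -> \bar R}) (P : probability T2 R).

Definition probability_product : set (T1 * T2)%type -> \bar R := (m \x P)%E.

HB.instance Definition _ := Measure.copy probability_product (m \x P)%E.

Let probability_product_sigma_finite : sigma_finite setT probability_product.
Proof.
have [F FT Fm] := sigma_finiteT m; exists (fun n => F n `*` setT).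
  apply/esym/seteqP; split=> // -[x y] _.
  by have : [set: T1] x by []; rewrite FT => -[n _ Fx]; exists n.
move=> n; have [mF Foo] := Fm n; split; first exact: measurableX.
rewrite [X in (X < _)%E](product_measure1E m P)//.
by rewrite [X in (_ * X)%E](@probability_setT _ _ _ P) mule1.
Qed.

HB.instance Definition _ := Measure_isSigmaFinite.Build _ _ _ probability_product
  probability_product_sigma_finite.

End ProductWithProbability.

(** * Non-archimedean fields *)

Section Nonarchimedean.
Context {R : realType} {L : fieldType} (v : absolute_value R L).
Hypothesis v_nontrivial : nontrivial_absv v.
Hypothesis L_locally_compact : locally_compact [set: valued v].
Hypothesis na : nonarchimedean v.
Local Notation P := (P1 v).
Local Notation X := (borel (P1 v)).

Let compact_integers : compact [set x : valued v | v x <= 1].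
Proof. exact: compact_absv_ball. Qed.

Lemma na_triangle x y z : v (x - z) <= Num.max (v (x - y)) (v (y - z)).
Proof. by rewrite -(subrKA y); exact: na. Qed.

Lemma na_eq x y : v (x - y) < v x -> v y = v x.
Proof.
move=> xy; apply/eqP; rewrite eq_le; apply/andP; split.
  have := na (- (x - y)) x; rewrite absvN opprB subrK => /le_trans; apply.
  by rewrite ge_max lexx ltW.
have := na (x - y) y; rewrite subrK le_max => /orP[|//].
by rewrite leNgt xy.
Qed.

Lemma closed_maximal_ideal : closed [set x : valued v | v x < 1].
Proof.
rewrite (_ : [set x | _] = ~` [set x : valued v | 1 <= v x]); last first.
  by apply/seteqP; split=> x /=; rewrite ltNge => /negP.
apply: open_closedC; rewrite openE => x /= x1; apply/nbhs_absv; exists 1 => // y xy /=.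
by rewrite (@na_eq x y)// (lt_le_trans xy).
Qed.

(** The maximal ideal is closed in the compact ring of integers, so the absolute value attains a
    maximum on it, which is positive because small nonzero elements exist. This makes the value
    group discrete. *)
Lemma uniformizer : exists c : L,
  [/\ 0 < v c, v c < 1 & forall x, v x < 1 -> v x <= v c].
Proof.
have cM : compact [set x : valued v | v x < 1].
  apply: (subclosed_compact closed_maximal_ideal compact_integers).
  by move=> x /= /ltW.
have [|c + cmax] := @compact_EVT_max (valued v) R v _ _ cM
    (continuous_subspaceT (@absv_continuous _ _ v)).
  by exists 0; rewrite /= absv0.
rewrite inE/= => c1; exists c; split => //; last first.
  by move=> x x1; apply: (cmax x); rewrite inE.
have [d d0 d1] := small_absv v_nontrivial ltr01.
apply: lt_le_trans (cmax d _); last by rewrite inE.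
by rewrite absv_gt0.
Qed.

Lemma wedge_na (x y : L * L) : v (wedge x y) <= maxnorm v x * maxnorm v y.
Proof.
apply: le_trans (na _ _) _; rewrite absvN !absvM ge_max.
by apply/andP; split; [|rewrite mulrC]; apply: ler_pM; rewrite ?absv_ge0// /maxnorm le_max lexx ?orbT.
Qed.

Lemma wedge_ultra (x y z : L * L) :
  v (wedge x z) * maxnorm v y <=
  Num.max (v (wedge x y) * maxnorm v z) (v (wedge y z) * maxnorm v x).
Proof.
rewrite {1}/maxnorm maxr_pMr ?absv_ge0// ge_max -!absvM; apply/andP; split.
  have -> : wedge x z * y.1 = wedge x y * z.1 + wedge y z * x.1.
    by rewrite /wedge; ring.
  apply: le_trans (na _ _) _; rewrite !absvM ge_max.
  by apply/andP; split; rewrite le_max ler_wpM2l ?absv_ge0 ?orbT// le_max lexx.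
have -> : wedge x z * y.2 = wedge x y * z.2 + wedge y z * x.2.
  by rewrite /wedge; ring.
apply: le_trans (na _ _) _; rewrite !absvM ge_max.
by apply/andP; split; rewrite le_max ler_wpM2l ?absv_ge0 ?orbT// le_max lexx orbT.
Qed.

Lemma delta_ultra (q p r : P) : delta p r <= Num.max (delta p q) (delta q r).
Proof.
have := maxnorm_gt0 v (hcoord_neq0 p); have := maxnorm_gt0 v (hcoord_neq0 q).
have := maxnorm_gt0 v (hcoord_neq0 r).
have := wedge_ultra (hcoord p) (hcoord q) (hcoord r).
rewrite !deltaE; set p1 := maxnorm v (hcoord p); set q1 := maxnorm v (hcoord q).
set r1 := maxnorm v (hcoord r); set A := v _; set B := v _; set C := v _.
move=> ABC r0 q0 p0.
have e1 : B / (p1 * q1) = B * r1 / (p1 * q1 * r1) by field; rewrite !gt_eqF.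
have e2 : C / (q1 * r1) = C * p1 / (p1 * q1 * r1) by field; rewrite !gt_eqF.
rewrite e1 e2 -maxr_pMl; last by rewrite invr_ge0 !mulr_ge0 ?ltW.
have -> : A / (p1 * r1) = A * q1 / (p1 * q1 * r1) by field; rewrite !gt_eqF.
by rewrite ler_pM2r// invr_gt0 !mulr_gt0.
Qed.

Lemma delta_le1 (p q : P) : delta p q <= 1.
Proof.
rewrite deltaE ler_pdivrMr ?mul1r ?wedge_na//.
by rewrite mulr_gt0// maxnorm_gt0// hcoord_neq0.
Qed.

Lemma ball_sub (p q : P) r : delta p q <= r ->
  [set x | delta p x <= r] = [set x | delta q x <= r].
Proof.
move=> pq; apply/seteqP; split=> x /= h.
  by apply: le_trans (delta_ultra p q x) _; rewrite ge_max deltaC pq.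
by apply: le_trans (delta_ultra q p x) _; rewrite ge_max pq.
Qed.

(** The charts of [hpoint_normalized] overlap where both coordinates have the same absolute value;
    assigning these points to the first chart makes the charts disjoint, so that masses can be
    added. *)
Lemma hpoint_na (p : P) : (exists2 z, v z <= 1 & p = hpoint v z 1) \/
  (exists2 z, v z < 1 & p = hpoint v 1 z).
Proof.
have [|[z z1 ->]] := hpoint_normalized p; first by left.
move: z1; rewrite le_eqVlt => /orP[/eqP z1|z1]; last by right; exists z.
have z0 : z != 0 by rewrite -(absv_gt0 v) z1.
left; exists z^-1; first by rewrite absvV z1 invr1.
by rewrite -(@hpoint_scale _ _ v z z^-1 1) ?(pair1_neq0 _).1// mulfV// mulr1.
Qed.

Variable c : L.
Local Notation t := (v c).
Hypothesis t_gt0 : 0 < t.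
Hypothesis t_lt1 : t < 1.
Hypothesis t_max : forall x, v x < 1 -> v x <= t.

Let c_neq0 : c != 0.
Proof. by rewrite -(absv_gt0 v). Qed.

(** With [n.+1] the least exponent such that [t ^ n.+1 <= v x], the quotient [x / c ^ n] has
    absolute value below 1, hence at most [t]. *)
Lemma absv_power x : x != 0 -> v x <= 1 -> exists n, v x = t ^+ n.
Proof.
move=> x0 x1.
have ex : exists n, t ^+ n <= v x.
  have : (fun n => t ^+ n) @ \oo --> 0 by apply: cvg_expr; rewrite ger0_norm ?absv_ge0.
  move=> /cvgrPdist_lt/(_ (v x)); rewrite absv_gt0 => /(_ x0)[n _ /(_ n (leqnn n))].
  rewrite sub0r normrN ger0_norm ?exprn_ge0 ?absv_ge0// => h.
  by exists n; rewrite ltW.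
case: (ex_minnP ex) => -[|n] nx nmin; [exists 0%N|exists n.+1].
  by apply/eqP; rewrite expr0 eq_le x1 -[X in X <= _](expr0 t).
apply/eqP; rewrite eq_le nx andbT.
have nx' : v x < t ^+ n.
  by rewrite ltNge; apply/negP => /nmin; rewrite ltnn.
have cn0 : 0 < t ^+ n by rewrite exprn_gt0.
have : v (x / c ^+ n) <= t.
  by apply: t_max; rewrite absvM absvV absvX ltr_pdivrMr// mul1r.
by rewrite absvM absvV absvX ler_pdivrMr// -exprS.
Qed.

Lemma delta_power (p q : P) : p != q -> exists n, delta p q = t ^+ n.
Proof.
move=> pq; have [c1 [d1 [cd1 pE]]] := hpoint_norm1 p.
have [c2 [d2 [cd2 qE]]] := hpoint_norm1 q.
have h c' d' : Num.max (v c') (v d') = 1 -> (c', d') != (0, 0).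
  move=> cd; apply/eqP => -[c0 d0]; move: cd.
  by rewrite c0 d0 absv0 maxxx => /esym/eqP; rewrite oner_eq0.
have dE : delta p q = v (wedge (c1, d1) (c2, d2)).
  rewrite pE qE delta_hpoint ?h// chordalE /maxnorm/= cd1 cd2.
  by rewrite mulr1 divr1.
rewrite dE; apply: absv_power; last by rewrite -dE delta_le1.
apply/eqP => w0; move/eqP: pq; apply; apply: delta_eq0.
by rewrite dE w0 absv0.
Qed.

(** This is [ln q], because [residue_field_card] gives [q * t = 1]. *)
Let e : R := - ln t.

Lemma e_gt0 : 0 < e.
Proof. by rewrite /e oppr_gt0 ln_lt0// t_gt0. Qed.

Lemma log_delta_series (p q : P) : (- lne (delta p q)%:E =
  \sum_(k <oo) (e * (delta p q <= t ^+ k.+1)%R%:R)%:E)%E.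
Proof.
have e0 := e_gt0.
have pos k : (0 <= (e * (delta p q <= t ^+ k.+1)%R%:R)%:E)%E.
  by rewrite lee_fin mulr_ge0 ?ler0n// ltW.
have [pq|pq] := eqVneq p q.
  rewrite pq delta_refl le0_lneNy//=.
  apply/esym/eqyP => A A0.
  (* On the diagonal every indicator is 1, and the partial sum [N * e] exceeds the given bound
     [A]. *)
  pose N := (Num.truncn (`|A| / e)).+1.
  apply: le_trans (nneseries_lim_ge (P := xpredT) N _); last by move=> n _ _; rewrite lee_fin mulr_ge0 ?ler0n// ltW.
  rewrite sumEFin lee_fin.
  rewrite (eq_bigr (fun=> e)) => [|k _]; last by rewrite exprn_ge0 ?mulr1// ltW.
  rewrite big_const_nat iter_addr_0 subn0 -mulr_natr mulrC -ler_pdivrMr//.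
  apply: le_trans (ltW (truncnS_gt (`|A| / e))).
  by rewrite ler_pM2r ?invr_gt0// ler_norm.
have [n dn] := delta_power pq.
rewrite (nneseries_split 0 n) ?add0n//.
rewrite [X in (_ + X)%E]eseries0 ?adde0; last first.
  move=> k nk _; rewrite dn leNgt ltr_iXn2l ?t_gt0//.
  by rewrite ltnS nk mulr0.
rewrite dn lne_EFin ?exprn_gt0// lnXn// sumEFin big_mkord.
rewrite (eq_bigr (fun=> e)) => [|k _]; last by rewrite ler_iXn2l ?t_gt0// ltn_ord mulr1.
by rewrite sumr_const card_ord /e mulNrn.
Qed.

(** * The equilibrium measure and the residue field from Haar measure *)

Section HaarMeasure.
Variable m : {measure set (borel (valued v)) -> \bar R}.
Hypothesis m_haar : is_haar m.
Hypothesis m_mod : forall (a : L) (A : set (borel (valued v))),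
  a != 0 -> measurable A -> m [set a * x | x in A] = ((v a)%:E * m A)%E.

Let D (a : L) r : set (borel (valued v)) := [set x | v (a - x) <= r].

Lemma disc_meas a r : measurable (D a r).
Proof.
rewrite (_ : D a r = ~` [set x : valued v | r < v (a - x)]).
  apply: measurableC; apply: open_borel; rewrite openE => x /= ax.
  apply/nbhs_absv; exists (v (a - x) - r); first by rewrite subr_gt0.
  move=> y xy /=; rewrite -(ltrD2r (v (x - y))); apply: lt_le_trans (_ : v (a - x) <= _).
    by rewrite -ltrBrDl.
  by rewrite (absv_distC v x y); exact: absv_dist_triangle.
by apply/seteqP; split=> x /=; rewrite /D/= leNgt => /negP.
Qed.

Let mO := m (D 0 1).

Lemma disc_measure a n : m (D a (t ^+ n)) = ((t ^+ n)%:E * mO)%E.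
Proof.
have cn : c ^+ n != 0 by rewrite expf_neq0.
have tn : 0 < t ^+ n by rewrite exprn_gt0.
have im0 : [set c ^+ n * x | x in D 0 1] = D 0 (t ^+ n).
  apply/seteqP; split=> x /=; rewrite /D/= sub0r absvN.
    by move=> [y]; rewrite sub0r absvN => y1 <-; rewrite absvM absvX ler_piMr// ltW.
  move=> xn; exists (x / c ^+ n); last by rewrite mulrCA divff ?mulr1.
  by rewrite sub0r absvN absvM absvV absvX ler_pdivrMr// mul1r.
have ima : [set a + x | x in [set c ^+ n * x | x in D 0 1]] = D a (t ^+ n).
  rewrite im0; apply/seteqP; split=> x; rewrite /D/=.
    by move=> [y]; rewrite sub0r absvN => yn <-; rewrite opprD addrA subrr sub0r absvN.
  move=> ax; exists (x - a); last by rewrite addrC subrK.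
  by rewrite sub0r absvN absv_distC.
rewrite -ima (haar_translation m_haar) ?im0; last exact: disc_meas.
by rewrite -im0 m_mod// ?absvX//; exact: disc_meas.
Qed.

Lemma mO_fin : mO \is a fin_num.
Proof.
rewrite ge0_fin_numE ?measure_ge0// /mO (_ : D 0 1 = [set x : valued v | v x <= 1]).
  exact: (haar_compact m_haar compact_integers).
by apply/seteqP; split=> x; rewrite /D/= sub0r absvN.
Qed.

(** The dilates of the unit ball by the inverses of [c ^ k] exhaust [L], so if the ball were null
    the whole Haar measure would vanish. *)
Lemma mO_gt0 : (0 < mO)%E.
Proof.
rewrite lt0e measure_ge0 andbT; apply/eqP => mO0.
have /negP := haar_nonzero m_haar; apply; apply/eqP.
have -> : [set: borel (valued v)] = \bigcup_k [set (c ^+ k)^-1 * x | x in D 0 1].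
  apply/esym/seteqP; split => // x _.
  have [->|x0] := eqVneq x 0.
    by exists 0%N => //; exists 0; rewrite ?mulr0// /D/= subrr absv0.
  have : (fun n => t ^+ n) @ \oo --> 0 by apply: cvg_expr; rewrite ger0_norm ?absv_ge0.
  have vx : 0 < (v x)^-1 by rewrite invr_gt0 absv_gt0.
  move=> /cvgrPdist_lt/(_ _ vx)[n _ /(_ n (leqnn n))].
  rewrite sub0r normrN ger0_norm ?exprn_ge0 ?absv_ge0// => h.
  exists n => //; exists (c ^+ n * x); last by rewrite mulKf// expf_neq0.
  rewrite /D/= sub0r absvN absvM absvX ltW//.
  by rewrite -(mulVf (_ : v x != 0)) ?ltr_pM2r ?absv_gt0 ?gt_eqF ?absv_gt0.
have mm k : measurable ([set (c ^+ k)^-1 * x | x in D 0 1] : set (borel (valued v))).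
  rewrite (_ : [set _ | _ in _] = D 0 ((t ^+ k)^-1)); first exact: disc_meas.
  have ck : c ^+ k != 0 by rewrite expf_neq0.
  have tk : 0 < t ^+ k by rewrite exprn_gt0.
  apply/seteqP; split=> x /=; rewrite /D/= sub0r absvN.
    move=> [y]; rewrite sub0r absvN => y1 <-; rewrite absvM absvV absvX.
    by rewrite ler_piMr// invr_ge0 ltW.
  move=> xn; exists (c ^+ k * x); last by rewrite mulKf.
  by rewrite sub0r absvN absvM absvX -(mulfV (lt0r_neq0 tk)) ler_pM2l.
apply/eqP; rewrite -measure_le0.
apply: le_trans (@measure_sigma_subadditive _ R _ m _ _ mm (bigcupT_measurable _ mm) (@subset_refl _ _)) _.
rewrite eseries0// => k _ _.
rewrite m_mod ?invr_eq0 ?expf_neq0//; last exact: disc_meas.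
by rewrite -/mO mO0 mule0.
Qed.

Let h1 : borel (valued v) -> X := fun z => hpoint v z 1.
Let h2 : borel (valued v) -> X := fun z => hpoint v 1 z.

Let h1_meas : measurable_fun setT h1.
Proof.
apply: borel_measurable_fun => U oU; apply: open_borel.
by have /continuousP := (@chart_continuous _ _ v).1; apply.
Qed.

Let h2_meas : measurable_fun setT h2.
Proof.
apply: borel_measurable_fun => U oU; apply: open_borel.
by have /continuousP := (@chart_continuous _ _ v).2; apply.
Qed.

(* Haar measure on the two charts [(z : 1)], [|z| <= 1], and [(1 : z)],
   [|z| < 1], normalized. *)
Lemma equilibrium_exists : exists mu : probability X R, forall p k,
  mu [set q | delta p q <= t ^+ k.+1] = (t ^+ k.+1 / (1 + t))%:E.
Proof.
have [m1 m1E] := pushforward_measure_exists (mrestr m (disc_meas 0 1)) h1_meas.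
have [m2 m2E] := pushforward_measure_exists (mrestr m (disc_meas 0 t)) h2_meas.
pose m3 : {measure set X -> \bar R} := measure_add m1 m2.
have m3E A : m3 A = (m (h1 @^-1` A `&` D 0%R 1%R) + m (h2 @^-1` A `&` D 0%R t))%E.
  by rewrite [LHS]measure_addE m1E m2E.
have mOf : mO = (fine mO)%:E by rewrite fineK// mO_fin.
have f0 : 0 < fine mO by rewrite -lte_fin -mOf mO_gt0.
have m3T : m3 setT = ((1 + t) * fine mO)%:E.
  rewrite m3E !preimage_setT !setTI.
  have := disc_measure 0 1; rewrite expr1 => ->.
  by rewrite -/mO mOf -EFinM -EFinD mulrDl mul1r.
have t1 : 0 < 1 + t by rewrite addr_gt0.
exists (mnormalize m3 (dirac (point : X))) => p k.
have ne0 : (1 + t) * fine mO != 0 by rewrite gt_eqF// mulr_gt0.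
apply: (eq_trans (mnormalizeE _ _ m3T ne0)).
suff -> : m3 [set q | delta p q <= t ^+ k.+1] = ((t ^+ k.+1) * fine mO)%:E.
  by rewrite -EFinM; congr _%:E; field; rewrite !gt_eqF.
have tk1 : t ^+ k.+1 < 1 by rewrite exprn_ilt1// ltW.
have tkt : t ^+ k.+1 <= t by rewrite exprS ler_piMr ?exprn_ile1// ltW.
(* Points of different charts are at distance 1, whereas the radii here are at most [t], so every
   ball lies in a single chart. *)
have cross a b : v a <= 1 -> v b < 1 -> delta (hpoint v a 1) (hpoint v 1 b) = 1.
  move=> a1 b1; rewrite delta_hpoint ?(pair1_neq0 _).1 ?(pair1_neq0 _).2//.
  rewrite chordalE /wedge /maxnorm/= absv1 (max_idPr _)// (max_idPl (ltW b1)).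
  rewrite !mulr1 divr1 absv_distC; have := @na_eq 1 (1 - a * b); rewrite absv1.
  by apply; rewrite opprB addrC subrK absvM; have := absv_ge0 v a; have := absv_ge0 v b; nra.
have inD (a z : L) : v (a - z) <= t ^+ k.+1 -> forall s, v a <= s -> t <= s -> v z <= s.
  move=> az s as_ ts; have := na (z - a) a; rewrite subrK => /le_trans; apply.
  by rewrite ge_max as_ absv_distC (le_trans az)// (le_trans tkt).
have [[a a1 ->]|[b b1 ->]] := hpoint_na p; rewrite m3E.
- rewrite [X in m X + _](_ : _ = D a (t ^+ k.+1)); last first.
    apply/seteqP; split=> z; rewrite /D /h1/= delta_chart1 (max_idPr _)//.
      by move=> [h]; rewrite sub0r absvN => z1; move: h; rewrite (max_idPr z1) mulr1 divr1.
    move=> az; have z1 : v z <= 1 by apply: (inD _ _ az) => //; exact: ltW.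
    by rewrite (max_idPr z1) mulr1 divr1 sub0r absvN.
  rewrite [X in _ + m X](_ : _ = set0) ?measure0 ?adde0; last first.
    apply/seteqP; split=> z //; rewrite /D /h2/= sub0r absvN => -[+ zt].
    by rewrite cross// ?(le_lt_trans zt)// leNgt tk1.
  by rewrite disc_measure -/mO mOf.
- rewrite [X in m X + _](_ : _ = set0) ?measure0 ?add0e; last first.
    apply/seteqP; split=> z //; rewrite /D /h1/= sub0r absvN => -[+ z1].
    by rewrite deltaC cross// leNgt tk1.
  rewrite [X in m X](_ : _ = D b (t ^+ k.+1)); last first.
    apply/seteqP; split=> z; rewrite /D /h2/= delta_chart2 (max_idPl (ltW b1)).
      move=> [h]; rewrite sub0r absvN => zt.
      have z1 : v z <= 1 by rewrite (le_trans zt)// ltW.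
      by move: h; rewrite (max_idPl z1) mulr1 divr1.
    move=> bz; have zt : v z <= t by apply: (inD _ _ bz) => //; exact: t_max.
    have z1 : v z <= 1 by rewrite (le_trans zt)// ltW.
    by rewrite (max_idPl z1) mulr1 divr1 sub0r absvN.
  by rewrite disc_measure -/mO mOf.
Qed.

(** The residue classes are open and cover the compact ring of integers, so there are finitely many.
    They partition the ring, and each is a ball of radius [t], with measure [t] times that of the
    ring. *)
Lemma residue_field_card : exists q : nat,
  (residue_field v #= `I_q)%card /\ q%:R * t = 1.
Proof.
have classE a : [set y | v (y - a) < 1] = D a t.
  apply/seteqP; split=> y; rewrite /D/= absv_distC; first exact: t_max.
  by move=> h; exact: le_lt_trans t_lt1.
have classD a b : v (b - a) < 1 -> [set y | v (y - a) < 1] = [set y | v (y - b) < 1].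
  move=> ab; apply/seteqP; split=> y /= h.
    by apply: le_lt_trans (na_triangle y a b) _; rewrite gt_max h absv_distC.
  by apply: le_lt_trans (na_triangle y b a) _; rewrite gt_max h.
have fin : finite_set (residue_field v).
  have := compact_integers.
  rewrite compact_cover => /(_ (set L) (residue_field v) id).
  case.
  - move=> _ [a a1 <-]; rewrite openE => x /= xa; apply/nbhs_absv; exists 1 => // y xy.
    by apply: le_lt_trans (na_triangle y x a) _; rewrite gt_max absv_distC xy.
  - move=> x /= x1; exists [set y | v (y - x) < 1]; first by exists x.
    by rewrite /= subrr absv0.
  move=> D' D'r D'c; have fD : finite_set [set` D'] := finite_fset D'.
  apply: sub_finite_set fD.
  move=> _ [a a1 <-]; have [C CD Ca] := D'c a a1.
  have := D'r _ CD; rewrite inE => -[b b1 Cb].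
  by move: CD Ca; rewrite -Cb /= => CD ab; rewrite -(classD _ _ ab).
have [q qE] := fin; exists q; split => //.
have := @measure_fin_bigcup _ _ _ m (set L) (residue_field v) id fin.
have -> : \bigcup_(C in residue_field v) C = D 0 1.
  apply/seteqP; split=> x; rewrite /D/= sub0r absvN.
    move=> [_ [a a1 <-]] /= xa; have := na (x - a) a; rewrite subrK => /le_trans; apply.
    by rewrite ge_max a1 ltW.
  by move=> x1; exists [set y | v (y - x) < 1]; [exists x|rewrite /= subrr absv0].
move=> H; have {H} := H _ _; rewrite -/mO.
have mOf : mO = (fine mO)%:E by rewrite fineK// mO_fin.
have f0 : 0 < fine mO by rewrite -lte_fin -mOf mO_gt0.
have -> : (\sum_(i \in residue_field v) m i = ((t * fine mO) *+ q)%:E)%E.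
  rewrite fsbig_finite// (eq_big_seq (fun=> (t * fine mO)%:E)); last first.
    move=> C; rewrite in_fset_set// inE => -[a a1 <-]; rewrite classE.
    by have := disc_measure a 1; rewrite expr1 => ->; rewrite EFinM -mOf.
  rewrite sumEFin big_const_seq count_predT iter_addr_0; congr ((_ *+ _)%:E).
  by apply/card_eq_fsetP; rewrite fset_setK.
move=> H; have : mO = ((t * fine mO) *+ q)%:E.
  apply: H.
  - move=> _ _ [a a1 <-] [b b1 <-] [x [/= xa xb]]; apply: classD.
    by apply: le_lt_trans (na_triangle b x a) _; rewrite gt_max absv_distC xb.
  - by move=> _ [a a1 <-]; rewrite classE; exact: disc_meas.
rewrite mOf => -[] h.
have : (q%:R * t - 1) * fine mO = 0.
  rewrite -mulr_natl in h.
  by rewrite mulrBl mul1r [X in _ - X]h mulrA subrr.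
by move/eqP; rewrite mulf_eq0 (gt_eqF f0) orbF subr_eq0 => /eqP.
Qed.

End HaarMeasure.

(** * The energy kernel as a superposition of balls *)

Section EquilibriumMeasure.
Variable mu : probability X R.
Hypothesis mu_ball : forall p k,
  mu [set q | delta p q <= t ^+ k.+1] = (t ^+ k.+1 / (1 + t))%:E.

Let t1 : 0 < 1 + t. Proof. by rewrite addr_gt0. Qed.

Let tk (k : nat) : 0 < t ^+ k. Proof. by rewrite exprn_gt0. Qed.

Let weight k : R := (1 + t) / t ^+ k.+1.

Let weight_gt0 k : 0 < weight k. Proof. by rewrite divr_gt0. Qed.

(** The parameter is a level and a center, the center being distributed according to [mu] itself.
    [weight] is the reciprocal of the mass of a ball, and the square root is there because a Gram
    kernel multiplies two features. *)
Definition ball_feature (z : (nat * X) * X) : R :=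
  Num.sqrt (e * weight z.1.1) * (delta z.1.2 z.2 <= t ^+ z.1.1.+1)%R%:R.

Local Notation a := ball_feature.

Let w : {sigma_finite_measure set (nat * X)%type -> \bar R} :=
  probability_product (nat_counting R) mu.

Lemma ball_feature_ge0 z : 0 <= a z.
Proof. by rewrite /a mulr_ge0// sqrtr_ge0. Qed.

(** Finitely many balls of radius [r] cover the compact space, and by the ultrametric inequality two
    points are within [r] iff one of these balls contains both. The set is thus a finite union of
    rectangles, hence measurable for the product sigma-algebra. *)
Lemma delta_le_meas2 r : 0 < r -> measurable ([set z | delta z.1 z.2 <= r] : set (X * X)).
Proof.
move=> r0; have := compact_P1 v_nontrivial L_locally_compact.
rewrite compact_cover => /(_ P setT (fun p => [set q | delta p q < r])).
case.
- by move=> p _; exact: open_delta_ball.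
- by move=> p _; exists p => //=; rewrite delta_refl.
move=> D _ Dc; have fD : finite_set [set` D] := finite_fset D.
rewrite (_ : [set _ | _] = \bigcup_(p in [set` D])
    ([set q | delta p q <= r] `*` [set q | delta p q <= r])).
  by apply: fin_bigcup_measurable => // p _; apply: measurableX; exact: delta_le_meas.
apply/seteqP; split=> [[x y] /= xy|[x y] [p _ [/= px py]]].
  have [p pD /= px] := Dc x I; exists p => //; split=> /=; first exact: ltW.
  by apply: le_trans (delta_ultra x p y) _; rewrite ge_max (ltW px).
by apply: le_trans (delta_ultra p x y) _; rewrite ge_max deltaC px.
Qed.

Lemma ball_feature_meas : measurable_fun setT a.
Proof.
pose f (z : nat * (X * X)) : R :=
  Num.sqrt (e * weight z.1) * (delta z.2.1 z.2.2 <= t ^+ z.1.+1)%R%:R.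
have mf : measurable_fun setT f.
  apply: measurable_fun_nat_prod => k; rewrite /f/=.
  apply: measurable_funM; first exact: measurable_cst.
  rewrite (_ : (fun x => _) = \1_[set z : X * X | delta z.1 z.2 <= t ^+ k.+1]).
    by apply: measurable_indic; exact: delta_le_meas2.
  by apply/funext => z; rewrite indicE mem_setE.
have -> : a = f \o (fun z : (nat * X) * X => (z.1.1, (z.1.2, z.2))) by [].
apply: (measurableT_comp mf); apply: measurable_fun_pair.
  exact: measurableT_comp measurable_fst measurable_fst.
apply: measurable_fun_pair; last exact: measurable_snd.
exact: measurableT_comp measurable_snd measurable_fst.
Qed.

Lemma ball_feature_bnd s : exists M, forall x, a (s, x) <= M.
Proof.
exists (Num.sqrt (e * weight s.1)) => x; rewrite /a/=.
by case: (delta _ _ <= _); rewrite ?mulr1// mulr0 sqrtr_ge0.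
Qed.

Let B (x : P) k : set X := [set q | delta x q <= t ^+ k.+1].

Let ind_meas x k : measurable_fun setT (fun u : X => ((delta x u <= t ^+ k.+1)%R%:R : R)).
Proof.
rewrite (_ : (fun u => _) = \1_(B x k)).
  by apply: measurable_indic; exact: delta_le_meas.
by apply/funext => z; rewrite indicE mem_setE.
Qed.

Let scaled_ball_integral (nu : probability X R) r x k : 0 <= r ->
  (\int[nu]_u (r * (delta x u <= t ^+ k.+1)%R%:R)%:E = r%:E * nu (B x k))%E.
Proof.
move=> r0; under eq_integral do rewrite EFinM.
have mi : measurable_fun setT (fun u : X => ((delta x u <= t ^+ k.+1)%R%:R : R)%:E).
  exact/measurable_EFinP.
have i0 (u : X) : (0 <= ((delta x u <= t ^+ k.+1)%R%:R : R)%:E)%E by rewrite lee_fin.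
rewrite (nn_integralZ nu r0 i0 mi); congr (_ * _)%E.
have mB : measurable (B x k) by exact: delta_le_meas.
rewrite -[in RHS](setIT (B x k)) -integral_indic//.
by apply: eq_integral => u _; rewrite indicE mem_setE.
Qed.

Let feature_const (nu : probability X R) k u : feature a nu (k, u) =
  ((Num.sqrt (e * weight k))%:E * nu (B u k))%E.
Proof. by rewrite /feature/= /a/= scaled_ball_integral// sqrtr_ge0. Qed.

Let scaled_mu_integral r x k : 0 <= r ->
  (\int[mu]_u (r * (delta x u <= t ^+ k.+1)%R%:R)%:E = (r * (t ^+ k.+1 / (1 + t)))%:E)%E.
Proof. by move=> r0; rewrite scaled_ball_integral// mu_ball. Qed.

(* In an ultrametric space the ball of radius [r] around [u] contains [x] and
   [y] iff [delta x y <= r] and [delta u x <= r]; integrating over [u] leaves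
   the terms of [log_delta_series]. *)
Lemma ball_gram x y : (- lne (delta x y)%:E + 0%:E + 0%:E = gram w a (x, y))%E.
Proof.
rewrite !adde0 log_delta_series /gram /w.
have e0 := e_gt0.
rewrite fubini_tonelli1//=; last 2 first.
- apply/measurable_EFinP; apply: measurable_funM;
    apply: (measurableT_comp ball_feature_meas); exact: measurable_fun_pair.
- by move=> z; rewrite lee_fin mulr_ge0// ball_feature_ge0.
rewrite ge0_integral_count; last first.
  by move=> k; apply: integral_ge0 => u _; rewrite lee_fin mulr_ge0// ball_feature_ge0.
apply: eq_eseriesr => k _; rewrite /fubini_F /a/=.
have ew : 0 <= e * weight k by rewrite mulr_ge0 ?ltW.
transitivity (\int[mu]_u ((e * weight k * (delta x y <= t ^+ k.+1)%R%:R) *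
    (delta x u <= t ^+ k.+1)%R%:R)%:E)%E.
  have ew1 : 0 <= e * weight k * (delta x y <= t ^+ k.+1)%R%:R.
    exact: mulr_ge0 ew (ler0n _ _).
  rewrite scaled_mu_integral//.
  by congr _%:E; rewrite /weight; field; rewrite !gt_eqF.
apply: eq_integral => u _; congr _%:E.
rewrite [RHS]mulrACA -expr2 sqr_sqrtr// -!mulrA; congr (_ * (_ * _)).
rewrite (deltaC u x) (deltaC u y).
have [xu|xu] := boolP (delta x u <= t ^+ k.+1).
  have /seteqP[h1 h2] := ball_sub xu.
  have -> : (delta x y <= t ^+ k.+1) = (delta y u <= t ^+ k.+1).
    by rewrite (deltaC y u); apply/idP/idP => [/h1|/h2].
  by rewrite [_%:R * _]mulrC.
by rewrite mulr0 mul0r.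
Qed.

(** The sum of the geometric series with terms [e * t ^ k.+1 / (1 + t)]; for [t = 1 / q] it is
    [q * ln q / (q ^ 2 - 1)]. *)
Let kappa : R := e * t / ((1 + t) * (1 - t)).

Lemma ball_potential x :
  (\int[mu]_y (- lne (delta x y)%:E + 0%:E) = (kappa + 0)%:E)%E.
Proof.
have e0 := e_gt0.
under eq_integral do rewrite adde0 log_delta_series.
have mk k : measurable_fun setT (fun y : X => (e * (delta x y <= t ^+ k.+1)%R%:R)%:E).
  by apply/measurable_EFinP; apply: measurable_funM => //; exact: measurable_cst.
rewrite addr0 integral_nneseries//; last first.
  by move=> k y _; rewrite lee_fin mulr_ge0 ?ler0n// ltW.
rewrite (eq_eseriesr (g := fun k => (e * t / (1 + t) * t ^+ k)%:E)); last first.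
  move=> k _; rewrite scaled_mu_integral ?(ltW e0)// exprS; congr _%:E; ring.
have tn : `|t| < 1 by rewrite gtr0_norm.
have := @cvg_geometric_series R (e * t / (1 + t)) t tn.
move=> h; apply/cvg_lim => //.
rewrite (_ : (fun n => _) = EFin \o (series (geometric (e * t / (1 + t)) t))); last first.
  by apply/funext => n; rewrite /= sumEFin.
have -> : kappa = e * t / (1 + t) * (1 - t)^-1 by rewrite /kappa invfM mulrA.
by apply: cvg_EFin => //; exact: nearW.
Qed.

Lemma ball_mollifier eta : 0 < eta ->
  exists (h : nat * X -> R) (ctr : nat * X -> X),
  [/\ (forall s, 0 <= h s) /\ measurable_fun setT h,
      measurable_fun setT ctr,
      (\int[w]_s (h s ^+ 2)%:E < +oo)%E,
      (forall x, (\int[w]_s (h s * a (s, x))%:E = 1)%E) &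
      (forall s x, h s * a (s, x) != 0 -> delta (ctr s) x < eta)].
Proof.
move=> eta0; have e0 := e_gt0.
have [K Ke] : exists K, t ^+ K.+1 < eta.
  have : (fun n => t ^+ n) @ \oo --> 0 by apply: cvg_expr; rewrite ger0_norm ?absv_ge0.
  move=> /cvgrPdist_lt/(_ _ eta0)[n _ /(_ n.+1 (leqnSn n))].
  rewrite sub0r normrN ger0_norm ?exprn_ge0 ?absv_ge0// => h.
  by exists n.
have ew : 0 < e * weight K by rewrite mulr_gt0.
(* Only the level [K] is used; this factor turns the feature into [weight K] times the indicator of
   a ball, which has integral 1. *)
pose hK : R := weight K / Num.sqrt (e * weight K).
have hK0 : 0 <= hK by rewrite divr_ge0 ?sqrtr_ge0// ltW.
pose h (s : nat * X) : R := (s.1 == K)%:R * hK.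
have mh : measurable_fun setT h.
  apply: measurable_fun_nat_prod => k.
  by rewrite (_ : (fun t => h (k, t)) = cst ((k == K)%:R * hK)).
exists h, snd; split.
- by split => // s; rewrite mulr_ge0.
- exact: measurable_snd.
- rewrite fubini_tonelli1//=; last 2 first.
  + by apply/measurable_EFinP; exact: measurable_funX.
  + by move=> z; rewrite lee_fin sqr_ge0.
  rewrite ge0_integral_count; last first.
    by move=> k; apply: integral_ge0 => u _; rewrite lee_fin sqr_ge0.
  rewrite (nneseriesD1 (n := K))//; last first.
    by move=> k _; apply: integral_ge0 => u _; rewrite lee_fin sqr_ge0.
  rewrite eseries0 ?adde0; last first.
    move=> k _ kK; rewrite /fubini_F /h/= (negPf kK) mul0r expr0n.
    exact: probability_integral_cst.
  by rewrite /fubini_F /h/= eqxx mul1r probability_integral_cst ltry.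
- move=> x; rewrite fubini_tonelli1//=; last 2 first.
  + apply/measurable_EFinP; apply: measurable_funM => //.
    by apply: (measurableT_comp ball_feature_meas); exact: measurable_fun_pair.
  + by move=> z; rewrite lee_fin mulr_ge0 ?ball_feature_ge0// mulr_ge0.
  have nn k : (0 <= fubini_F mu (fun s : nat * X => (h s * a (s, x))%:E) k)%E.
    by apply: integral_ge0 => u _; rewrite lee_fin mulr_ge0 ?ball_feature_ge0// mulr_ge0.
  rewrite ge0_integral_count// (nneseriesD1 (n := K))//.
  rewrite eseries0 ?adde0; last first.
    move=> k _ kK; rewrite /fubini_F /h/= (negPf kK).
    under eq_integral do rewrite !mul0r.
    exact: probability_integral_cst.
  rewrite /fubini_F /h /a/= eqxx mul1r.
  under eq_integral do rewrite mulrA deltaC.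
  rewrite scaled_mu_integral; last exact: mulr_ge0 hK0 (sqrtr_ge0 _).
  rewrite /hK divfK ?gt_eqF ?sqrtr_gt0// /weight.
  by congr _%:E; field; rewrite !gt_eqF.
- move=> [k u] x; rewrite /h /a/=; have [->|] := eqVneq k K; last by rewrite !mul0r eqxx.
  case: (boolP (delta u x <= _)) => [ux _|_]; first exact: le_lt_trans ux Ke.
  by rewrite !mulr0 eqxx.
Qed.

Let lne_ge0 (z : X * X) : (0 <= - lne (delta z.1 z.2)%:E + 0%:E)%E.
Proof. by rewrite adde0 oppe_ge0 lne_le0 lee_fin delta_le1. Qed.

Lemma na_minimizer : [/\ minimizes_energy mu,
      forall nu : probability X R, minimizes_energy nu -> same_measure nu mu &
      forall nu : nat -> probability X R,
        energy (nu n) @[n --> \oo] --> energy mu -> weakly_converges nu mu].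
Proof.
apply: (@kernel_minimizer _ _ v v_nontrivial L_locally_compact _ _ w a
  ball_feature_ge0 ball_feature_meas ball_feature_bnd (fun=> 0) 0 0 kappa mu) => //.
- exact: ball_gram.
- exact: ball_potential.
- exact: ball_mollifier.
Qed.

Lemma na_energy : energy mu = kappa%:E.
Proof.
apply: (@energy_minimizer _ _ v _ _ w a
  ball_feature_ge0 ball_feature_meas ball_feature_bnd (fun=> 0) 0 0 kappa mu) => //.
- exact: ball_gram.
- exact: ball_potential.
Qed.

(** A feature of [nu] is a multiple of the mass of a ball, so the gap to [mu] vanishes. Invariance
    of [mu] and uniqueness of the invariant measure both reduce to this. *)
Lemma same_balls_same_measure (nu : probability X R) :
  (forall p k, nu [set q | delta p q <= t ^+ k.+1] = (t ^+ k.+1 / (1 + t))%:E) ->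
  same_measure nu mu.
Proof.
move=> nu_ball.
apply: (@gap0_same_measure _ _ v v_nontrivial L_locally_compact _ _ w a
  ball_feature_ge0 ball_feature_meas ball_feature_bnd mu ball_mollifier).
rewrite /gap integral0_eq// => -[k u] _.
by rewrite !feature_const nu_ball mu_ball subrr expr0n.
Qed.

End EquilibriumMeasure.

End Nonarchimedean.

(** * Isometries of the projective line given by integral matrices *)

Section IntegralMobius.
Context {R : realType} {L : fieldType} (v : absolute_value R L).
Hypothesis na : nonarchimedean v.
Local Notation P := (P1 v).

Let mul2 (M : 'M[L]_2) (x : L * L) : L * L :=
  (M ord0 ord0 * x.1 + M ord0 ord_max * x.2,
   M ord_max ord0 * x.1 + M ord_max ord_max * x.2).

Let det2 (M : 'M[L]_2) : L :=
  M ord0 ord0 * M ord_max ord_max - M ord0 ord_max * M ord_max ord0.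

Let mul2A (M N : 'M[L]_2) x : mul2 M (mul2 N x) = mul2 (M *m N) x.
Proof.
rewrite /mul2/= !mxE !big_ord_recl !big_ord0 !addr0.
rewrite (_ : lift ord0 ord0 = ord_max); last exact: val_inj.
by congr pair; ring.
Qed.

Let mul2_1 x : mul2 1%:M x = x.
Proof. by case: x => x y; rewrite /mul2 !mxE/= !mulr1n !mulr0n !mul1r !mul0r addr0 add0r. Qed.

Let mul2K (M : 'M[L]_2) x : M \in unitmx -> mul2 (invmx M) (mul2 M x) = x.
Proof. by move=> uM; rewrite mul2A mulVmx// mul2_1. Qed.

Let mul2VK (M : 'M[L]_2) x : M \in unitmx -> mul2 M (mul2 (invmx M) x) = x.
Proof. by move=> uM; rewrite mul2A mulmxV// mul2_1. Qed.

Let mul2_neq0 (M : 'M[L]_2) x : M \in unitmx -> x != (0, 0) -> mul2 M x != (0, 0).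
Proof.
move=> uM; apply: contra_neq => M0; rewrite -(mul2K x uM) M0 /mul2/=.
by rewrite !mulr0 !addr0.
Qed.

Lemma mobius_hpoint (M : 'M[L]_2) a b : M \in unitmx -> (a, b) != (0, 0) ->
  mobius M (hpoint v a b) = hpoint v (mul2 M (a, b)).1 (mul2 M (a, b)).2.
Proof.
move=> uM ab; have [s s0 e] := hcoord_hpoint v ab.
rewrite /mobius e -[RHS](@hpoint_scale _ _ v s)//; last first.
  by rewrite -surjective_pairing mul2_neq0.
by rewrite /mul2/=; congr (hpoint v _ _); ring.
Qed.

Lemma mobius_surj (M : 'M[L]_2) (p : P) : M \in unitmx -> exists q : P, mobius M q = p.
Proof.
move=> uM; move: p; apply: hpoint_ind => a b ab.
have ab' : mul2 (invmx M) (a, b) != (0, 0) by rewrite mul2_neq0// unitmx_inv.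
exists (hpoint v (mul2 (invmx M) (a, b)).1 (mul2 (invmx M) (a, b)).2).
by rewrite mobius_hpoint -?surjective_pairing// mul2VK.
Qed.

Let maxnorm_mul2_le (M : 'M[L]_2) x : (forall i j, v (M i j) <= 1) ->
  maxnorm v (mul2 M x) <= maxnorm v x.
Proof.
move=> M1; rewrite {1}/maxnorm/= ge_max.
by apply/andP; split; apply: le_trans (na _ _) _; rewrite ge_max !absvM;
  apply/andP; split; (apply: le_trans (_ : v _ <= _); [exact: ler_piMl (absv_ge0 _ _) (M1 _ _)|rewrite /maxnorm le_max lexx ?orbT]).
Qed.

Let maxnorm_mul2 (M : 'M[L]_2) x : GL2_integers v M ->
  maxnorm v (mul2 M x) = maxnorm v x.
Proof.
move=> [uM M1 V1]; apply/eqP; rewrite eq_le maxnorm_mul2_le//=.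
by rewrite -{1}(mul2K x uM) maxnorm_mul2_le.
Qed.

Let wedge_mul2 (M : 'M[L]_2) x y : wedge (mul2 M x) (mul2 M y) = det2 M * wedge x y.
Proof. by rewrite /wedge /det2 /mul2/=; ring. Qed.

Let det2_le (M : 'M[L]_2) : (forall i j, v (M i j) <= 1) -> v (det2 M) <= 1.
Proof.
move=> M1; apply: le_trans (na _ _) _; rewrite absvN ge_max !absvM.
by rewrite !mulr_ile1 ?absv_ge0.
Qed.

Let det2M (M N : 'M[L]_2) : det2 (M *m N) = det2 M * det2 N.
Proof.
rewrite /det2 !mxE !big_ord_recl !big_ord0 !addr0.
by rewrite (_ : lift ord0 ord0 = ord_max); [ring|exact: val_inj].
Qed.

(** The determinants of [M] and of its inverse have absolute value at most 1 and product 1. *)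
Let absv_det2 (M : 'M[L]_2) : GL2_integers v M -> v (det2 M) = 1.
Proof.
move=> [uM M1 V1]; have := det2M M (invmx M); rewrite mulmxV//.
have -> : det2 1%:M = 1 :> L by rewrite /det2 !mxE/= !mulr1n !mulr0n mulr1 mulr0 subr0.
move=> /(congr1 v); rewrite absvM absv1.
have := det2_le M1; have := det2_le V1.
have := absv_ge0 v (det2 M); have := absv_ge0 v (det2 (invmx M)); nra.
Qed.

(** The numerator of [delta] is multiplied by the determinant, a unit, and the sup norm of the
    coordinates is preserved. *)
Lemma mobius_isometry (M : 'M[L]_2) (p q : P) : GL2_integers v M ->
  delta (mobius M p) (mobius M q) = delta p q.
Proof.
move=> GM; have [uM _ _] := GM.
move: p; apply: hpoint_ind => a b ab; move: q; apply: hpoint_ind => c d cd.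
rewrite !mobius_hpoint// !delta_hpoint -?surjective_pairing ?mul2_neq0//.
by rewrite !chordalE wedge_mul2 absvM absv_det2// mul1r !maxnorm_mul2.
Qed.

Lemma mobius_meas (M : 'M[L]_2) : GL2_integers v M ->
  measurable_fun setT (mobius M : borel P -> borel P).
Proof.
move=> GM; apply: borel_measurable_fun => U oU; apply: open_borel.
rewrite openE => p Up; apply/nbhs_delta.
have /nbhs_delta[e e0 eU] : nbhs (mobius M p) U by exact: open_nbhs_nbhs.
by exists e => // q pq; apply: eU; rewrite mobius_isometry.
Qed.

Lemma mobius_transitive (p : P) : exists2 M : 'M[L]_2, GL2_integers v M &
  mobius M (hpoint v 0 1) = p.
Proof.
have e0 : (0, 1) != (0, 0) :> L * L by rewrite xpair_eqE oner_eq0 andbF.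
have mxE2 (a b c d : L) : let M := \matrix_(i, j) (if i == ord0 then (if j == ord0 then a else b)
   else (if j == ord0 then c else d)) : 'M[L]_2 in
   [/\ M ord0 ord0 = a, M ord0 ord_max = b, M ord_max ord0 = c & M ord_max ord_max = d].
  by rewrite /= !mxE.
have key (M N : 'M[L]_2) : M *m N = 1%:M ->
   (forall i j, v (M i j) <= 1) -> (forall i j, v (N i j) <= 1) -> GL2_integers v M.
  move=> MN M1 N1; have [uM _] := mulmx1_unit MN.
  split => //; have -> : invmx M = N by rewrite -[N]mul1mx -(mulVmx uM) -mulmxA MN mulmx1.
  exact: N1.
have ord2 (i : 'I_2) : i = ord0 \/ i = ord_max.
  by case: i => [[|[|//]] h]; [left|right]; apply: val_inj.
pose mk (a b c d : L) : 'M[L]_2 := \matrix_(i, j) (if i == ord0 then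
   (if j == ord0 then a else b) else (if j == ord0 then c else d)).
have mk1 a b c d : v a <= 1 -> v b <= 1 -> v c <= 1 -> v d <= 1 ->
    forall i j, v (mk a b c d i j) <= 1.
  by move=> a1 b1 c1 d1 i j; rewrite mxE; do 2 case: ifP.
have mkM a b c d a' b' c' d' : a * a' + b * c' = 1 -> a * b' + b * d' = 0 ->
    c * a' + d * c' = 0 -> c * b' + d * d' = 1 -> mk a b c d *m mk a' b' c' d' = 1%:M.
  move=> h1 h2 h3 h4; apply/matrixP => i j; rewrite !mxE !big_ord_recl big_ord0 addr0 !mxE.
  by have [->|->] := ord2 i; have [->|->] := ord2 j; rewrite /= ?mulr1n ?mulr0n.
have v0 : v 0 <= 1 by rewrite absv0.
have v1 : v 1 <= 1 by rewrite absv1.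
have [[z z1 ->]|[z z1 ->]] := hpoint_normalized p.
  have GM : GL2_integers v (mk 1 z 0 1).
    apply: (key _ (mk 1 (- z) 0 1)); last 2 first.
    - exact: mk1.
    - by apply: mk1 => //; rewrite absvN.
    by apply: mkM; ring.
  exists (mk 1 z 0 1) => //; have [uM _ _] := GM.
  by rewrite mobius_hpoint// /mul2/= !mxE/= !mulr0 !add0r !mulr1.
have GM : GL2_integers v (mk 0 1 1 z).
  apply: (key _ (mk (- z) 1 1 0)); last 2 first.
  - exact: mk1.
  - by apply: mk1 => //; rewrite absvN.
  by apply: mkM; ring.
exists (mk 0 1 1 z) => //; have [uM _ _] := GM.
by rewrite mobius_hpoint// /mul2/= !mxE/= !mulr0 !add0r !mulr1.
Qed.

End IntegralMobius.

(** * Invariance, uniqueness and energy over a non-archimedean field *)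

Section NonarchimedeanTheorem.
Context {R : realType} {L : fieldType} (v : absolute_value R L).
Hypothesis v_nontrivial : nontrivial_absv v.
Hypothesis L_locally_compact : locally_compact [set: valued v].
Hypothesis v_modulus : is_haar_modulus v.
Hypothesis na : nonarchimedean v.

Theorem nonarchimedean_equilibrium : exists mu : probability (borel (P1 v)) R,
  [/\ minimizes_energy mu,
      forall nu : probability (borel (P1 v)) R, minimizes_energy nu -> same_measure nu mu &
      forall nu : nat -> probability (borel (P1 v)) R,
        energy (nu n) @[n --> \oo] --> energy mu -> weakly_converges nu mu] /\
  [/\ PGL2_invariant mu,
      forall nu : probability (borel (P1 v)) R, PGL2_invariant nu -> same_measure nu mu &
      exists q : nat, (residue_field v #= `I_q)%card /\
        energy mu = (q%:R * ln q%:R / (q%:R ^+ 2 - 1))%:E].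
Proof.
have [m m_haar m_mod] := v_modulus.
have [c [c0 c1 cmax]] := uniformizer v_nontrivial L_locally_compact na.
have [mu mu_ball] := equilibrium_exists v_nontrivial L_locally_compact na c0 c1 cmax m_haar m_mod.
have same := same_balls_same_measure v_nontrivial L_locally_compact na c0 c1 mu_ball.
exists mu; split; first exact: (na_minimizer v_nontrivial L_locally_compact na c0 c1 cmax mu_ball).
split.
- move=> M GM A mA; have [uM _ _] := GM.
  (* [M] is an isometry, so the image of [mu] under it gives balls the same masses as [mu]. *)
  have [nu nuE] := pushforward_probability mu (mobius_meas na GM).
  rewrite -nuE; apply: same => // p k; rewrite nuE.
  have [p' <-] := mobius_surj p uM.
  rewrite (_ : _ @^-1` _ = [set q | delta p' q <= v c ^+ k.+1]) ?mu_ball//.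
  by apply/seteqP; split=> q /=; rewrite mobius_isometry.
- move=> nu nu_inv; apply: same => p k.
  pose b := fine (nu [set q | delta (hpoint v 0 1) q <= v c ^+ k.+1]).
  have nub q : nu [set x | delta q x <= v c ^+ k.+1] = b%:E.
    have [M GM <-] := mobius_transitive q.
    rewrite -(nu_inv _ GM); last exact: delta_le_meas.
    rewrite (_ : _ @^-1` _ = [set x | delta (hpoint v 0 1) x <= v c ^+ k.+1]).
      by rewrite /b fineK// fin_num_measure//; exact: delta_le_meas.
    by apply/seteqP; split=> x /=; rewrite mobius_isometry.
  (* By transitivity [nu] gives every ball of this radius the same mass [b]. Integrating the
     indicator of the pairs within this radius against [mu] and [nu] in both orders identifies [b]
     with the mass given by [mu]. *)
  rewrite nub.
  have mE : measurable ([set z | delta z.1 z.2 <= v c ^+ k.+1] :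
      set (borel (P1 v) * borel (P1 v))).
    by apply: delta_le_meas2 => //; rewrite exprn_gt0.
  have mI : measurable_fun setT (fun z : borel (P1 v) * borel (P1 v) =>
      (\1_[set z : borel (P1 v) * borel (P1 v) | delta z.1 z.2 <= v c ^+ k.+1] z : R)%:E).
    by apply/measurable_EFinP; exact: measurable_indic.
  have := @tonelli _ _ _ _ _ mu nu _ mI.
  have I1 (rho : probability (borel (P1 v)) R) x : (\int[rho]_y
     (\1_[set z : borel (P1 v) * borel (P1 v) | (delta z.1 z.2 <= v c ^+ k.+1)%R] (x, y) : R)%:E =
     rho [set y | (delta x y <= v c ^+ k.+1)%R])%E.
    have mB := delta_le_meas x (v c ^+ k.+1).
    by rewrite -[in RHS](setIT [set y | _]) -integral_indic//.
  have I2 (rho : probability (borel (P1 v)) R) y : (\int[rho]_x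
     (\1_[set z : borel (P1 v) * borel (P1 v) | (delta z.1 z.2 <= v c ^+ k.+1)%R] (x, y) : R)%:E =
     rho [set x | (delta y x <= v c ^+ k.+1)%R])%E.
    have mB := delta_le_meas y (v c ^+ k.+1).
    rewrite -[in RHS](setIT [set x | _]) -integral_indic//.
    apply: eq_integral => x _; rewrite !indicE.
    suff -> : ((x, y) \in [set z : borel (P1 v) * borel (P1 v) | delta z.1 z.2 <= v c ^+ k.+1]) =
      (x \in [set x | delta y x <= v c ^+ k.+1]) by [].
    by apply/idP/idP; rewrite !inE /= deltaC.
  under eq_integral do rewrite I1 nub.
  under [RHS]eq_integral do rewrite I2 mu_ball.
  rewrite !probability_integral_cst; apply => z.
  by rewrite lee_fin.
- have [q [qc qt]] := residue_field_card v_nontrivial L_locally_compact na c0 c1 cmax m_haar m_mod.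
  exists q; split => //.
  rewrite (na_energy v_nontrivial L_locally_compact na c0 c1 cmax mu_ball).
  have q0 : 0 < q%:R :> R.
    by rewrite lt0r ler0n andbT; apply: contra_eq_neq qt => ->; rewrite mul0r eq_sym oner_eq0.
  have -> : v c = q%:R^-1 by apply: (mulfI (lt0r_neq0 q0)); rewrite qt divff// gt_eqF.
  rewrite lnV ?posrE// opprK; congr _%:E.
  have q1 : 1 < q%:R :> R by rewrite -[X in X < _]qt gtr_pMr.
  have : q%:R ^+ 2 - 1 != 0 :> R by rewrite subr_sqr_1 mulf_neq0// ?subr_eq0 gt_eqF// addr_gt0.
  by move=> q2; field; rewrite q2 !gt_eqF// ?subr_gt0// addr_gt0.
Qed.

End NonarchimedeanTheorem.

(** * Archimedean fields *)

Lemma bernoulli_ge (R : realType) (h : R) n : 0 <= h -> 1 + n%:R * h <= (1 + h) ^+ n.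
Proof.
move=> h0; elim: n => [|n ih]; first by rewrite mul0r addr0 expr0.
rewrite exprS; have nh : 0 <= n%:R * h by rewrite mulr_ge0.
apply: (@le_trans _ _ ((1 + h) * (1 + n%:R * h))).
  by rewrite -natr1 mulrDl mul1r; nra.
by rewrite ler_wpM2l// addr_ge0.
Qed.

(** Bernoulli's inequality for [r ^ m] is squared: the exponent [2 * m] gives quadratic growth in
    [m], which beats the linear left-hand side. *)
Lemma exp_gt_linear (R : realType) (r C : R) : 1 < r -> exists n, n.+1%:R * C < r ^+ n.
Proof.
move=> r1; pose h := r - 1; have h0 : 0 < h by rewrite subr_gt0.
have h2 : 0 < h ^+ 2 by rewrite exprn_gt0.
pose m := (Num.truncn (3 * `|C| / h ^+ 2)).+1.
have m1 : (1 : R) <= m%:R by rewrite ler1n.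
have mh : 3 * `|C| < m%:R * h ^+ 2.
  by rewrite -ltr_pdivrMr// truncnS_gt.
exists (m + m)%N; rewrite exprD -expr2.
have rm : 1 + m%:R * h <= r ^+ m.
  by have := bernoulli_ge m (ltW h0); rewrite /h addrCA subrr addr0.
have mh0 : 0 < m%:R * h by rewrite mulr_gt0// (lt_le_trans ltr01).
apply: (@lt_le_trans _ _ ((1 + m%:R * h) ^+ 2)); last first.
  by rewrite lerXn2r ?nnegrE ?exprn_ge0// ?(le_trans _ rm) ?addr_ge0// ltW// (lt_trans ltr01).
apply: (@le_lt_trans _ _ ((m + m).+1%:R * `|C|)).
  by rewrite ler_wpM2l// ler_norm.
have -> : ((m + m).+1%:R : R) = 2 * m%:R + 1 by rewrite -natr1 natrD; ring.
have C0 := normr_ge0 C.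
apply: (@le_lt_trans _ _ (m%:R * (3 * `|C|))).
  have : `|C| <= m%:R * `|C| by rewrite ler_peMl.
  by move=> ?; lra.
apply: (@lt_trans _ _ (m%:R * (m%:R * h ^+ 2))); first by rewrite ltr_pM2l// (lt_le_trans ltr01).
nra.
Qed.

(** * Archimedean local fields normalized by Haar measure *)

Section Classification.
Context {R : realType} {L : fieldType} (v : absolute_value R L).
Hypothesis v_nontrivial : nontrivial_absv v.
Hypothesis L_locally_compact : locally_compact [set: valued v].
Variable m : {measure set (borel (valued v)) -> \bar R}.
Hypothesis m_haar : is_haar m.
Hypothesis m_mod : forall (a : L) (A : set (borel (valued v))),
  a != 0 -> measurable A -> m [set a * x | x in A] = ((v a)%:E * m A)%E.

Let w (n : nat) : R := v n%:R.

Let w_ge0 n : 0 <= w n. Proof. exact: absv_ge0. Qed.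

Let w_le n : w n <= n%:R.
Proof.
elim: n => [|n ih]; first by rewrite /w absv0.
rewrite /w -natr1; apply: le_trans (absvD _ _ _) _.
by rewrite absv1 -natr1 lerD2r.
Qed.

Let wM a b : w (a * b) = w a * w b.
Proof. by rewrite /w natrM absvM. Qed.

Let wX a n : w (a ^ n) = w a ^+ n.
Proof. by rewrite /w natrX absvX. Qed.

(** The binomial coefficients have absolute value at most 1, so [v (x + y) ^ n] is at most [n.+1]
    times [M ^ n]; if [M] were smaller than [v (x + y)], exponential growth would beat the linear
    factor. *)
Lemma bounded_nat_nonarchimedean : (forall n, v n%:R <= 1) -> nonarchimedean v.
Proof.
move=> w1 x y; set M := Num.max _ _.
have M0 : 0 <= M by rewrite le_max absv_ge0.
have key n : v (x + y) ^+ n <= n.+1%:R * M ^+ n.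
  rewrite -absvX exprDn.
  have sumle (F : nat -> L) (B : R) k : (forall i, (i < k)%N -> v (F i) <= B) ->
      v (\sum_(i < k) F i) <= k%:R * B.
    elim: k => [|k ih] FB; first by rewrite big_ord0 absv0 mul0r.
    rewrite big_ord_recr/=; apply: le_trans (absvD _ _ _) _.
    rewrite -natr1 mulrDl mul1r lerD ?FB// ih// => i ik.
    by rewrite FB// ltnW.
  apply: (sumle (fun i => x ^+ (n - i) * y ^+ i *+ 'C(n, i))) => i.
  rewrite ltnS => ni; rewrite -mulr_natr !absvM !absvX.
  rewrite -[leRHS]mulr1 ler_pM ?mulr_ge0 ?exprn_ge0 ?absv_ge0//.
  rewrite -[X in _ <= M ^+ X](subnK ni) exprD ler_pM ?exprn_ge0 ?absv_ge0// lerXn2r ?nnegrE ?absv_ge0//;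
    by rewrite /M le_max lexx ?orbT.
rewrite leNgt; apply/negP => Mxy.
have [M00|M00] := eqVneq M 0.
  have := key 1%N; rewrite !expr1 M00 mulr0 leNgt -{1}M00.
  by rewrite Mxy.
have Mp : 0 < M by rewrite lt0r M00.
have [] := @exp_gt_linear _ (v (x + y) / M) 1.
  by rewrite ltr_pdivlMr// mul1r.
move=> n; rewrite mulr1 expr_div_n ltr_pdivlMr ?exprn_gt0//.
by rewrite ltNge key.
Qed.

Section Archimedean.
Hypothesis arch : ~ nonarchimedean v.

Let wa_gt1 : exists a, 1 < w a.
Proof.
apply: contrapT => H; apply: arch; apply: bounded_nat_nonarchimedean => n.
by rewrite leNgt; apply/negP => wn; apply: H; exists n.
Qed.

Let digit_bound b : exists2 D : R, 0 <= D & forall d, (d < b)%N -> w d <= D.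
Proof.
exists b%:R => // d db; apply: le_trans (w_le d) _.
by rewrite ler_nat ltnW.
Qed.

Let w_divn b n : (0 < b)%N -> w n <= w (n %/ b) * w b + w (n %% b).
Proof.
by move=> b0; rewrite -wM /w {1}(divn_eq n b) natrD; exact: absvD.
Qed.

Let w_unbounded C : exists n, C < w n.
Proof.
have [a a1] := wa_gt1; have [n nC] := exp_gt_linear `|C| a1.
exists (a ^ n)%N; rewrite wX; apply: le_lt_trans nC.
by apply: le_trans (ler_norm C) _; rewrite ler_peMl// ler1n.
Qed.

(* Writing [n] in base [b] bounds [|n|] by a geometric sum in [|b|]. *)
Let w_ge1 b : (0 < b)%N -> 1 <= w b.
Proof.
move=> b0; rewrite leNgt; apply/negP => wb1.
have [D D0 hD] := digit_bound b.
have wb : 0 < 1 - w b by rewrite subr_gt0.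
have [n] := w_unbounded (D / (1 - w b)); apply/negP; rewrite -leNgt.
have [b1|b1] := leqP b 1.
  by move: wb1; rewrite (_ : b = 1%N) ?/w ?absv1 ?ltxx//; apply/eqP; rewrite eqn_leq b1.
elim/ltn_ind: n => n ih.
have [->|n0] := posnP n; first by rewrite /w absv0 divr_ge0// ltW.
apply: le_trans (w_divn n b0) _.
have h1 := ih (n %/ b)%N (ltn_Pdiv b1 n0); have h2 := hD _ (ltn_pmod n b0).
have -> : D / (1 - w b) = D / (1 - w b) * w b + D by field; rewrite gt_eqF.
by rewrite lerD// ler_wpM2r.
Qed.

(** If [w b = 1], expansion in base [b] bounds [w n] by a constant times the number of digits of
    [n]. The powers of an integer [a] with [1 < w a] contradict this: their number of digits grows
    only linearly in the exponent. *)
Let w_gt1 b : (1 < b)%N -> 1 < w b.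
Proof.
move=> b1; have b0 : (0 < b)%N by exact: ltnW.
rewrite lt_neqAle w_ge1// andbT eq_sym; apply/eqP => wb1.
have [D D0 hD] := digit_bound b.
have h k n : (n < b ^ k)%N -> w n <= k%:R * D.
  elim: k n => [|k ih] n; first by rewrite expn0 ltnS leqn0 => /eqP ->; rewrite /w absv0 mul0r.
  move=> nb; apply: le_trans (w_divn n b0) _.
  rewrite wb1 mulr1 -natr1 mulrDl mul1r lerD ?hD ?ltn_pmod// ih//.
  by rewrite ltn_divLR// -expnSr.
have [a a1] := wa_gt1; have [n nC] := exp_gt_linear (a%:R * D) a1.
(* Since [a < b ^ a], the number [a ^ n] has at most [a * n.+1] digits in base [b]. *)
have : (a ^ n < b ^ (a * n.+1))%N.
  apply: (@leq_ltn_trans (b ^ (a * n))).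
    by case: (n) => [|k]; rewrite ?muln0// expnM leq_exp2r//; apply: ltnW; exact: ltn_expl.
  by rewrite ltn_exp2l// ltn_pmul2l//; case: (a) a1 => //; rewrite /w absv0 ltr10.
move/h; rewrite wX leNgt => /negP; apply.
by apply: le_lt_trans nC; rewrite natrM mulrAC mulrC mulrA mulrC.
Qed.

Let D (r : R) : set (borel (valued v)) := [set x | v x <= r].
Let U (r : R) : set (borel (valued v)) := [set x | v x < r].

Let D_meas r : measurable (D r).
Proof.
rewrite -[X in measurable X]setCK; apply: measurableC; apply: open_borel.
by apply: closed_openC; exact: closed_absv_ball.
Qed.

Let U_open a r : open [set x : valued v | v (x - a) < r].
Proof.
rewrite openE => x /= xr; apply/nbhs_absv; exists (r - v (x - a)).
  by rewrite subr_gt0.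
move=> y /= xy; apply: le_lt_trans (absv_dist_triangle v x y a) _.
by rewrite absv_distC -ltrBrDr.
Qed.

Let D_fin r : m (D r) \is a fin_num.
Proof.
rewrite ge0_fin_numE ?measure_ge0//.
exact: (haar_compact m_haar (compact_absv_ball v_nontrivial L_locally_compact (r := r))).
Qed.

Let U_gt0 r : 0 < r -> (0 < m (U r))%E.
Proof.
move=> r0; have mU s : measurable (U s).
  apply: open_borel; have := @U_open 0 s; congr open.
  by apply/seteqP; split=> x /=; rewrite subr0.
rewrite lt0e measure_ge0 andbT; apply/eqP => mU0.
have /negP := haar_nonzero m_haar; apply; apply/eqP.
have [c c0 c1] := small_absv v_nontrivial ltr01.
have scale k : [set (c ^+ k)^-1 * x | x in U r] = U ((v c ^+ k)^-1 * r).
  have ck : c ^+ k != 0 by rewrite expf_neq0.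
  have vk : 0 < v c ^+ k by rewrite exprn_gt0// absv_gt0.
  apply/seteqP; split=> x; rewrite /U/=.
    by move=> [y yr <-]; rewrite absvM absvV absvX ltr_pM2l// invr_gt0.
  move=> xr; exists (c ^+ k * x); last by rewrite mulKf.
  by rewrite absvM absvX -ltr_pdivlMl.
have -> : [set: borel (valued v)] = \bigcup_k [set (c ^+ k)^-1 * x | x in U r].
  apply/esym/seteqP; split => // x _.
  have : (fun n => v c ^+ n) @ \oo --> 0 by apply: cvg_expr; rewrite ger0_norm ?absv_ge0.
  have vx : 0 < r / (v x + 1) by rewrite divr_gt0// ltr_wpDl// absv_ge0.
  move=> /cvgrPdist_lt/(_ _ vx)[n _ /(_ n (leqnn n))].
  rewrite sub0r normrN ger0_norm ?exprn_ge0 ?absv_ge0// => h.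
  exists n => //; rewrite scale /U/= mulrC ltr_pdivlMr ?exprn_gt0 ?absv_gt0//.
  move: h; rewrite ltr_pdivlMr ?ltr_wpDl ?absv_ge0// => h.
  apply: le_lt_trans h; rewrite mulrC ler_wpM2l ?exprn_ge0 ?absv_ge0//.
  by rewrite lerDl.
apply/eqP; rewrite -measure_le0.
have mm k : measurable ([set (c ^+ k)^-1 * x | x in U r] : set (borel (valued v))).
  by rewrite scale.
apply: le_trans (@measure_sigma_subadditive _ R _ m _ _ mm (bigcupT_measurable _ mm) (@subset_refl _ _)) _.
rewrite eseries0// => k _ _.
by rewrite m_mod ?invr_eq0 ?expf_neq0// mU0 mule0.
Qed.

(* The balls of radius [s / 2] around the points [p i] are disjoint and lie in
   a dilated ball, whose measure the modulus controls. *)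
Lemma packing (K : nat) (p : nat -> L) (s B : R) (l : L) : l != 0 ->
  (forall i j, (i < K)%N -> (j < K)%N -> i <> j -> s <= v (p i - p j)) ->
  (forall i, (i < K)%N -> v (p i) + s <= v l * B) ->
  K%:R * fine (m (U (s / 2))) <= v l * fine (m (D B)).
Proof.
move=> l0 sep bnd.
pose V i : set (borel (valued v)) := [set p i + x | x in U (s / 2)].
have VE i : V i = [set x : valued v | v (x - p i) < s / 2].
  apply/seteqP; split=> x; rewrite /V /U/=.
    by move=> [y yr <-]; rewrite addrAC subrr add0r.
  by move=> h; exists (x - p i) => //; rewrite addrC subrK.
have mV i : measurable (V i) by rewrite VE; apply: open_borel; exact: U_open.
have mU : measurable (U (s / 2)).
  apply: open_borel; have := @U_open 0 (s / 2); congr open.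
  by apply/seteqP; split=> x /=; rewrite subr0.
have mVU i : m (V i) = m (U (s / 2)) by exact: (haar_translation m_haar).
have tV : trivIset (fun i => (i < K)%N) V.
  move=> i j iK jK [x []]; rewrite !VE/= => xi xj; apply: contrapT => ij.
  have := sep i j iK jK ij; rewrite leNgt => /negP; apply.
  apply: le_lt_trans (absv_dist_triangle v x (p i) (p j)) _.
  by rewrite (absv_distC _ (p i)) [ltRHS]splitr ltrD.
have sub : \big[setU/set0]_(i < K) V i `<=` [set l * x | x in D B].
  rewrite -bigcup_mkord => x [i iK]; rewrite VE/= => xi.
  exists (l^-1 * x); last by rewrite mulrA divff// mul1r.
  rewrite /D/= absvM absvV mulrC ler_pdivrMr ?absv_gt0// mulrC.
  apply: le_trans (bnd i iK); rewrite -{1}(subrK (p i) x).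
  apply: le_trans (absvD _ _ _) _; rewrite addrC lerD2l ltW//.
  have s0 : 0 <= s / 2 by apply: le_trans (ltW xi); exact: absv_ge0.
  by apply: lt_le_trans xi _; lra.
have mlD : measurable ([set l * x | x in D B] : set (borel (valued v))).
  rewrite (_ : [set _ | _ in _] = D (v l * B))//.
  have vl : 0 < v l by rewrite absv_gt0.
  apply/seteqP; split=> x; rewrite /D/=.
    by move=> [y yB <-]; rewrite absvM ler_pM2l.
  move=> xB; exists (l^-1 * x); last by rewrite mulrA divff// mul1r.
  by rewrite absvM absvV mulrC ler_pdivrMr// mulrC.
have := le_measure m _ _ sub; rewrite !inE => /(_ _ mlD) H.
have {H} := H (bigsetU_measurable _ (fun i _ => mV (nat_of_ord i))).
move=> H.
have mE : m [set l * x | x in D B] = ((v l)%:E * m (D B))%E by exact: m_mod.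
have {mE}H : (m (\big[setU/set0]_(i < K) V i) <= (v l)%:E * m (D B))%E.
  by rewrite -mE; exact: H.
move: H; rewrite measure_bigsetU_ord//; last first.
  by move=> i j _ _ ij; apply: val_inj; apply: tV (ltn_ord i) (ltn_ord j) ij.
rewrite (eq_bigr (fun=> m (U (s / 2)))) => [|i _]; last exact: mVU.
have fU : m (U (s / 2)) \is a fin_num.
  rewrite ge0_fin_numE ?measure_ge0//.
  apply: (@le_lt_trans _ _ (m (D (s / 2)))).
    by apply: le_measure; rewrite ?inE// => x; rewrite /U /D/=; exact: ltW.
  by rewrite -ge0_fin_numE ?measure_ge0.
rewrite -(fineK fU) -(fineK (D_fin B)) -EFinM sumEFin sumr_const card_ord lee_fin.
by rewrite mulr_natl.
Qed.

(* The integers below [b ^ k] are 1-separated, and if [|b| < b] then they lie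
   in a ball of radius [O(|b| ^ k)], which has measure [O(|b| ^ k)]. *)
Let w_id b : w b = b%:R.
Proof.
have [b1|b1] := leqP b 1.
  case: b b1 => [|[|//]] _; rewrite /w ?absv0 ?absv1//.
apply/eqP; rewrite eq_le w_le/= leNgt; apply/negP => wb.
have wb1 := w_gt1 b1; have b0 : (0 < b)%N by exact: ltnW.
have [E E0 hE] := digit_bound b.
have wb10 : 0 < w b - 1 by rewrite subr_gt0.
have h k n : (n < b ^ k)%N -> w n <= E / (w b - 1) * (w b ^+ k - 1).
  elim: k n => [|k ih] n.
    by rewrite expn0 ltnS leqn0 => /eqP ->; rewrite /w absv0 expr0 subrr mulr0.
  move=> nb; apply: le_trans (w_divn n b0) _.
  have h1 : w (n %/ b) <= E / (w b - 1) * (w b ^+ k - 1).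
    by apply: ih; rewrite ltn_divLR// -expnSr.
  have -> : E / (w b - 1) * (w b ^+ k.+1 - 1) =
      E / (w b - 1) * (w b ^+ k - 1) * w b + E.
    by rewrite exprS; field; rewrite gt_eqF.
  by rewrite lerD ?hE ?ltn_pmod// ler_wpM2r.
(* [w b ^ k * B] bounds the absolute values of the integers below [b ^ k] with room for balls around
   them, the summand 1 being their separation. *)
pose B := E / (w b - 1) + 1.
have pk k : (b ^ k)%:R * fine (m (U (1 / 2))) <= w b ^+ k * fine (m (D B)).
  rewrite -wX; apply: (@packing (b ^ k) (fun i => i%:R)).
  - by rewrite -(absv_gt0 v) -/(w _) wX exprn_gt0// (lt_trans ltr01).
  - have sep i j : (j < i)%N -> 1 <= v (i%:R - j%:R).
      move=> ij; have : 1 <= w (i - j) by apply: w_ge1; rewrite subn_gt0.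
      by rewrite /w natrB// ltnW.
    move=> i j _ _ /eqP; rewrite neq_ltn => /orP[ij|ij]; last exact: sep.
    by rewrite absv_distC sep.
  - move=> i ik; rewrite -/(w (b ^ k)) wX /B mulrDr mulr1.
    have := h k i ik; rewrite -/(w i) => hi.
    have q0 : 0 <= E / (w b - 1) by rewrite divr_ge0// ltW.
    have wk : 1 <= w b ^+ k by rewrite exprn_ege1// ltW.
    nra.
have mU0 : 0 < fine (m (U (1 / 2))).
  have fU : m (U (1 / 2)) \is a fin_num.
    rewrite ge0_fin_numE ?measure_ge0//.
    apply: (@le_lt_trans _ _ (m (D (1 / 2)))).
      apply: le_measure; rewrite ?inE//.
        apply: open_borel; have := @U_open 0 (1 / 2); congr open.
        by apply/seteqP; split=> x /=; rewrite subr0.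
      by move=> x; rewrite /U /D/=; exact: ltW.
    by rewrite -ge0_fin_numE ?measure_ge0.
  by rewrite fine_gt0// U_gt0//= ?ltry// -ge0_fin_numE ?measure_ge0.
have r1 : 1 < b%:R / w b by rewrite ltr_pdivlMr ?mul1r// (lt_trans ltr01).
have [k hk] := exp_gt_linear (fine (m (D B)) / fine (m (U (1 / 2)))) r1.
have := pk k; rewrite leNgt => /negP; apply.
have wk : 0 < w b ^+ k by rewrite exprn_gt0// (lt_trans ltr01).
move: hk; rewrite expr_div_n ltr_pdivlMr// => hk.
have d0 : 0 <= fine (m (D B)) / fine (m (U (1 / 2))).
  by rewrite divr_ge0 ?fine_ge0 ?measure_ge0// ltW.
rewrite natrX -ltr_pdivrMr//.
have : fine (m (D B)) / fine (m (U (1 / 2))) * w b ^+ k < b%:R ^+ k.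
  apply: le_lt_trans hk; rewrite ler_wpM2r ?(ltW wk)//.
  by rewrite ler_peMl// ler1n.
have swap (x y z : R) : x * y / z = y / z * x.
  by rewrite [x * y]mulrC mulrAC.
by rewrite swap.
Qed.

Let v_nat n : v n%:R = n%:R. Proof. exact: w_id. Qed.

Let v_int (k : int) : v k%:~R = `|k%:~R|.
Proof.
by case: k => n; rewrite ?NegzE ?mulrNz ?absvN ?normrN -pmulrn v_nat normr_nat.
Qed.

Let natL_neq0 n : n.+1%:R != 0 :> L.
Proof. by rewrite -(absv_gt0 v) v_nat ltr0n. Qed.

(** The same rational number seen in [R] and in [L]; by [fraction_norm] both copies have the same
    absolute value. *)
Let common_fraction (r : R) (l : L) := exists k : int, exists n : nat,
  r = k%:~R / n.+1%:R /\ l = k%:~R / n.+1%:R.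

Let fraction_norm r l : common_fraction r l -> v l = `|r|.
Proof.
move=> [k [n [-> ->]]].
by rewrite absvM absvV v_nat v_int normrM normfV normr_nat.
Qed.

Let fraction_add r l r' l' : common_fraction r l -> common_fraction r' l' ->
  common_fraction (r + r') (l + l').
Proof.
move=> [k [n [-> ->]]] [k' [n' [-> ->]]].
exists (k * n'.+1%:Z + k' * n.+1%:Z), (n * n' + n + n')%N.
have -> : (n * n' + n + n').+1 = (n.+1 * n'.+1)%N
  by rewrite mulSn mulnS addSn; congr _.+1; rewrite addnC [(n * n' + n)%N]addnC.
by rewrite !intrD !intrM -!pmulrn !natrM; split; rewrite addf_div ?pnatr_eq0 ?natL_neq0.
Qed.

Let fraction_mul r l r' l' : common_fraction r l -> common_fraction r' l' ->
  common_fraction (r * r') (l * l').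
Proof.
move=> [k [n [-> ->]]] [k' [n' [-> ->]]].
exists (k * k'), (n * n' + n + n')%N.
have -> : (n * n' + n + n').+1 = (n.+1 * n'.+1)%N
  by rewrite mulSn mulnS addSn; congr _.+1; rewrite addnC [(n * n' + n)%N]addnC.
by rewrite !intrM !natrM !mulf_div.
Qed.

Let fraction_int (k : int) : common_fraction k%:~R k%:~R.
Proof. by exists k, 0%N; rewrite !divr1. Qed.

Let fraction_dense (x e : R) : 0 < e -> exists r l, common_fraction r l /\ `|x - r| < e.
Proof.
move=> e0; pose n := Num.truncn e^-1.
have ne : e^-1 < n.+1%:R by exact: truncnS_gt.
pose k := Num.floor (x * n.+1%:R).
exists (k%:~R / n.+1%:R), (k%:~R / n.+1%:R); split; first by exists k, n.
have n0 : 0 < n.+1%:R :> R by rewrite ltr0n.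
have -> : x - k%:~R / n.+1%:R = (x * n.+1%:R - k%:~R) / n.+1%:R by field; rewrite gt_eqF.
rewrite normrM normfV normr_nat ltr_pdivrMr//.
have := floor_le (x * n.+1%:R); have := floorD1_gt (x * n.+1%:R); rewrite -/k => h1 h2.
rewrite ger0_norm ?subr_ge0//; apply: (@lt_trans _ _ 1).
  by move: h1; rewrite intrD => h1; rewrite ltrBlDl.
by rewrite -ltr_pdivrMl// mulr1.
Qed.

(* [z] is the limit in [L] of the rational numbers that converge to [x]. *)
Let close (x : R) (z : L) := forall e, 0 < e ->
  exists r l, [/\ common_fraction r l, `|x - r| < e & v (z - l) < e].

Let close_dist x z y t : close x z -> close y t -> v (z - t) = `|x - y|.
Proof.
move=> xz yt; apply/eqP; rewrite -subr_eq0 -normr_le0; apply/ler_addgt0Pl => e e0.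
rewrite addr0.
have e4 : 0 < e / 4 by rewrite divr_gt0.
have [r [l [S1 xr zl]]] := xz _ e4; have [r' [l' [S2 yr tl]]] := yt _ e4.
have S3 : common_fraction (r - r') (l - l').
  rewrite -(mulN1r r') -(mulN1r l'); apply: fraction_add => //.
  by apply: fraction_mul => //; exact: (fraction_int (-1)).
have h1 : `|v (z - t) - v (l - l')| <= v ((z - t) - (l - l')) by exact: absv_lip.
have h2 : v ((z - t) - (l - l')) <= v (z - l) + v (t - l').
  rewrite -(absvN v (t - l')); apply: le_trans (absvD v _ _).
  by rewrite (_ : z - t - (l - l') = z - l - (t - l'))//; ring.
have h3 : `| `|r - r'| - `|x - y| | <= `|(r - r') - (x - y)| by exact: ler_dist_dist.
have h4 : `|(r - r') - (x - y)| <= `|x - r| + `|y - r'|.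
  rewrite -normrN (_ : - (r - r' - (x - y)) = (x - r) - (y - r')); last by ring.
  exact: ler_normB.
rewrite -(fraction_norm S3) in h3.
have := ler_distD (v (l - l')) (v (z - t)) `|x - y|.
lra.
Qed.

(** Fractions tending to [x] stay in a compact ball of [L], and any cluster point of them serves;
    completeness of [L] enters in this form. *)
Let close_exists x : exists z, close x z.
Proof.
have /choice[f hf] : forall n : nat, exists rl : R * L,
    common_fraction rl.1 rl.2 /\ `|x - rl.1| < n.+1%:R^-1.
  move=> n; have /(fraction_dense x)[r [l h]] : 0 < n.+1%:R^-1 :> R by rewrite invr_gt0.
  by exists (r, l).
have fK n : v (f n).2 <= `|x| + 1.
  have [S1 h] := hf n; rewrite (fraction_norm S1).
  rewrite -[(f n).1](subrK x) addrC; apply: le_trans (ler_normD _ _) _.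
  by rewrite lerD2l distrC (le_trans (ltW h))// invf_le1// ler1n.
have cK := @compact_absv_ball _ _ v v_nontrivial L_locally_compact (`|x| + 1).
have [|z [zK zcl]] := cK ((fun n => (f n).2 : valued v) @ \oo) _.
  by exists 0%N => // n _ /=; exact: fK.
exists z => e e0; pose N := Num.truncn e^-1.
have Ne : e^-1 < N.+1%:R by exact: truncnS_gt.
have nz : nbhs (z : valued v) [set y : valued v | v (z - y) < e].
  by apply/nbhs_absv; exists e.
have tail : ((fun n => (f n).2 : valued v) @ \oo) [set (f n).2 | n in [set n | (N <= n)%N]].
  by exists N => // n /= Nn; exists n.
have [y [[n Nn <-] yz]] := zcl _ _ tail nz.
have [S1 h] := hf n; exists (f n).1, (f n).2; split => //.
apply: lt_trans h _; rewrite invf_plt ?posrE//; apply: lt_le_trans Ne _.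
by rewrite ler_nat ltnS.
Qed.

Let close_add x z y t : close x z -> close y t -> close (x + y) (z + t).
Proof.
move=> xz yt e e0; have e2 : 0 < e / 2 by rewrite divr_gt0.
have [r [l [S1 xr zl]]] := xz _ e2; have [r' [l' [S2 yr tl]]] := yt _ e2.
exists (r + r'), (l + l'); split; first exact: fraction_add.
  rewrite opprD addrACA (splitr e); apply: le_lt_trans (ler_normD _ _) _.
  exact: ltrD.
rewrite opprD addrACA (splitr e); apply: le_lt_trans (absvD v _ _) _.
exact: ltrD.
Qed.

Let prod_bound (p q s X Y M d e : R) : s <= p + X -> 0 <= p -> 0 <= q ->
  d * M <= e -> p < d -> q < d -> d <= 1 -> 0 <= X -> 0 <= Y -> X + Y + 2 <= M ->
  p * Y + s * q < e.
Proof.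
move=> sX p0 q0 dM pd qd d1 X0 Y0 XM; apply: lt_le_trans dM.
have d0 : 0 < d by exact: le_lt_trans pd.
have h1 : p * Y <= d * Y by rewrite ler_wpM2r// ltW.
have h2 : s * q <= (1 + X) * d.
  apply: (@le_trans _ _ ((1 + X) * q)); last by rewrite ler_wpM2l ?(ltW qd)// addr_ge0.
  by rewrite ler_wpM2r//; lra.
have h3 : d * (X + Y + 2) <= d * M by rewrite ler_pM2l.
by move: h3; rewrite !mulrDr; lra.
Qed.

Let close_mul x z y t : close x z -> close y t -> close (x * y) (z * t).
Proof.
(* One [M] serves the estimates in [R] and in [L], so that the same pairs of fractions approximate
   both products. *)
move=> xz yt e e0; pose M := `|x| + v z + `|y| + v t + 2.
have M0 : 0 < M.
  have := (normr_ge0 x, normr_ge0 y, absv_ge0 v z, absv_ge0 v t) => -[[[? ?] ?] ?].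
  by rewrite /M; lra.
pose d := Num.min 1 (e / M).
have d0 : 0 < d by rewrite lt_min ltr01 divr_gt0.
have d1 : d <= 1 by rewrite ge_min lexx.
have dM : d * M <= e by rewrite -ler_pdivlMr// ge_min lexx orbT.
have [r [l [S1 xr zl]]] := xz _ d0; have [r' [l' [S2 yr tl]]] := yt _ d0.
exists (r * r'), (l * l'); split; first exact: fraction_mul.
  rewrite (_ : x * y - r * r' = (x - r) * y + (r - x + x) * (y - r')); last by ring.
  apply: le_lt_trans (ler_normD _ _) _; rewrite !normrM.
  have h := ler_normD (r - x) x; rewrite (distrC r) in h.
  refine (prod_bound h _ _ dM _ _ _ _ _ _) => //.
  by have := absv_ge0 v z; have := absv_ge0 v t; rewrite /M; lra.
rewrite (_ : z * t - l * l' = (z - l) * t + (l - z + z) * (t - l')); last by ring.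
apply: le_lt_trans (absvD v _ _) _; rewrite !absvM.
have h := absvD v (l - z) z; rewrite (absv_distC v l) in h.
refine (prod_bound h _ _ dM _ _ _ _ _ _) => //; rewrite ?absv_ge0//.
by have := normr_ge0 x; have := normr_ge0 y; rewrite /M; lra.
Qed.

Theorem archimedean_real : exists phi : {rmorphism R -> L},
  bijective phi /\ forall x, v (phi x) = `|x|.
Proof.
have /choice[phi cphi] := close_exists.
have close_uniq x z t : close x z -> close x t -> z = t.
  by move=> h1 /(close_dist h1); rewrite subrr normr0 => /absv_eq0/eqP; rewrite subr_eq0 => /eqP.
have close_int (k : int) : close k%:~R k%:~R.
  by move=> e e0; exists k%:~R, k%:~R; rewrite !subrr normr0 absv0.
have phiD x y : phi (x + y) = phi x + phi y.
  by apply: close_uniq (cphi _) _; exact: close_add.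
have phiM x y : phi (x * y) = phi x * phi y.
  by apply: close_uniq (cphi _) _; exact: close_mul.
have phi1 : phi 1 = 1 by apply: close_uniq (cphi _) _; exact: (close_int 1).
have phiB : zmod_morphism phi.
  move=> x y; apply: (addIr (phi y)).
  by rewrite -phiD !subrK.
pose A := GRing.isZmodMorphism.Build R L phi phiB.
pose B := GRing.isMonoidMorphism.Build R L phi (phi1, phiM).
pose phiR : {rmorphism R -> L} := HB.pack phi A B.
have iso x y : v (phi x - phi y) = `|x - y| by exact: close_dist.
have phi_norm x : v (phiR x) = `|x|.
  by rewrite -[x in RHS]subr0 -iso -[phi 0]/(phiR 0) rmorph0 subr0.
exists phiR; split => //.
have inj : injective phiR.
  move=> x y /eqP; rewrite -subr_eq0 => /eqP/(absv_eq0 v); rewrite iso => /eqP.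
  by rewrite normr_eq0 subr_eq0 => /eqP.
suff surj z : exists x, phiR x = z.
  have /choice[g gK] := surj.
  by exists g => // x; apply: inj.
apply: contrapT => /forallNP nz.
(* The distance from [z] to the image of [phi] is positive: the continuous positive function [f]
   attains a minimum on [[- M, M]] and is at least 1 outside. *)
pose f x := v (z - phi x).
have f_gt0 x : 0 < f x.
  by rewrite /f absv_gt0 subr_eq0 eq_sym; apply/eqP; exact: nz.
have f_lip x y : `|f x - f y| <= `|x - y|.
  apply: le_trans (absv_lip _ _ _) _; rewrite (distrC x) -iso.
  by rewrite (_ : z - phi x - (z - phi y) = phi y - phi x)//; ring.
have fc : continuous f.
  move=> x; apply/cvgrPdist_lt => e e0; near=> y.
  apply: le_lt_trans (f_lip _ _) _; near: y.
  by apply: (@cvgr_dist_lt _ _ _ (nbhs x) _ id x).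
pose M := v z + 1.
have M0 : 0 <= M by rewrite addr_ge0// absv_ge0.
have [|c0 _ c0min] := @EVT_min _ f (- M) M _ (continuous_subspaceT fc).
  by rewrite ge0_cp.
pose c := Num.min (f c0) 1.
have c_gt0 : 0 < c by rewrite lt_min f_gt0/=.
have c1 : c <= 1 by rewrite ge_min lexx orbT.
have f_ge x : c <= f x.
  have [xM|xM] := leP `|x| M.
    by rewrite ge_min c0min//= in_itv/= -ler_norml.
  apply: le_trans c1 _; rewrite /f -phi_norm in xM *.
  have := absvD v (phi x - z) z; rewrite subrK absv_distC.
  by move: xM; rewrite /M/=; lra.
(* Factoring out the integer [j], of absolute value at least 1, reduces the claim to the distance
   from [z] to the image of [phi]. *)
have sep1 (i : R) (j : int) : j != 0 -> c <= v (phi i + j%:~R * z).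
  move=> j0; have jr : j%:~R != 0 :> R by rewrite intr_eq0.
  have phij : phi j%:~R = j%:~R by rewrite -[LHS]/(phiR _) rmorph_int.
  have -> : phi i + j%:~R * z = phi j%:~R * (z - phi (- i / j%:~R)).
    have e1 : phi j%:~R * phi (- i / j%:~R) = - phi i.
      by rewrite -phiM mulrC divfK// -[LHS]/(phiR _) rmorphN.
    by rewrite mulrBr e1 opprK phij addrC.
  rewrite absvM -[v (phi _)]/(v (phiR _)) phi_norm; apply: le_trans (f_ge (- i / j%:~R)) _.
  rewrite ler_peMl ?absv_ge0//.
  rewrite -intr_norm -[1]/(1%:~R) ler_int.
  by rewrite -gtz0_ge1 normr_gt0.
(* If [z] is not a real number, the [(N + 1) ^ 2] points [i + j z] are
   separated and lie in a ball of measure [O(N)]. *)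
pose m0 := fine (m (U (c / 2))); pose BB := v z + 2; pose m1 := fine (m (D BB)).
have pk N : (N.+1 * N.+1)%:R * m0 <= N.+1%:R * m1.
  (* An index below [N.+1 * N.+1] encodes a lattice point by its remainder and quotient modulo
     [N.+1]. Dilation by [N.+1] multiplies the measure by [N.+1] only: here the normalization rules
     out the complex numbers. *)
  rewrite -[X in _ <= X * _]v_nat; apply: (@packing _ (fun n => (n %% N.+1)%:R + (n %/ N.+1)%:R * z)).
  - exact: natL_neq0.
  - move=> i j iN jN ij.
    set a := (i %% _)%N; set b := (i %/ _)%N; set a' := (j %% _)%N; set b' := (j %/ _)%N.
    have -> : a%:R + b%:R * z - (a'%:R + b'%:R * z) =
        phi (a%:R - a'%:R) + (b%:Z - b'%:Z)%:~R * z.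
      rewrite -[phi _]/(phiR _) rmorphB !rmorph_nat rmorphB/= -!pmulrn; ring.
    have [bb|bb] := eqVneq (b%:Z - b'%:Z) 0; last exact: sep1.
    rewrite bb mul0r addr0 -[phi _]/(phiR _) phi_norm; apply: le_trans c1 _.
    have aa : (a%:Z - a'%:Z) != 0.
      apply/eqP => aa; apply: ij; rewrite (divn_eq i N.+1) (divn_eq j N.+1).
      move: aa bb => /eqP; rewrite subr_eq0 => /eqP[] + /eqP; rewrite subr_eq0 => + /eqP[].
      by rewrite -/a -/a' -/b -/b' => -> ->.
    have -> : (a%:R - a'%:R : R) = (a%:Z - a'%:Z)%:~R by rewrite rmorphB/= -!pmulrn.
    by rewrite -intr_norm -[1]/(1%:~R) ler_int -gtz0_ge1 normr_gt0.
  - move=> i iN; rewrite v_nat.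
    have h1 : v ((i %% N.+1)%:R + (i %/ N.+1)%:R * z) <= (i %% N.+1)%:R + (i %/ N.+1)%:R * v z.
      by apply: le_trans (absvD v _ _) _; rewrite absvM !v_nat.
    have h2 : (i %% N.+1)%:R <= N.+1%:R :> R by rewrite ler_nat ltnW// ltn_pmod.
    have h3 : (i %/ N.+1)%:R <= N.+1%:R :> R by rewrite ler_nat ltnW// ltn_divLR.
    have h4 : 1 <= N.+1%:R :> R by rewrite ler1n.
    have h5 := absv_ge0 v z.
    apply: le_trans (lerD h1 c1) _; rewrite /BB; nra.
have m00 : 0 < m0.
  have cc : 0 < c / 2 by rewrite divr_gt0.
  have fU : m (U (c / 2)) \is a fin_num.
    rewrite ge0_fin_numE ?measure_ge0//.
    apply: (@le_lt_trans _ _ (m (D (c / 2)))).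
      apply: le_measure; rewrite ?inE//.
        apply: open_borel; have := @U_open 0 (c / 2); congr open.
        by apply/seteqP; split=> x /=; rewrite subr0.
      by move=> x; rewrite /U /D/=; exact: ltW.
    by rewrite -ge0_fin_numE ?measure_ge0.
  by rewrite fine_gt0// U_gt0//= -ge0_fin_numE ?measure_ge0.
have := pk (Num.truncn (m1 / m0)); apply/negP; rewrite -ltNge natrM -mulrA ltr_pM2l ?ltr0n//.
by rewrite -ltr_pdivrMr//; exact: truncnS_gt.
Unshelve. all: by end_near.
Qed.

End Archimedean.

End Classification.

(** * Integrals on the line and on the circle *)

Section AffineChange.
Context {R : realType}.
Local Notation mu := (@lebesgue_measure R).
Local Open Scope ereal_scope.

Lemma affine_measurable (a b : R) :
  measurable_fun setT (fun x : measurableTypeR R => (a * x + b)%R : measurableTypeR R).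
Proof. by apply: measurable_funD => //; apply: measurable_funM. Qed.

Lemma lebesgue_measure_affine (a b : R) (A : set (measurableTypeR R)) :
  a != 0%R -> measurable A ->
  mu A = (`|a|%:E * mu ((fun x => a * x + b)%R @^-1` A)).
Proof.
move=> a0 mA.
have mf := affine_measurable a b.
have [m' m'E] := pushforward_measure_exists mu mf.
have aV0 : (0 < `|a|)%R by rewrite normr_gt0.
pose m'' : {measure set (measurableTypeR R) -> \bar R} := mscale (NngNum (ltW aV0)) m'.
have -> : mu ((fun x => a * x + b)%R @^-1` A) = m' A by rewrite m'E.
have -> : `|a|%:E * m' A = m'' A by [].
apply: lebesgue_measure_unique => // _ [[x y] _ <-].
rewrite [RHS](_ : _ = `|a|%:E * m' `]x, y]%classic)// m'E.
have [xy|yx] := ltP x y; last first.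
  rewrite (_ : `]x, y]%classic = set0); last by rewrite set_itv_ge// bnd_simp -leNgt.
  by rewrite preimage_set0 !measure0 mule0.
rewrite lebesgue_measure_itv/= lte_fin xy.
have /orP[an|an] : (a < 0)%R || (0 < a)%R by rewrite -neq_lt.
- rewrite (_ : _ @^-1` _ = `[((y - b) / a)%R, ((x - b) / a)%R[%classic); last first.
    apply/seteqP; split=> z /=; rewrite !in_itv/=.
      by rewrite ler_ndivrMr// ltr_ndivlMr// lerBrDr ltrBlDr mulrC => /andP[-> ->].
    by rewrite ler_ndivrMr// ltr_ndivlMr// lerBrDr ltrBlDr mulrC => /andP[-> ->].
  rewrite lebesgue_measure_itv/= lte_fin ltr_nM2r ?invr_lt0// ltrD2r xy.
  rewrite -EFinD -EFinM; congr _%:E; rewrite ltr0_norm//; field.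
  by rewrite lt_eqF.
- rewrite (_ : _ @^-1` _ = `]((x - b) / a)%R, ((y - b) / a)%R]%classic); last first.
    apply/seteqP; split=> z /=; rewrite !in_itv/=.
      by rewrite ltr_pdivrMr// ler_pdivlMr// ltrBlDr lerBrDr mulrC => /andP[-> ->].
    by rewrite ltr_pdivrMr// ler_pdivlMr// ltrBlDr lerBrDr mulrC => /andP[-> ->].
  rewrite lebesgue_measure_itv/= lte_fin ltr_pM2r ?invr_gt0// ltrD2r xy.
  rewrite -EFinD -EFinM; congr _%:E; rewrite gtr0_norm//; field.
  by rewrite gt_eqF.
Qed.

Lemma integral_affine (a b : R) (f : measurableTypeR R -> \bar R) : a != 0%R ->
  measurable_fun setT f -> (forall x, 0 <= f x) ->
  \int[mu]_x f x = `|a|%:E * \int[mu]_x f (a * x + b)%R.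
Proof.
move=> a0 mf f0.
have maf := affine_measurable a b.
have aV0 : (0 < `|a|)%R by rewrite normr_gt0.
have [m' m'E] := pushforward_measure_exists mu maf.
rewrite (@eq_measure_integral _ _ _ _ (mscale (NngNum (ltW aV0)) m')); last first.
  by move=> A mA _; rewrite /= /mscale/= m'E; exact: lebesgue_measure_affine.
rewrite ge0_integral_mscale//=; congr (_ * _).
rewrite (@eq_measure_integral _ _ _ _ (pushforward mu (fun x => (a * x + b)%R : measurableTypeR R))); last first.
  by move=> A mA _; rewrite m'E.
by rewrite ge0_integral_pushforward.
Qed.

Lemma integral_affine_set (a b : R) (A : set (measurableTypeR R))
    (f : measurableTypeR R -> \bar R) : a != 0%R -> measurable A ->
  measurable_fun setT f -> (forall x, 0 <= f x) ->
  \int[mu]_(x in A) f x =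
    `|a|%:E * \int[mu]_(x in [set x | A (a * x + b)%R]) f (a * x + b)%R.
Proof.
move=> a0 mA mf f0.
rewrite integral_mkcond (integral_affine b a0)//.
- congr (_ * _); rewrite [RHS]integral_mkcond; apply: eq_integral => x _.
  by rewrite !patchE; congr (if _ then _ else _); apply/idP/idP; rewrite !inE.
- by apply/(measurable_restrictT _ _).1 => //; exact: measurable_funTS.
- by move=> x; rewrite patchE; case: ifP.
Qed.

Lemma integral_shift (b : R) (A : set (measurableTypeR R))
    (f : measurableTypeR R -> \bar R) : measurable A ->
  measurable_fun setT f -> (forall x, 0 <= f x) ->
  \int[mu]_(x in [set x | A (x + b)%R]) f (x + b)%R = \int[mu]_(x in A) f x.
Proof.
move=> mA mf f0; rewrite [RHS](integral_affine_set b (oner_neq0 R))//.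
rewrite normr1 mul1e (_ : [set x | A (1 * x + b)%R] = [set x | A (x + b)%R]).
  by apply: eq_integral => x _; rewrite mul1r.
by apply/seteqP; split=> x /=; rewrite mul1r.
Qed.

End AffineChange.

(** * Periodic functions and uniform angles *)

Section Periodic.
Context {R : realType}.
Local Notation mu := (@lebesgue_measure R).
Variables (T : R) (T0 : 0 < T).
Local Open Scope ereal_scope.
Variable f : measurableTypeR R -> \bar R.
Hypothesis mf : measurable_fun setT f.
Hypothesis f0 : forall x, 0 <= f x.
Hypothesis fT : forall x, f (x + T)%R = f x.

Let periodic_nat n x : f (x + n%:R * T)%R = f x.
Proof.
elim: n x => [|n ih] x; first by rewrite mul0r addr0.
by rewrite -natr1 mulrDl mul1r addrA fT.
Qed.

Let periodic_int (k : int) x : f (x + k%:~R * T)%R = f x.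
Proof.
case: k => n; first by rewrite -pmulrn periodic_nat.
by rewrite NegzE mulrNz mulNr -[in RHS](subrK (n.+1%:R * T) x)%R periodic_nat -pmulrn.
Qed.

Let mfS (D : set (measurableTypeR R)) : measurable_fun D f.
Proof. exact: measurable_funTS. Qed.

Lemma periodic_integral_co (c : R) :
  \int[mu]_(x in `[c, (c + T)%R[) f x = \int[mu]_(x in `[0%R, T[) f x.
Proof.
have shift (a b d : R) : \int[mu]_(x in `[(a + d)%R, (b + d)%R[) f x = \int[mu]_(x in `[a, b[) f (x + d)%R.
  rewrite -(@integral_shift _ d `[(a + d)%R, (b + d)%R[)//; congr (integral _ _ _).
  by apply/seteqP; split=> x /=; rewrite !in_itv/= lerD2r ltrD2r.
have main (r : R) : (0 <= r < T)%R ->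
    \int[mu]_(x in `[r, (r + T)%R[) f x = \int[mu]_(x in `[0%R, T[) f x.
  move=> /andP[r0 rT].
  have -> : `[r, (r + T)%R[%classic = `[r, T[ `|` `[T, (r + T)%R[ :> set (measurableTypeR R).
    by rewrite -itv_bndbnd_setU// bnd_simp ?(ltW rT)// lerDr.
  have -> : `[0%R, T[%classic = `[0%R, r[ `|` `[r, T[ :> set (measurableTypeR R).
    by rewrite -itv_bndbnd_setU// bnd_simp// ltW.
  rewrite !ge0_integral_setU//; last first.
  - by apply: lt_disjoint => x y; rewrite !in_itv/= => /andP[_ xr] /andP[ry _]; exact: lt_le_trans ry.
  - by apply: lt_disjoint => x y; rewrite !in_itv/= => /andP[_ xr] /andP[ry _]; exact: lt_le_trans ry.
  rewrite addeC; congr (_ + _); rewrite (_ : `[T, (r + T)%R[ = `[(0 + T)%R, (r + T)%R[)%classic; last by rewrite add0r.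
  rewrite shift.
  by apply: eq_integral => x _; rewrite fT.
pose k := Num.floor (c / T); pose r := (c - k%:~R * T)%R.
have -> : c = (r + k%:~R * T)%R by rewrite /r subrK.
transitivity (\int[mu]_(x in `[(r + k%:~R * T)%R, (r + T + k%:~R * T)%R[) f x).
  by rewrite (addrAC r).
rewrite (shift r (r + T)%R) -(main r).
  by apply: eq_integral => x _; rewrite periodic_int.
rewrite /r subr_ge0 -ler_pdivlMr// ge_floor/= ltrBlDr.
have -> : (T + k%:~R * T = (k + 1)%:~R * T)%R by rewrite intrD mulrDl mul1r addrC.
by rewrite -ltr_pdivrMr//; exact: floorD1_gt.
Qed.

Lemma periodic_shift (c : R) :
  \int[mu]_(x in `[0%R, T]) f (x + c)%R = \int[mu]_(x in `[0%R, T]) f x.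
Proof.
have mfc : measurable_fun setT (fun x : measurableTypeR R => f (x + c)%R).
  by apply: measurableT_comp => //; exact: measurable_funD.
rewrite -!integral_itv_bndo_bndc; try exact: measurable_funTS.
rewrite -(periodic_integral_co c) -(@integral_shift _ c `[c, (c + T)%R[)//.
congr (integral _ _ _).
by apply/seteqP; split=> x /=; rewrite !in_itv/= lerDr (addrC c) ltrD2r.
Qed.

Lemma periodic_opp_integral :
  \int[mu]_(x in `[0%R, T]) f (- x)%R = \int[mu]_(x in `[0%R, T]) f x.
Proof.
rewrite [RHS](@integral_affine_set _ (-1) T)//.
rewrite normrN1 mul1e; under [RHS]eq_integral do rewrite fT mulN1r.
congr (integral _ _ _); apply/seteqP; split=> x /=; rewrite !in_itv/= mulN1r => /andP[? ?]; apply/andP; split; lra.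
Qed.

Lemma uniform_shift (c : R) :
  \int[uniform_prob T0]_x f (x + c)%R = \int[uniform_prob T0]_x f x.
Proof.
rewrite !integral_uniform//.
- by rewrite periodic_shift.
- by apply: measurableT_comp => //; exact: measurable_funD.
Qed.

Lemma uniform_opp : \int[uniform_prob T0]_x f (- x)%R = \int[uniform_prob T0]_x f x.
Proof.
rewrite !integral_uniform//; first by rewrite periodic_opp_integral.
by apply: measurableT_comp => //; exact: measurable_oppr.
Qed.

End Periodic.

(** * Fundamental theorem of calculus for a nonnegative integrand singular at the ends *)

Section OpenFTC.
Context {R : realType}.
Local Notation mu := (@lebesgue_measure R).
Variables (f F : R -> R) (a b l r : R).
Hypothesis ab : a < b.
Hypothesis f0 : forall x, a < x < b -> 0 <= f x.
Hypothesis cf : forall x, a < x < b -> {for x, continuous f}.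
Hypothesis dF : forall x, a < x < b -> is_derive x 1 F (f x).
Hypothesis Fa : F x @[x --> a^'+] --> l.
Hypothesis Fb : F x @[x --> b^'-] --> r.

(** [n.+3] makes the step at most a third of the length, so that [an n < bn n] from the first index
    on. *)
Let step (n : nat) := (b - a) / n.+3%:R.
Let an (n : nat) := a + step n.
Let bn (n : nat) := b - step n.

Let ba : 0 < b - a. Proof. by rewrite subr_gt0. Qed.

Let an_gt n : a < an n.
Proof. by rewrite ltrDl divr_gt0. Qed.

Let bn_lt n : bn n < b.
Proof. by rewrite gtrDl oppr_lt0 divr_gt0. Qed.

Let an_bn n : an n < bn n.
Proof.
have h : step n <= (b - a) / 3.
  by rewrite ler_pM2l// lef_pV2 ?posrE// ler_nat.
have ba' := ba; rewrite /an /bn; lra.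
Qed.

Let step_cvg : step n @[n --> \oo] --> 0.
Proof.
rewrite -(mulr0 (b - a)); apply: cvgMr.
have := @cvg_harmonic R; rewrite -(cvg_shiftn 2%N) /harmonic.
by under eq_fun do rewrite addn2.
Qed.

Let an_cvg : F (an n) @[n --> \oo] --> l.
Proof.
apply: (cvg_at_rightP _ _ _).1 Fa an _; split; first exact: an_gt.
by rewrite -[X in _ --> X]addr0; apply: cvgD; [exact: cvg_cst|exact: step_cvg].
Qed.

Let bn_cvg : F (bn n) @[n --> \oo] --> r.
Proof.
apply: (cvg_at_leftP _ _ _).1 Fb bn _; split; first exact: bn_lt.
by rewrite -[X in _ --> X]subr0; apply: cvgB; [exact: cvg_cst|exact: step_cvg].
Qed.

(** The theorem for compact intervals applies on [[an n, bn n]]; monotone convergence passes to the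
    limit in the integrals, and the one-sided limits of [F] in the boundary values. *)
Lemma open_FTC : (\int[mu]_(x in `]a, b[) (f x)%:E = (r - l)%:E)%E.
Proof.
have mfo : measurable_fun `]a, b[ (f : measurableTypeR R -> R).
  apply: open_continuous_measurable_fun => // x; rewrite inE/= in_itv/=; exact: cf.
have -> : `]a, b[%classic = \bigcup_n `[an n, bn n]%classic :> set (measurableTypeR R).
  apply/seteqP; split=> [x|x [n _]]; rewrite /= !in_itv/=; last first.
    by move=> /andP[h1 h2]; rewrite (lt_le_trans (an_gt n))//= (le_lt_trans h2).
  move=> /andP[ax xb].
  pose d := Num.min (x - a) (b - x).
  have d0 : 0 < d by rewrite lt_min !subr_gt0 ax.
  have /cvgrPdist_lt/(_ _ d0)[N _ hN] := step_cvg.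
  exists N => //; have := hN N (leqnn _).
  rewrite sub0r normrN ger0_norm ?divr_ge0 ?(ltW ba)// /d lt_min => /andP[h1 h2].
  by rewrite /= in_itv/= /an /bn; apply/andP; split; lra.
have FE n : (\int[mu]_(x in `[an n, bn n]) (f x)%:E = (F (bn n) - F (an n))%:E)%E.
  have sub x : an n <= x <= bn n -> a < x < b.
    by move=> /andP[h1 h2]; rewrite (lt_le_trans (an_gt n))//= (le_lt_trans h2).
  have dFx x : a < x < b -> derivable F x 1 by move=> /dF[].
  have cFx x : a < x < b -> {for x, continuous F}.
    by move=> /dFx h; apply/differentiable_continuous/derivable1_diffP.
  have ha : a < an n < b by apply: sub; rewrite lexx ltW.
  have hb : a < bn n < b by apply: sub; rewrite lexx ltW.
  rewrite EFinB; apply: (@continuous_FTC2 _ f F) => //.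
  - apply: continuous_in_subspaceT => x; rewrite inE/= in_itv/= => /sub; exact: cf.
  - split.
    + move=> x; rewrite in_itv/= => /andP[h1 h2]; apply: dFx; apply: sub.
      by rewrite !ltW.
    + by apply: cvg_at_right_filter; exact: cFx.
    + by apply: cvg_at_left_filter; exact: cFx.
  - move=> x; rewrite in_itv/= => /andP[h1 h2].
    have /dF[_ <-] : a < x < b by apply: sub; rewrite !ltW.
    by rewrite derive1E.
have cv : (\int[mu]_(x in `[an n, bn n]) (f x)%:E)%E @[n --> \oo] -->
    (\int[mu]_(x in \bigcup_n `[an n, bn n]%classic) (f x)%:E)%E.
  apply: ge0_nondecreasing_set_cvg_integral => //.
  - apply/nondecreasing_seqP => n; apply/subsetPset => x /=; rewrite !in_itv/=.
    have h : step n.+1 <= step n.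
      by rewrite ler_pM2l// lef_pV2 ?posrE// ler_nat.
    by rewrite /an /bn => /andP[h1 h2]; apply/andP; split; lra.
  - move=> n; apply/measurable_EFinP; apply: measurable_funS mfo => // x /=.
    rewrite !in_itv/= => /andP[h1 h2].
    by rewrite (lt_le_trans (an_gt n))//= (le_lt_trans h2).
  - move=> n x; rewrite /= in_itv/= lee_fin => /andP[h1 h2]; apply: f0.
    by rewrite (lt_le_trans (an_gt n))//= (le_lt_trans h2).
apply: (cvg_unique _ cv) => //; rewrite (_ : (fun n => _) = (fun n => (F (bn n) - F (an n))%:E)).
  by apply: cvg_EFin; [exact: nearW|exact: cvgB].
by apply/funext => n; exact: FE.
Qed.

End OpenFTC.

(** * The chordal kernel of the real projective line *)

Lemma measurable_inv (R : realType) : measurable_fun setT (fun x : R => x^-1).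
Proof.
rewrite (_ : (fun x => _) = (fun x : R => if x == 0 then 0 else x^-1)); last first.
  by apply/funext => x; case: eqP => // ->; rewrite invr0.
apply: measurable_fun_if => //; first exact: measurable_fun_eqr.
rewrite setTI; apply: open_continuous_measurable_fun.
  rewrite (_ : _ @^-1` _ = ~` [set 0]); first exact: closed_openC.
  by apply/seteqP; split=> x /=; [move/negbT/eqP|move/eqP/negbTE].
by move=> x; rewrite inE/= => /negbT x0; exact: inv_continuous.
Qed.

Section ArcOverlap.
Context {R : realType}.
Local Notation mu := (@lebesgue_measure R).
Local Notation pi := (@pi R).

Lemma pihalf_gt0 : 0 < pi / 2. Proof. by rewrite divr_gt0// pi_gt0. Qed.

Lemma sin_meas : measurable_fun setT (@sin R).
Proof. by apply: continuous_measurable_fun; exact: continuous_sin. Qed.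

Lemma cos_meas : measurable_fun setT (@cos R).
Proof. by apply: continuous_measurable_fun; exact: continuous_cos. Qed.

Lemma sin_le_id (x : R) : 0 <= x -> sin x <= x.
Proof.
move=> x0; have [|c _ e] := @MVT_segment _ (@sin R) (@cos R) 0 x x0 (fun y _ => is_derive_sin y).
  by apply: continuous_subspaceT; exact: continuous_sin.
by move: e; rewrite sin0 !subr0 => ->; rewrite ler_piMl// cos_le1.
Qed.

Lemma ler_sin_pihalf x y : - (pi / 2) <= x <= pi / 2 -> - (pi / 2) <= y <= pi / 2 ->
  (sin x <= sin y) = (x <= y).
Proof. by move=> hx hy; rewrite !leNgt ltr_sin// in_itv. Qed.

Lemma sin_norm_le t u : 0 <= t <= pi / 2 -> `|u| <= pi / 2 ->
  (`|sin u| <= sin t) = (`|u| <= t).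
Proof.
have p0 := pihalf_gt0; have p1 := @pi_gt0 R => /andP[t0 t1] u1.
have -> : `|sin u| = sin `|u|.
  have [u0|u0] := leP 0 u.
    move: u1; rewrite !(ger0_norm u0) => u1; rewrite ger0_norm// sin_ge0_pi// u0/=.
    by lra.
  move: u1; rewrite (ltr0_norm u0) => u1; rewrite -normrN -sinN ger0_norm// sin_ge0_pi//.
  by apply/andP; split; lra.
have n0 := normr_ge0 u.
by rewrite ler_sin_pihalf//; apply/andP; split; lra.
Qed.

(** Angles count modulo [pi], so two arcs might meet on both sides of the circle. The bound
    [t < pi / 2] excludes the second meeting, which is the case [pi / 2 < d - u], where the sine is
    evaluated at [pi - (d - u)]. *)
Lemma arc_overlap_window d t u : 0 <= d <= pi / 2 -> 0 < t < pi / 2 -> - (pi / 2) <= u <= pi / 2 ->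
  (`|sin u| <= sin (t / 2)) && (`|sin (u - d)| <= sin (t / 2)) = (d - t / 2 <= u <= t / 2).
Proof.
have p0 := pihalf_gt0; have p1 := @pi_gt0 R => /andP[d0 d1] /andP[t0 t1] /andP[u0 u1].
have t2 : 0 <= t / 2 <= pi / 2 by apply/andP; split; lra.
have un : `|u| <= pi / 2 by rewrite ler_norml u0.
rewrite (sin_norm_le t2 un) ler_norml.
have [ut|ut] := leP u (t / 2); last by rewrite !andbF.
rewrite !andbT.
have [ud|ud] := leP (d - t / 2) u.
  rewrite (_ : - (t / 2) <= u)/=; last by lra.
  by rewrite sin_norm_le// ler_norml; apply/andP; split; lra.
have [tu|//] := leP (- (t / 2)) u; apply/negbTE; rewrite -ltNge/= -normrN -sinN opprB.
have h0 : 0 < d - u < pi by apply/andP; split; lra.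
rewrite gtr0_norm ?sin_gt0_pi//.
have [dh|dh] := leP (d - u) (pi / 2).
  by rewrite ltr_sin ?in_itv//=; first lra; apply/andP; split; lra.
have -> : sin (d - u) = sin (pi - (d - u)) by rewrite [RHS]sinB sinpi cospi mul0r mulN1r sub0r opprK.
by rewrite ltr_sin ?in_itv//=; first lra; apply/andP; split; lra.
Qed.

(** The probability that an arc of length [t] with uniformly distributed center contains both
    angles, all angles being those of lines and hence taken modulo [pi]. *)
Definition overlap (t p q : R) : \bar R :=
  (\int[uniform_prob (@pi_gt0 R)]_u
    (((`|sin (u - p)| <= sin (t / 2)) && (`|sin (u - q)| <= sin (t / 2)))%R%:R)%:E)%E.

Lemma overlap_meas t p q : measurable_fun setT (fun u : measurableTypeR R =>
    (((`|sin (u - p)| <= sin (t / 2)) && (`|sin (u - q)| <= sin (t / 2)))%R%:R)%:E : \bar R).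
Proof.
have m1 p' : measurable_fun setT (fun u : measurableTypeR R => `|sin (u - p')|).
  apply: measurableT_comp => //; apply: (measurableT_comp sin_meas).
  by apply: measurable_funB.
apply/measurable_EFinP.
rewrite (_ : (fun u => _) = (fun u => if ((`|sin (u - p)| <= sin (t / 2)) && (`|sin (u - q)| <= sin (t / 2))) then 1 else 0)); last first.
  by apply/funext => u; case: ifP.
by apply: measurable_fun_if => //; apply: measurable_and; apply: measurable_fun_ler.
Qed.

Let abs_sinDpi x : `|sin (x + pi)| = `|sin x|.
Proof. by rewrite sinDpi normrN. Qed.

Let arc_periodic t p q u :
  (((`|sin (u + pi - p)| <= sin (t / 2)) && (`|sin (u + pi - q)| <= sin (t / 2)))%R%:R)%:E =
  (((`|sin (u - p)| <= sin (t / 2)) && (`|sin (u - q)| <= sin (t / 2)))%R%:R)%:E :> \bar R.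
Proof. by rewrite ![u + pi - _]addrAC !abs_sinDpi. Qed.

Let overlap_shift t p q : overlap t p q = overlap t 0 (q - p).
Proof.
rewrite /overlap -(@uniform_shift _ _ _ _ (overlap_meas t p q) _ (arc_periodic t p q) p)//.
by apply: eq_integral => u _; rewrite subr0 addrK opprB addrA.
Qed.

Let overlap_opp t q : overlap t 0 (- q) = overlap t 0 q.
Proof.
rewrite /overlap -(@uniform_opp _ _ _ _ (overlap_meas t 0 q) _ (arc_periodic t 0 q))//.
apply: eq_integral => u _; rewrite !subr0 opprK sinN normrN.
by rewrite -[in RHS]opprD sinN normrN.
Qed.

Let overlap_window d t : 0 <= d <= pi / 2 -> 0 < t < pi / 2 ->
  overlap t 0 d = (Num.max (t - d) 0 / pi)%:E.
Proof.
move=> d01 t01; have p0 := pihalf_gt0; have p1 := @pi_gt0 R.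
rewrite /overlap -(@uniform_shift _ _ _ _ (overlap_meas t 0 d) _ (arc_periodic t 0 d) (- (pi / 2)))//.
rewrite integral_uniform//; last first.
  under eq_fun do rewrite -!addrA -!opprD; exact: overlap_meas.
pose I := `[d - t / 2 + pi / 2, t / 2 + pi / 2]%classic : set (measurableTypeR R).
transitivity ((pi - 0)^-1%:E * \int[mu]_(x in `[0%R, pi]%classic) (\1_I x)%:E)%E.
  congr (_ * _)%E; apply: eq_integral => u; rewrite inE/= in_itv/= => /andP[u0 u1].
  rewrite !subr0 arc_overlap_window//; last by apply/andP; split; lra.
  rewrite indicE /I mem_setE in_itv/=; congr (_%:R)%:E; congr (nat_of_bool (_ && _)).
    by rewrite lerBrDr.
  by rewrite lerBlDr.
have mI : measurable I by exact: measurable_itv.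
rewrite integral_indic//.
rewrite (_ : I `&` _ = I); last first.
  apply/setIidPl => x; rewrite /I/= !in_itv/=; case/andP: d01 => ? ?; case/andP: t01 => ? ? /andP[? ?].
  by apply/andP; split; lra.
rewrite subr0 [X in (_ * X)%E]lebesgue_measure_itv/= lte_fin ltrD2r.
have -> : (d - t / 2 < t / 2) = (0 < t - d) by apply/idP/idP => ?; lra.
rewrite -EFinD; case: ltP => h.
  by rewrite -EFinM mulrC; congr (_ / _)%:E; lra.
by rewrite mule0 mul0r.
Qed.

Let abs_sin_sub (x d : R) : sin d = `|sin x| -> cos d = `|cos x| ->
  (forall u, `|sin (u - x)| = `|sin (u - d)|) \/ (forall u, `|sin (u - x)| = `|sin (u - - d)|).
Proof.
move=> sd cd; have [s0|s0] := leP 0 (sin x); have [c0|c0] := leP 0 (cos x); [left|right|right|left];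
  move=> u; rewrite !sinB ?sinN ?cosN sd cd ?(ger0_norm s0) ?(ger0_norm c0) ?(ltr0_norm s0) ?(ltr0_norm c0);
  first [by []|by rewrite -normrN; congr `|_|; ring|by congr `|_|; ring].
Qed.

(** [d] is the angle between the two lines. Translation and reflection invariance of the uniform law
    leave only the overlap of an arc around 0 with one around [d], and a single [d] works for all
    [t]. *)
Lemma overlapE p q : exists2 d, 0 <= d <= pi / 2 /\ sin d = `|sin (p - q)| &
  forall t, 0 < t < pi / 2 -> overlap t p q = (Num.max (t - d) 0 / pi)%:E.
Proof.
pose th := q - p; pose d := asin `|sin th|.
have s1 : -1 <= `|sin th| <= 1.
  by rewrite (le_trans _ (normr_ge0 _)) ?lerN10//= sin_max.
have sd : sin d = `|sin th| by rewrite asinK// in_itv.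
have d1 : d <= pi / 2 by exact: asin_lepi2.
have d0 : 0 <= d.
  rewrite -(@ler_sin_pihalf 0 d) ?sin0 ?sd//; have p0 := pihalf_gt0.
    by rewrite oppr_le0 !ltW.
  by rewrite asin_geNpi2.
exists d; first by rewrite d0 d1 -normrN -sinN opprB.
move=> t t01.
have cd : cos d = `|cos th|.
  by rewrite cos_asin// real_normK ?num_real// -cos2sin2 sqrtr_sqr.
suff h : (forall u, `|sin (u - th)| = `|sin (u - d)|) \/ (forall u, `|sin (u - th)| = `|sin (u - - d)|).
  rewrite overlap_shift -(overlap_window _ t01) ?d0//.
  by case: h => h; [|rewrite -[RHS]overlap_opp]; apply: eq_integral => u _; rewrite -/th h.
exact: abs_sin_sub.
Qed.

(* The antiderivative is [ln (sin t) - (t - d) cot t]. *)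
Lemma integral_log_sin d : 0 <= d <= pi / 2 ->
  (\int[mu]_(t in `]0%R, (pi / 2)%R[) (Num.max (t - d) 0 / sin t ^+ 2)%:E =
   - lne (sin d)%:E)%E.
Proof.
have p0 := pihalf_gt0; have p1 := @pi_gt0 R.
have sin0p t : 0 < t < pi -> 0 < sin t by exact: sin_gt0_pi.
have max_meas e : measurable_fun (`]0%R, (pi / 2)%R[ : set (measurableTypeR R))
    (fun t => (Num.max (t - e) 0 / sin t ^+ 2)%:E).
  apply: measurable_funTS; apply/measurable_EFinP; apply: measurable_funM.
    by apply: measurable_maxr => //; apply: measurable_funB.
  apply: (measurableT_comp (@measurable_inv R)); apply: measurable_funX; exact: sin_meas.
have main e : 0 < e < pi / 2 ->
    (\int[mu]_(t in `]0%R, (pi / 2)%R[) (Num.max (t - e) 0 / sin t ^+ 2)%:E = (- ln (sin e))%:E)%E.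
  move=> /andP[e0 e1].
  transitivity (\int[mu]_(t in `]e, (pi / 2)%R[) ((t - e) / sin t ^+ 2)%:E)%E.
    rewrite integral_mkcond [RHS]integral_mkcond; apply: eq_integral => t _.
    rewrite !patchE !mem_setE !in_itv/=.
    have [te|te] := leP t e.
      by rewrite (max_idPr _) ?subr_le0// mul0r; case: ifP.
    by rewrite (lt_trans e0 te)/= (max_idPl _)// subr_ge0 ltW.
  pose F t := ln (sin t) - (t - e) * (cos t * (sin t)^-1).
  have dF t : e <= t <= pi / 2 -> is_derive t 1 F ((t - e) / sin t ^+ 2).
    move=> /andP[t0 t1]; have st : 0 < sin t by apply: sin0p; apply/andP; split; lra.
    have sn : sin t != 0 by rewrite gt_eqF.
    have d1 : is_derive t 1 (fun t => ln (sin t)) ((sin t)^-1 * cos t).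
      by apply: (@is_derive1_comp _ (@ln R) (@sin R)); exact: is_derive1_ln.
    have d2 : is_derive t 1 (fun t => (sin t)^-1) (- (sin t) ^- 2 * cos t).
      exact: (@is_deriveV _ (@sin R) t (cos t) 1 sn (is_derive_sin t)).
    have d3 : is_derive t 1 (fun t => t - e) 1 by apply: is_derive_eq; rewrite subr0.
    have d4 := is_deriveM (is_derive_cos t) d2.
    have d5 := is_deriveB d1 (is_deriveM d3 d4).
    apply: is_derive_eq d5 _.
    rewrite /GRing.scale/= -[(_ * _) t]/(cos t * (sin t)^-1).
    transitivity ((t - e) * (cos t ^+ 2 + sin t ^+ 2) / sin t ^+ 2); first by field.
    by rewrite cos2Dsin2 mulr1.
  have cF t : e <= t <= pi / 2 -> {for t, continuous F}.
    by move=> /dF[h _]; apply/differentiable_continuous/derivable1_diffP.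
  have dF' t : e < t < pi / 2 -> is_derive t 1 F ((t - e) / sin t ^+ 2).
    by move=> /andP[t0 t1]; apply: dF; rewrite !ltW.
  rewrite -[- ln _]sub0r.
  apply: (@open_FTC _ (fun t => (t - e) / sin t ^+ 2) F e (pi / 2) (ln (sin e)) 0 _ _ _ dF') => //.
  - move=> t /andP[t0 t1]; rewrite divr_ge0 ?sqr_ge0// subr_ge0 ltW//.
  - move=> t /andP[t0 t1]; have st : 0 < sin t by apply: sin0p; apply/andP; split; lra.
    apply: cvgM; first by apply: cvgB; [exact: cvg_id|exact: cvg_cst].
    apply: cvgV; first by rewrite expf_neq0// gt_eqF.
    by under eq_fun do rewrite expr2; rewrite expr2; apply: cvgM; exact: continuous_sin.
  - have -> : ln (sin e) = F e by rewrite /F subrr mul0r subr0.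
    by apply: cvg_at_right_filter; apply: cF; rewrite lexx ltW.
  - have -> : 0 = F (pi / 2) by rewrite /F sin_pihalf cos_pihalf ln1 mul0r mulr0 subr0.
    by apply: cvg_at_left_filter; apply: cF; rewrite lexx ltW.
move=> /andP[d0 d1].
have [dp|dp] := eqVneq d (pi / 2).
  rewrite dp sin_pihalf lne1 oppe0; apply: integral0_eq => t.
  by rewrite /= in_itv/= => /andP[_ tp]; rewrite (max_idPr _) ?mul0r// subr_le0 ltW.
have d1' : d < pi / 2 by rewrite lt_neqAle dp.
have [d00|d00] := eqVneq d 0; last first.
  have d0' : 0 < d by rewrite lt_neqAle eq_sym d00.
  by rewrite main ?d0'// lne_EFin ?EFinN//; apply: sin0p; apply/andP; split; lra.
rewrite d00 sin0 le0_lneNy//=; apply/eqP; rewrite -leye_eq leNgt; apply/negP.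
set I := (\int[mu]_(t in _) _)%E => Ioo.
have I0 : (0 <= I)%E.
  apply: integral_ge0 => t _; rewrite lee_fin divr_ge0 ?sqr_ge0//.
  by rewrite le_max lexx orbT.
have Ifin : I \is a fin_num by rewrite ge0_fin_numE.
(* The integral for [d = 0] dominates those for positive angles; a finite value [I] would be at
   least the value [I + 1] attained at the angle [asin y]. *)
pose y := expR (- (fine I + 1)).
have y0 : 0 < y by exact: expR_gt0.
have y1 : y < 1 by rewrite expR_lt1 oppr_lt0 ltr_wpDl// fine_ge0.
have y11 : -1 <= y <= 1 by rewrite (ltW y1) (le_trans _ (ltW y0)) ?lerN10.
have sy : sin (asin y) = y by rewrite asinK// in_itv.
have e1 : asin y < pi / 2 by rewrite asin_ltpi2// y1 andbT; case/andP: y11.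
have e0 : 0 < asin y.
  rewrite ltNge -(@ler_sin_pihalf (asin y) 0) ?sin0 ?sy -?ltNge//.
    by rewrite asin_geNpi2// ltW.
  by rewrite oppr_le0 !ltW.
have : ((- ln (sin (asin y)))%:E <= I)%E.
  rewrite -main ?e0//; apply: ge0_le_integral => //.
  - by move=> t _; rewrite lee_fin divr_ge0 ?sqr_ge0// le_max lexx orbT.
  - move=> t; rewrite /= in_itv/= => /andP[t0 _]; rewrite lee_fin subr0 ler_wpM2r ?invr_ge0 ?sqr_ge0//.
    by rewrite ge_max !le_max lexx orbT andbT gerBl// ltW.
by rewrite sy expRK opprK -(fineK Ifin) lee_fin gerDl ler10.
Qed.

End ArcOverlap.

(** * The energy kernel as a superposition of arcs *)

Section RealPoints.
Context {R : realType} {L : fieldType} (v : absolute_value R L).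
Hypothesis v_nontrivial : nontrivial_absv v.
Hypothesis L_locally_compact : locally_compact [set: valued v].
Variable phi : {rmorphism R -> L}.
Hypothesis phi_bij : bijective phi.
Hypothesis phi_norm : forall x, v (phi x) = `|x|.
Local Notation X := (borel (P1 v)).

Definition real_point (a b : R) : P1 v := hpoint v (phi a) (phi b).

Let phi_pair a b : (a, b) != (0, 0) -> (phi a, phi b) != (0, 0).
Proof. by rewrite !xpair_eqE !fmorph_eq0. Qed.

Lemma delta_real_point a b c d : (a, b) != (0, 0) -> (c, d) != (0, 0) ->
  delta (real_point a b) (real_point c d) =
  `|a * d - b * c| / (Num.max `|a| `|b| * Num.max `|c| `|d|).
Proof.
move=> ab cd; rewrite delta_hpoint; [|exact: phi_pair..].
by rewrite /chordal/= -!rmorphM -rmorphB !phi_norm [c * b]mulrC.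
Qed.

Lemma real_point_scale c a b : c != 0 -> (a, b) != (0, 0) ->
  real_point (c * a) (c * b) = real_point a b.
Proof.
by move=> c0 ab; rewrite /real_point !rmorphM hpoint_scale ?fmorph_eq0//; exact: phi_pair.
Qed.

Lemma real_point_ind (Q : P1 v -> Prop) :
  (forall a b, (a, b) != (0, 0) -> Q (real_point a b)) -> forall p, Q p.
Proof.
case: phi_bij => psi psiK phiK QP; apply: hpoint_ind => a b ab.
rewrite -(phiK a) -(phiK b); apply: QP.
by move: ab; rewrite !xpair_eqE -(fmorph_eq0 phi (psi a)) -(fmorph_eq0 phi (psi b)) !phiK.
Qed.

Lemma real_chart_continuous : continuous (fun x : R => real_point x 1).
Proof.
have pc : continuous (phi : R -> valued v).
  move=> x A /nbhs_absv[e e0 eA]; apply/nbhs_ballP; exists e => // y.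
  by rewrite /ball/= => xy; apply: eA; rewrite -rmorphB phi_norm.
rewrite /real_point rmorph1 => x; apply: (@continuous_comp _ _ _ (phi : R -> valued v)
  ((fun z => hpoint v z 1) : valued v -> P1 v)); first exact: pc.
exact: (chart_continuous v).1.
Qed.

Lemma real_point_meas d (T : measurableType d) (f g : T -> R) :
  measurable_fun setT f -> measurable_fun setT g ->
  measurable_fun setT (fun t => real_point (f t) (g t) : X).
Proof.
move=> mf mg.
have chart : measurable_fun setT (fun x : R => real_point x 1 : X).
  apply: borel_measurable_fun => U oU; apply: open_measurable.
  exact: (@continuousP _ _ _).1 real_chart_continuous _ oU.
rewrite (_ : (fun t => _) =
    (fun t => if g t == 0 then real_point 1 0 else real_point (f t / g t) 1)); last first.
  apply/funext => t; case: eqP => [->|/eqP g0].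
    have [->|f0] := eqVneq (f t) 0.
      (* When both coordinates vanish, the default value of [hpoint] is [(1 : 0)], in agreement with
         the first branch. *)
      rewrite /real_point rmorph0 rmorph1 /hpoint; congr (\pi_(P1 v) _)%qT.
      rewrite /insubd insubF; last by apply/negbTE; rewrite notin_setE /nzpair/= eqxx.
      rewrite insubT/=; first exact: nzpair10.
      by move=> nz; congr exist; exact: bool_irrelevance.
    rewrite -[RHS](@real_point_scale (f t))// ?mulr1 ?mulr0//.
    by rewrite xpair_eqE oner_eq0.
  rewrite -[RHS](@real_point_scale (g t))//; last by rewrite xpair_eqE oner_eq0 andbF.
  by rewrite mulr1 mulrC divfK.
apply: measurable_fun_if => //.
- apply: measurable_fun_eqr => //.
- apply: measurable_funTS; apply: (measurableT_comp chart).
  apply: measurable_funM => //; apply: measurableT_comp => //.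
  exact: measurable_inv.
Qed.

Definition angle_point (t : R) : P1 v := real_point (cos t) (sin t).

Lemma cos_sin_neq0 t : (cos t, sin t) != (0, 0) :> R * R.
Proof.
rewrite xpair_eqE negb_and; have := cos2Dsin2 t.
case: eqP => //= ->; case: eqP => // ->; rewrite expr0n/= addr0 => /eqP.
by rewrite eq_sym oner_eq0.
Qed.

Lemma angle_point_ind (Q : P1 v -> Prop) : (forall t, Q (angle_point t)) -> forall p, Q p.
Proof.
move=> QP; apply: real_point_ind => a b ab.
pose r := Num.sqrt (a ^+ 2 + b ^+ 2).
have r2 : 0 < a ^+ 2 + b ^+ 2.
  rewrite lt_neqAle addr_ge0 ?sqr_ge0// andbT eq_sym; apply: contra ab.
  by rewrite paddr_eq0 ?sqr_ge0// !sqrf_eq0 xpair_eqE.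
have r0 : 0 < r by rewrite sqrtr_gt0.
have rE : r ^+ 2 = a ^+ 2 + b ^+ 2 by rewrite sqr_sqrtr// ltW.
have ar : -1 <= a / r <= 1.
  rewrite -ler_norml normrM normfV (gtr0_norm r0) ler_pdivrMr// mul1r.
  by rewrite -ler_sqr ?nnegrE ?(ltW r0)// real_normK ?num_real// rE lerDl sqr_ge0.
have sE : Num.sqrt (1 - (a / r) ^+ 2) = `|b| / r.
  rewrite -[RHS]ger0_norm ?divr_ge0 ?(ltW r0)// -sqrtr_sqr; congr Num.sqrt.
  rewrite !exprMn !exprVn rE real_normK ?num_real//; field.
  by rewrite gt_eqF.
have [t ct st] : exists2 t, cos t = a / r & sin t = b / r.
  have [b0|b0] := leP 0 b.
    exists (acos (a / r)); first by rewrite acosK// in_itv.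
    by rewrite sin_acos// sE ger0_norm.
  exists (- acos (a / r)); first by rewrite cosN acosK// in_itv.
  by rewrite sinN sin_acos// sE ltr0_norm// mulNr opprK.
have <- : angle_point t = real_point a b.
  rewrite /angle_point -(@real_point_scale r) ?cos_sin_neq0 ?gt_eqF//.
  by rewrite ct st ![r * _]mulrC !divfK ?gt_eqF.
exact: QP.
Qed.

Definition sup_norm t : R := Num.max `|cos t| `|sin t|.

Lemma sup_norm_bound t : 1 / 2 <= sup_norm t ^+ 2 <= 1.
Proof.
have := cos2Dsin2 t; rewrite -[cos t ^+ 2]real_normK ?num_real// -[sin t ^+ 2]real_normK ?num_real//.
rewrite /sup_norm; move: (normr_ge0 (cos t)) (normr_ge0 (sin t)).
move: `|cos t| `|sin t| => c s c0 s0 cs; rewrite !expr2 in cs *.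
have cc := mulr_ge0 c0 c0; have ss := mulr_ge0 s0 s0.
by case: (leP c s) => h; [have h2 := ler_pM c0 c0 h h|have h2 := ler_pM s0 s0 (ltW h) (ltW h)];
  apply/andP; split; lra.
Qed.

Lemma sup_norm_gt0 t : 0 < sup_norm t.
Proof.
have /andP[h _] := sup_norm_bound t.
have h0 : 0 <= sup_norm t by rewrite /sup_norm le_max normr_ge0.
rewrite lt_neqAle h0 andbT eq_sym; apply/eqP => e; move: h; rewrite e expr0n/=; lra.
Qed.

Lemma sup_norm_le1 t : sup_norm t <= 1.
Proof.
have /andP[_ h] := sup_norm_bound t.
by rewrite -(@ler_pXn2r _ 2) ?nnegrE ?(ltW (sup_norm_gt0 t))// expr1n.
Qed.

Lemma sup_norm_mul s t : 1 / 2 <= sup_norm s * sup_norm t.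
Proof.
have M0 := sup_norm_gt0 s; have N0 := sup_norm_gt0 t.
have /andP[h1 _] := sup_norm_bound s; have /andP[h2 _] := sup_norm_bound t.
rewrite -(@ler_pXn2r _ 2) ?nnegrE ?mulr_ge0 ?(ltW M0) ?(ltW N0)//.
by rewrite [leRHS]exprMn [leLHS]expr2 ler_pM//; lra.
Qed.

Lemma delta_angle_point s t : delta (angle_point s) (angle_point t) =
  `|sin (s - t)| / (sup_norm s * sup_norm t).
Proof.
rewrite delta_real_point ?cos_sin_neq0//; congr (_ / _).
by rewrite -normrN sinB; congr `|_|; ring.
Qed.

(* The products of the homogeneous coordinates of a point of norm 1, recovered
   from its distances to three points: this makes them functions on [P1] that
   are visibly measurable. *)
Let coord1 (p : P1 v) := delta (real_point 0 1) p ^+ 2.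
Let coord2 (p : P1 v) := delta (real_point 1 0) p ^+ 2.
Let coord12 (p : P1 v) := (coord1 p + coord2 p - delta (real_point 1 1) p ^+ 2) / 2.

Let coordE t : let M := sup_norm t in
  [/\ coord1 (angle_point t) = cos t ^+ 2 / M ^+ 2,
   coord2 (angle_point t) = sin t ^+ 2 / M ^+ 2 &
   coord12 (angle_point t) = cos t * sin t / M ^+ 2].
Proof.
move=> M; have M0 : M != 0 by rewrite gt_eqF// sup_norm_gt0.
have c1 : coord1 (angle_point t) = cos t ^+ 2 / M ^+ 2.
  rewrite /coord1 delta_real_point ?cos_sin_neq0 ?xpair_eqE ?oner_eq0 ?andbF//.
  rewrite normr0 normr1 mul0r mul1r sub0r normrN (max_idPr ler01) mul1r -/M.
  by rewrite exprMn exprVn real_normK ?num_real.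
have c2 : coord2 (angle_point t) = sin t ^+ 2 / M ^+ 2.
  rewrite /coord2 delta_real_point ?cos_sin_neq0 ?xpair_eqE ?oner_eq0 ?andbF//.
  rewrite normr0 normr1 mul0r mul1r subr0 (max_idPl ler01) mul1r -/M.
  by rewrite exprMn exprVn real_normK ?num_real.
split=> //; rewrite /coord12 c1 c2.
rewrite delta_real_point ?cos_sin_neq0 ?xpair_eqE ?oner_eq0 ?andbF//.
rewrite normr1 !mul1r maxxx mul1r -/(sup_norm t) -/M exprMn exprVn real_normK ?num_real//.
by field.
Qed.

Let coord_meas : [/\ measurable_fun setT (coord1 : X -> R),
  measurable_fun setT (coord2 : X -> R) & measurable_fun setT (coord12 : X -> R)].
Proof.
have md p : measurable_fun setT (delta p : X -> R).
  by apply: continuous_borel; exact: delta_continuous.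
have m1 : measurable_fun setT (coord1 : X -> R) by exact: measurable_funX.
have m2 : measurable_fun setT (coord2 : X -> R) by exact: measurable_funX.
split=> //; apply: measurable_funM => //; apply: measurable_funB => //.
  exact: measurable_funD.
exact: measurable_funX.
Qed.

(** Minus the logarithm of the sup norm of a representative of Euclidean norm 1: it measures the
    discrepancy between [delta] and the absolute sine of the angle. *)
Definition angle_weight (p : P1 v) := ln (coord1 p + coord2 p) / 2.

Lemma angle_weightE t : angle_weight (angle_point t) = - ln (sup_norm t).
Proof.
have [c1 c2 _] := coordE t; rewrite /angle_weight c1 c2 -mulrDl cos2Dsin2 mul1r.
rewrite lnV ?posrE ?exprn_gt0 ?sup_norm_gt0// lnXn ?sup_norm_gt0//.
by rewrite -[ln _ *+ 2]mulr_natr mulNr mulfK.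
Qed.

Lemma angle_weight_meas : measurable_fun setT (angle_weight : X -> R).
Proof.
have [m1 m2 _] := coord_meas; apply: measurable_funM => //.
by apply: (measurableT_comp (@measurable_ln R)); exact: measurable_funD.
Qed.

Lemma angle_weight_ge0 p : 0 <= angle_weight p.
Proof.
elim/angle_point_ind: p => t; rewrite angle_weightE oppr_ge0.
by rewrite ln_le0// sup_norm_le1.
Qed.

Lemma angle_weight_le p : angle_weight p <= ln 2.
Proof.
elim/angle_point_ind: p => t; rewrite angle_weightE -lnV ?posrE ?sup_norm_gt0//.
rewrite ler_ln ?posrE ?invr_gt0 ?sup_norm_gt0// -[leRHS]invrK lef_pV2 ?posrE ?sup_norm_gt0//.
have := sup_norm_bound t; have := sup_norm_gt0 t; have := sup_norm_le1 t; nra.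
Qed.

(* For the point of angle [s] this says [|sin (u - s)| <= sin (t / 2)], the
   left-hand side being the square of a linear form in the coordinates. *)
Definition in_arc (t u : R) (p : P1 v) : bool :=
  coord1 p * sin u ^+ 2 - 2 * coord12 p * (sin u * cos u) + coord2 p * cos u ^+ 2
  <= sin (t / 2) ^+ 2 * (coord1 p + coord2 p).

Lemma in_arcE t u s : 0 <= sin (t / 2) ->
  in_arc t u (angle_point s) = (`|sin (u - s)| <= sin (t / 2)).
Proof.
move=> st; have [c1 c2 c12] := coordE s; rewrite /in_arc c1 c2 c12.
have M0 : 0 < sup_norm s ^+ 2 by rewrite exprn_gt0// sup_norm_gt0.
rewrite -mulrDl cos2Dsin2 mul1r -(@ler_sqr _ `|_|) ?nnegrE//.
rewrite real_normK ?num_real// -(ler_pM2r (x := (sup_norm s ^+ 2)^-1)) ?invr_gt0// sinB.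
congr (_ <= _); field; exact: lt0r_neq0 (sup_norm_gt0 s).
Qed.

Local Notation W := (measurableTypeR R * measurableTypeR R)%type.

(** The product of two nonzero values is [pi / sin t ^ 2]; the factor [pi] cancels the density of
    the uniform law in [overlap], and what remains is the integrand of [integral_log_sin]. *)
Definition arc_kernel (z : W * X) : R :=
  if (0 < z.1.1 < pi / 2) && in_arc z.1.1 z.1.2 z.2
  then Num.sqrt pi / sin z.1.1 else 0.

Definition arc_measure : {sigma_finite_measure set W -> \bar R} :=
  probability_product (@lebesgue_measure R) (uniform_prob (@pi_gt0 R)).

Let sqrt_pi : Num.sqrt pi * Num.sqrt pi = pi :> R.
Proof. by rewrite -expr2 sqr_sqrtr// pi_ge0. Qed.

Lemma arc_kernel_ge0 z : 0 <= arc_kernel z.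
Proof.
rewrite /arc_kernel; case: ifP => // /andP[/andP[t0 t1] _].
by rewrite divr_ge0 ?sqrtr_ge0// ltW// sin_gt0_pihalf// t0.
Qed.

Lemma arc_kernel_meas : measurable_fun setT arc_kernel.
Proof.
have mt : measurable_fun setT (fun z : W * X => z.1.1).
  exact: measurableT_comp measurable_fst measurable_fst.
have mu : measurable_fun setT (fun z : W * X => z.1.2).
  exact: measurableT_comp measurable_snd measurable_fst.
have [c1 c2 c12] := coord_meas.
have m1 : measurable_fun setT (fun z : W * X => coord1 z.2) by exact: measurableT_comp c1 measurable_snd.
have m2 : measurable_fun setT (fun z : W * X => coord2 z.2) by exact: measurableT_comp c2 measurable_snd.
have m12 : measurable_fun setT (fun z : W * X => coord12 z.2) by exact: measurableT_comp c12 measurable_snd.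
have ms : measurable_fun setT (fun z : W * X => sin z.1.2) by exact: measurableT_comp sin_meas mu.
have mc : measurable_fun setT (fun z : W * X => cos z.1.2) by exact: measurableT_comp cos_meas mu.
have mh : measurable_fun setT (fun z : W * X => sin (z.1.1 / 2)).
  by apply: (measurableT_comp sin_meas); exact: measurable_funM.
apply: measurable_fun_if => //.
- apply: measurable_and.
    by apply: measurable_and; apply: measurable_fun_ltr.
  apply: measurable_fun_ler.
    apply: measurable_funD; last by apply: measurable_funM => //; exact: measurable_funX.
    apply: measurable_funB; first by apply: measurable_funM => //; exact: measurable_funX.
    by apply: measurable_funM; apply: measurable_funM.
  apply: measurable_funM; first exact: measurable_funX.
  exact: measurable_funD.
- apply: measurable_funTS; apply: measurable_funM => //.
  apply: (measurableT_comp (@measurable_inv R)).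
  exact: measurableT_comp sin_meas mt.
Qed.

Lemma arc_kernel_bnd s : exists M, forall x, arc_kernel (s, x) <= M.
Proof.
exists (Num.sqrt pi / `|sin s.1|) => x; rewrite /arc_kernel/=.
case: ifP => [/andP[/andP[t0 t1] _]|_]; last by rewrite divr_ge0 ?sqrtr_ge0.
by rewrite gtr0_norm// sin_gt0_pihalf// t0.
Qed.

Let sin_half_ge0 t : 0 < t < pi / 2 -> 0 <= sin (t / 2) :> R.
Proof.
move=> /andP[t0 t1]; rewrite ltW// sin_gt0_pi//; have := @pi_gt0 R => p0.
by apply/andP; split; lra.
Qed.

Let sinp_gt0 t : 0 < t < pi / 2 -> 0 < sin t :> R.
Proof. exact: sin_gt0_pihalf. Qed.

(* The arcs of length [t] that contain two points at angular distance [d] have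
   centers in an interval of length [max (t - d) 0], so the product of the
   kernels integrates to [integral_log_sin]. *)
Lemma arc_gram x y : (- lne (delta x y)%:E + (angle_weight x)%:E + (angle_weight y)%:E =
  gram arc_measure arc_kernel (x, y))%E.
Proof.
elim/angle_point_ind: x => p; elim/angle_point_ind: y => q.
have [d [d01 sd] dov] := overlapE p q.
transitivity (- lne (sin d)%:E)%E.
  rewrite delta_angle_point -sd !angle_weightE.
  have M0 := sup_norm_gt0 p; have N0 := sup_norm_gt0 q.
  have [s0|s0] := leP (sin d) 0.
    have -> : sin d = 0 by apply/eqP; rewrite eq_le s0/= sd normr_ge0.
    by rewrite mul0r le0_lneNy.
  have MN : 0 < sup_norm p * sup_norm q by rewrite mulr_gt0.
  rewrite !lne_EFin ?divr_gt0// -EFinN -!EFinD -EFinN ln_div ?posrE// lnM ?posrE//.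
  by congr _%:E; ring.
rewrite -integral_log_sin// /gram /arc_measure.
rewrite [RHS](_ : _ = \int[@lebesgue_measure R]_t \int[uniform_prob (@pi_gt0 R)]_u
    (arc_kernel ((t, u), angle_point p) * arc_kernel ((t, u), angle_point q))%:E)%E; last first.
  rewrite -[LHS]/(\int[(@lebesgue_measure R \x uniform_prob (@pi_gt0 R))%E]_z _)%E.
  rewrite fubini_tonelli1//=.
    apply/measurable_EFinP; apply: measurable_funM; apply: (measurableT_comp arc_kernel_meas);
      exact: measurable_fun_pair.
  by move=> z; rewrite lee_fin mulr_ge0// arc_kernel_ge0.
rewrite integral_mkcond; apply: eq_integral => t _.
rewrite patchE mem_setE in_itv/=; case: ifP => t01; last first.
  by rewrite [RHS]integral0_eq// => u _; rewrite /arc_kernel/= t01/= mul0r.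
transitivity ((pi / sin t ^+ 2)%:E * overlap t p q)%E.
  rewrite dov// -EFinM; congr _%:E; have := @pi_gt0 R; have := sinp_gt0 t01 => h1 h2.
  move: h2; move: (@pi R) (Num.max _ _) => P M P0.
  by field; rewrite !gt_eqF.
rewrite /overlap -nn_integralZ.
- apply: eq_integral => u _; rewrite -EFinM; congr _%:E.
  rewrite /arc_kernel/= t01/= !in_arcE ?sin_half_ge0//.
  case: (_ <= _); case: (_ <= _); rewrite ?mulr0 ?mul0r ?mulr1//=.
  by rewrite mulrACA sqrt_pi -invfM expr2.
- by rewrite divr_ge0 ?pi_ge0 ?sqr_ge0.
- by move=> u; rewrite lee_fin.
- exact: overlap_meas.
Qed.

(** The sine of the angle to the center is at most [t / 2], and division by the sup norms costs a
    factor of at most 2. *)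
Lemma arc_center_delta t u x : 0 < t < pi / 2 -> in_arc t u x ->
  delta (angle_point u) x <= 2 * t.
Proof.
move=> t01; elim/angle_point_ind: x => s; rewrite in_arcE ?sin_half_ge0// => h.
have M0 := sup_norm_gt0 u; have N0 := sup_norm_gt0 s; have st2 := sin_half_ge0 t01.
rewrite delta_angle_point ler_pdivrMr ?mulr_gt0//.
case/andP: t01 => t0 t1.
have s2 : sin (t / 2) <= t / 2 by apply: sin_le_id; lra.
have MN := sup_norm_mul u s.
apply: (@le_trans _ _ (2 * t * (1 / 2))); first by lra.
by rewrite ler_pM2l// mulr_gt0.
Qed.

Lemma arc_mollifier eta : 0 < eta ->
  exists (h : W -> R) (ctr : W -> X),
  [/\ (forall s, 0 <= h s) /\ measurable_fun setT h,
      measurable_fun setT ctr,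
      (\int[arc_measure]_s (h s ^+ 2)%:E < +oo)%E,
      (forall x, (\int[arc_measure]_s (h s * arc_kernel (s, x))%:E = 1)%E) &
      (forall s x, h s * arc_kernel (s, x) != 0 -> delta (ctr s) x < eta)].
Proof.
move=> eta0; have p0 := @pi_gt0 R.
(* By [arc_center_delta], points of arcs of length at most [2 * tau] are within [4 * tau < eta] of
   the center; the bound [pi / 8] keeps these lengths below [pi / 2]. *)
pose tau := Num.min (eta / 8) (pi / 8).
have tau0 : 0 < tau by rewrite lt_min !divr_gt0.
have tau1 : tau <= eta / 8 by rewrite ge_min lexx.
have tau2 : tau <= pi / 8 by rewrite ge_min lexx orbT.
pose I := `[tau, tau + tau]%classic : set (measurableTypeR R).
have mI : measurable I by exact: measurable_itv.
have I01 t : I t -> 0 < t < pi / 2.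
  by rewrite /I/= in_itv/= => /andP[? ?]; apply/andP; split; lra.
(* A single length has Lebesgue measure 0, so [t] is averaged over [[tau, 2 * tau]]. The product
   with the kernel is [pi / (tau * t)] on the arc, the centers of the arcs through a point have mass
   [t / pi], and the resulting [1 / tau] integrates to 1. *)
pose h1 (t : R) : R := if tau <= t <= tau + tau then Num.sqrt pi * sin t / (tau * t) else 0.
have h10 t : 0 <= h1 t.
  rewrite /h1; case: ifP => // It; have t01 : 0 < t < pi / 2 by apply: I01; rewrite /I/= in_itv.
  have t0 : 0 < t by case/andP: t01.
  by rewrite divr_ge0 ?mulr_ge0 ?sqrtr_ge0 ?(ltW tau0) ?(ltW t0)// ltW// sinp_gt0.
have mh1 : measurable_fun setT (h1 : measurableTypeR R -> R).
  apply: measurable_fun_if => //.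
    by apply: measurable_and; apply: measurable_fun_ler.
  apply: measurable_funTS; apply: measurable_funM.
    by apply: measurable_funM => //; exact: sin_meas.
  by apply: (measurableT_comp (@measurable_inv R)); exact: measurable_funM.
exists (fun s => h1 s.1), (fun s => angle_point s.2 : X); split.
- by split => //; exact: measurableT_comp mh1 measurable_fst.
- by apply: real_point_meas; [exact: measurableT_comp cos_meas measurable_snd|
     exact: measurableT_comp sin_meas measurable_snd].
- rewrite [X in (X < _)%E](_ : _ = \int[@lebesgue_measure R]_t \int[uniform_prob (@pi_gt0 R)]_u
    (h1 t ^+ 2)%:E)%E; last first.
    rewrite -[LHS]/(\int[(@lebesgue_measure R \x uniform_prob (@pi_gt0 R))%E]_z _)%E.
    rewrite fubini_tonelli1//=.
      apply/measurable_EFinP; apply: measurable_funX; exact: measurableT_comp mh1 measurable_fst.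
    by move=> z; rewrite lee_fin sqr_ge0.
  under eq_integral do rewrite probability_integral_cst.
  apply: (@le_lt_trans _ _ (\int[@lebesgue_measure R]_(t in I) ((Num.sqrt pi / tau ^+ 2) ^+ 2)%:E)%E).
    rewrite [leRHS]integral_mkcond; apply: nn_integral_le.
    - by move=> t; rewrite lee_fin sqr_ge0.
    - by apply/measurable_EFinP; exact: measurable_funX.
    - by apply/(measurable_restrictT _ _).1 => //; exact: measurable_cst.
    - move=> t; rewrite patchE mem_setE in_itv/= /h1; case: ifP => It; last by rewrite expr0n.
      have t01 : 0 < t < pi / 2 by apply: I01; rewrite /I/= in_itv.
      have /andP[t0 t1] := t01; have st := sinp_gt0 t01.
      rewrite lee_fin ler_sqr ?nnegrE ?divr_ge0 ?mulr_ge0 ?sqrtr_ge0 ?sqr_ge0 ?(ltW tau0) ?(ltW t0) ?(ltW st)//.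
      apply: ler_pM; rewrite ?mulr_ge0 ?invr_ge0 ?mulr_ge0 ?sqrtr_ge0 ?(ltW tau0) ?(ltW t0) ?(ltW st)//.
        by rewrite ler_piMr ?sqrtr_ge0 ?sin_le1.
      rewrite lef_pV2 ?posrE ?mulr_gt0 ?exprn_gt0// expr2 ler_pM2l//.
      by case/andP: It.
  rewrite integral_cst// [X in (_ * X)%E]lebesgue_measure_itv/= lte_fin ltrDr tau0 -EFinD -EFinM.
  exact: ltry.
- move=> x; elim/angle_point_ind: x => p.
  rewrite [LHS](_ : _ = \int[@lebesgue_measure R]_t \int[uniform_prob (@pi_gt0 R)]_u
    (h1 t * arc_kernel ((t, u), angle_point p))%:E)%E; last first.
    rewrite -[LHS]/(\int[(@lebesgue_measure R \x uniform_prob (@pi_gt0 R))%E]_z _)%E.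
    rewrite fubini_tonelli1//=.
      apply/measurable_EFinP; apply: measurable_funM.
        exact: measurableT_comp mh1 measurable_fst.
      by apply: (measurableT_comp arc_kernel_meas); exact: measurable_fun_pair.
    by move=> z; rewrite lee_fin mulr_ge0// arc_kernel_ge0.
  transitivity (\int[@lebesgue_measure R]_(t in I) (tau^-1)%:E)%E; last first.
    rewrite integral_cst// [X in (_ * X)%E]lebesgue_measure_itv/= lte_fin ltrDr tau0 -EFinD -EFinM.
    by rewrite addrK mulVf// gt_eqF.
  rewrite [RHS]integral_mkcond; apply: eq_integral => t _.
  rewrite patchE mem_setE in_itv/= /h1; case: ifP => It; last first.
    by rewrite integral0_eq// => u _; rewrite mul0r.
  have t01 : 0 < t < pi / 2 by apply: I01; rewrite /I/= in_itv.
  have /andP[t0 t1] := t01; have st := sinp_gt0 t01.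
  have [d [d01 sd] dov] := overlapE p p.
  have d0 : d = 0.
    case/andP: d01 => d0 d1; apply/eqP; rewrite eq_le d0 andbT leNgt; apply/negP => d00.
    move: sd; rewrite subrr sin0 normr0; apply/eqP; rewrite gt_eqF// sin_gt0_pi// d00/=.
    by lra.
  transitivity ((pi / (tau * t))%:E * overlap t p p)%E.
    rewrite /overlap -nn_integralZ.
    - apply: eq_integral => u _; rewrite -EFinM; congr _%:E.
      rewrite /arc_kernel/= t01/= !in_arcE ?sin_half_ge0// andbb.
      case: (_ <= _); rewrite ?mulr0 ?mul0r ?mulr1//=.
      by rewrite -[X in _ = X / _]sqrt_pi; field; rewrite !gt_eqF//.
    - by rewrite divr_ge0 ?pi_ge0// mulr_ge0 ?ltW.
    - by move=> u; rewrite lee_fin.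
    - exact: overlap_meas.
  rewrite dov// d0 subr0 (max_idPl (ltW t0)) -EFinM; congr _%:E.
  move: p0; move: (@pi R) => P P0; field.
  by rewrite !gt_eqF.
- move=> [t u] x /=; rewrite /h1; case: ifP => It; last by rewrite mul0r eqxx.
  have t01 : 0 < t < pi / 2 by apply: I01; rewrite /I/= in_itv.
  rewrite /arc_kernel/= t01/=; case: ifP => [arc _|]; last by rewrite mulr0 eqxx.
  apply: le_lt_trans (arc_center_delta t01 arc) _.
  by case/andP: It => ? ?; lra.
Qed.

End RealPoints.

(** * The real equilibrium law *)

Section NegLog.
Context {R : realType}.

Definition neglog (a : R) : \bar R := (- lne a%:E)%E.

Lemma neglog0 : neglog 0 = +oo%E.
Proof. by rewrite /neglog le0_lneNy. Qed.

Lemma neglogE a : 0 < a -> neglog a = (- ln a)%:E.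
Proof. by move=> a0; rewrite /neglog lne_EFin// EFinN. Qed.

Lemma neglog_ge0 a : a <= 1 -> (0 <= neglog a)%E.
Proof. by move=> a1; rewrite /neglog oppe_ge0 lne_le0 lee_fin. Qed.

Lemma neglogM a b : 0 <= a <= 1 -> 0 <= b <= 1 -> neglog (a * b) = (neglog a + neglog b)%E.
Proof.
move=> /andP[a0 a1] /andP[b0 b1].
have [->|a00] := eqVneq a 0.
  rewrite mul0r neglog0 addye// -ltNye; apply: lt_le_trans (neglog_ge0 b1).
  exact: ltNyr.
have [->|b00] := eqVneq b 0.
  rewrite mulr0 neglog0 addey// -ltNye; apply: lt_le_trans (neglog_ge0 a1).
  exact: ltNyr.
have ap : 0 < a by rewrite lt0r a00.
have bp : 0 < b by rewrite lt0r b00.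
by rewrite !neglogE ?mulr_gt0// -EFinD lnM ?posrE// opprD.
Qed.

Lemma le_neglog a b : 0 <= a <= b -> (neglog b <= neglog a)%E.
Proof.
move=> /andP[]; rewrite le_eqVlt => /predU1P[<- _|a0 ab]; first by rewrite neglog0 leey.
by rewrite !neglogE ?(lt_le_trans a0)// lee_fin lerN2 ler_ln// posrE (lt_le_trans a0).
Qed.

Lemma neglog_meas d (T : measurableType d) (f : T -> R) :
  measurable_fun setT f -> measurable_fun setT (fun t => neglog (f t)).
Proof.
move=> mf.
rewrite (_ : (fun t => _) = (fun t => if (f t <= 0)%R then +oo else (- ln (f t))%:E)%E).
  apply: measurable_fun_if => //; first exact: measurable_fun_ler.
  apply: measurable_funTS; apply/measurable_EFinP; apply: measurableT_comp => //.
  exact: measurableT_comp (@measurable_ln R) mf.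
apply/funext => t; case: leP => ft; last exact: neglogE.
by rewrite /neglog le0_lneNy.
Qed.

End NegLog.

(** * The logarithmic potential of the cosine of a uniform angle *)

Section AngleLaw.
Context {R : realType}.
Local Notation mu := (@lebesgue_measure R).

Lemma twopi_gt0 : 0 < (pi : R) *+ 2.
Proof. by rewrite pmulrn_rgt0// pi_gt0. Qed.

Definition circle_law : probability (measurableTypeR R) R := uniform_prob twopi_gt0.

Local Notation U := circle_law.

Lemma circle_shift (f : measurableTypeR R -> \bar R) (c : R) :
  measurable_fun setT f -> (forall x, 0 <= f x)%E ->
  (forall x, f (x + pi *+ 2) = f x) ->
  (\int[U]_x f (x + c)%R = \int[U]_x f x)%E.
Proof. by move=> mf f0 fT; rewrite /circle_law uniform_shift. Qed.

Let half_sin (s : R) : \bar R := neglog `|sin (s / 2)|.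

Let half_sin_ge0 s : (0 <= half_sin s)%E.
Proof. by apply: neglog_ge0; exact: sin_max. Qed.

Let half_sin_meas : measurable_fun setT (half_sin : measurableTypeR R -> \bar R).
Proof.
apply: neglog_meas; apply: measurableT_comp => //; apply: (measurableT_comp sin_meas).
exact: measurable_funM.
Qed.

Let half_sin_periodic s : half_sin (s + pi *+ 2) = half_sin s.
Proof.
rewrite /half_sin; have -> : (s + pi *+ 2) / 2 = s / 2 + pi by rewrite mulrDl -[pi *+ 2]mulr_natr mulfK.
by rewrite sinDpi normrN.
Qed.

Let half_sin_opp s : half_sin (- s) = half_sin s.
Proof. by rewrite /half_sin mulNr sinN normrN. Qed.

(** The two terms come from the two sine factors of [cos_sub_half]. The value enters through its
    finiteness only, since it cancels when the potentials at two points are compared. *)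
Definition circle_potential : \bar R :=
  (\int[U]_s half_sin s + \int[U]_s half_sin s)%E.

Lemma cos_sub_half (g s : R) :
  `|cos g - cos s| / 2 = `|sin ((s + g) / 2)| * `|sin ((s - g) / 2)|.
Proof.
have h : cos g - cos s = 2 * (sin ((s + g) / 2) * sin ((s - g) / 2)).
  have -> : cos g = cos ((s + g) / 2 - (s - g) / 2) by congr cos; field.
  have -> : cos s = cos ((s + g) / 2 + (s - g) / 2) by congr cos; field.
  by rewrite cosB cosD; ring.
by rewrite h normrM normrM (ger0_norm (ler0n _ 2)) mulrC mulKf.
Qed.

Lemma circle_potentialE g : (\int[U]_s neglog (`|cos g - cos s| / 2)%R = circle_potential)%E.
Proof.
have n01 (x : R) : 0 <= `|sin x| <= 1 by rewrite normr_ge0 sin_max.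
transitivity (\int[U]_s (half_sin (s + g)%R + half_sin (s - g)%R))%E.
  by apply: eq_integral => s _; rewrite cos_sub_half neglogM.
have mD (c : R) : measurable_fun setT (fun s : measurableTypeR R => half_sin (s + c)).
  by apply: (measurableT_comp half_sin_meas); exact: measurable_funD.
rewrite nn_integralD//.
by congr (_ + _)%E; exact: circle_shift.
Qed.

(** From [- ln r <= 1 / r - 1] at [r = Num.sqrt x]. The square root replaces the logarithmic
    singularity of [half_sin] by one with an explicit antiderivative. *)
Lemma neglog_le_sqrt (x : R) : 0 < x <= 1 -> - ln x <= 2 * (1 - x) / Num.sqrt x.
Proof.
move=> /andP[x0 x1]; have r0 : 0 < Num.sqrt x by rewrite sqrtr_gt0.
have e : x = Num.sqrt x ^+ 2 by rewrite sqr_sqrtr// ltW.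
move: x1; rewrite {}e => x1; rewrite sqrtr_sqr (gtr0_norm r0).
move: (Num.sqrt x) r0 x1 => r r0 r1.
have r11 : r <= 1 by rewrite -(@ler_pXn2r _ 2) ?nnegrE ?(ltW r0)// expr1n.
have l : - ln r <= r^-1 - 1.
  rewrite -lnV ?posrE//; have := @le_ln1Dx R (r^-1 - 1); rewrite (_ : 1 + (r^-1 - 1) = r^-1); last by rewrite addrC subrK.
  apply.
  by rewrite ltrBrDr addNr invr_gt0.
rewrite lnXn// -[ln r *+ 2]mulr_natl -mulrN.
apply: (@le_trans _ _ (2 * (r^-1 - 1))); first by rewrite ler_pM2l.
rewrite -mulrA ler_pM2l// ler_pdivlMr//.
by rewrite mulrBl mulVf ?gt_eqF// mul1r; nra.
Qed.

(* The bound is the derivative of [8 * Num.sqrt (sin (s / 2))]. *)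
Let half_sin_le s : 0 < s < pi -> (half_sin s <= (2 * cos (s / 2) / Num.sqrt (sin (s / 2)))%:E)%E.
Proof.
move=> /andP[s0 s1]; have p0 := @pi_gt0 R.
have h : 0 < s / 2 < pi / 2 by apply/andP; split; lra.
have st : 0 < sin (s / 2) by exact: sin_gt0_pihalf.
have ct : 0 < cos (s / 2) by apply: cos_gt0_pihalf; apply/andP; split; lra.
rewrite /half_sin gtr0_norm// neglogE// lee_fin.
apply: le_trans (@neglog_le_sqrt _ _) _; first by rewrite st sin_le1.
rewrite ler_wpM2r ?invr_ge0 ?sqrtr_ge0// ler_pM2l//.
have := cos2Dsin2 (s / 2); move: (cos _) (sin _) ct st (sin_le1 (s / 2)) => c t c0 t0 t1 e.
rewrite -(@ler_pXn2r _ 2) ?nnegrE ?(ltW c0) ?subr_ge0//.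
have -> : c ^+ 2 = 1 - t ^+ 2 by rewrite -e addrK.
by nra.
Qed.

Let half_integral : (\int[mu]_(s in `]0%R, (pi : R)[%classic) half_sin s < +oo)%E.
Proof.
have p0 := @pi_gt0 R.
have pos s : 0 < s < pi -> 0 < sin (s / 2) /\ 0 < cos (s / 2).
  move=> /andP[s0 s1]; split; first by apply: sin_gt0_pihalf; apply/andP; split; lra.
  by apply: cos_gt0_pihalf; apply/andP; split; lra.
pose f s : R := 2 * cos (s / 2) / Num.sqrt (sin (s / 2)).
pose F s : R := 8 * Num.sqrt (sin (s / 2)).
have f0 s : 0 < s < pi -> 0 <= f s.
  by move=> /pos[h1 h2]; rewrite divr_ge0 ?sqrtr_ge0// mulr_ge0// ltW.
have chalf s : {for s, continuous (fun s : R => s / 2)}.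
  by apply: cvgM; [exact: cvg_id|exact: cvg_cst].
have csin s : {for s, continuous (fun s : R => sin (s / 2))}.
  by apply: (continuous_comp (chalf s)); exact: continuous_sin.
have ccos s : {for s, continuous (fun s : R => cos (s / 2))}.
  by apply: (continuous_comp (chalf s)); exact: continuous_cos.
have csqrt s : {for s, continuous (fun s : R => Num.sqrt (sin (s / 2)))}.
  by apply: (continuous_comp (csin s)); exact: sqrt_continuous.
have cf s : 0 < s < pi -> {for s, continuous f}.
  move=> /pos[h1 h2]; apply: cvgM; first by apply: cvgM; [exact: cvg_cst|exact: ccos].
  by apply: cvgV; [rewrite gt_eqF// sqrtr_gt0|exact: csqrt].
have dF s : 0 < s < pi -> is_derive s 1 F (f s).
  move=> /pos[h1 h2].
  have d0 : is_derive s 1 (fun s : R => s / 2) (1 / 2).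
    have := @is_deriveM _ _ id (cst (2^-1)) s 1 1 0 _ _.
    by move=> h; apply: is_derive_eq; rewrite /GRing.scale/= mulr0 add0r mulr1 mul1r.
  have d1 : is_derive s 1 (fun s : R => sin (s / 2)) (cos (s / 2) * (1 / 2)).
    exact: (@is_derive1_comp _ (@sin R) (fun s : R => s / 2)).
  have d2 : is_derive s 1 (fun s : R => Num.sqrt (sin (s / 2)))
      ((2 * Num.sqrt (sin (s / 2)))^-1 * (cos (s / 2) * (1 / 2))).
    by apply: (@is_derive1_comp _ (@Num.sqrt R) (fun s : R => sin (s / 2))); exact: is_derive1_sqrt.
  have d3 := @is_deriveZ _ _ _ _ 8 _ _ _ d2.
  apply: is_derive_eq d3 _; rewrite /f /GRing.scale/=.
  by field; rewrite gt_eqF// sqrtr_gt0.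
have cF s : {for s, continuous F} by apply: cvgM; [exact: cvg_cst|exact: csqrt].
have := @open_FTC _ f F 0 pi (F 0) (F pi) p0 f0 cf dF
  (cvg_at_right_filter (cF 0)) (cvg_at_left_filter (cF pi)).
move=> e; apply: (@le_lt_trans _ _ (F pi - F 0)%:E); last exact: ltry.
rewrite -e; apply: ge0_le_integral => //.
- exact: measurable_funTS.
- apply/measurable_EFinP; apply: open_continuous_measurable_fun => //.
  by move=> s; rewrite inE/= in_itv/=; exact: cf.
Qed.

Lemma circle_potential_fin : circle_potential \is a fin_num.
Proof.
suff h : (\int[U]_s half_sin s < +oo)%E.
  have h0 : (0 <= \int[U]_s half_sin s)%E by apply: integral_ge0 => s _.
  by rewrite /circle_potential fin_numD ge0_fin_numE// h.
have p0 := @pi_gt0 R.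
rewrite /circle_law integral_uniform//; apply: lte_mul_pinfty; rewrite ?lee_fin ?invr_ge0 ?subr_ge0 ?(ltW twopi_gt0)//.
have mS (D : set (measurableTypeR R)) : measurable_fun D half_sin by exact: measurable_funTS.
have h2 : (\int[mu]_(s in `[(pi : R), (pi *+ 2)%R[%classic) half_sin s < +oo)%E.
  rewrite integral_itv_bndo_bndc; last exact: mS.
  rewrite (@integral_affine_set _ (-1) (pi *+ 2))//.
  rewrite normrN1 mul1e (_ : [set x | _] = `[0, pi]%classic); last first.
    by apply/seteqP; split=> x /=; rewrite !in_itv/= mulr2n mulN1r => /andP[? ?]; apply/andP; split; lra.
  under eq_integral do rewrite half_sin_periodic mulN1r half_sin_opp.
  rewrite -integral_itv_bndo_bndc; last exact: mS.
  by rewrite -integral_itv_obnd_cbnd; [exact: half_integral|exact: mS].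
rewrite -integral_itv_bndo_bndc; last exact: mS.
have -> : `[0, pi *+ 2[%classic = `[0, pi[ `|` `[pi, pi *+ 2[ :> set (measurableTypeR R).
  by rewrite -itv_bndbnd_setU// bnd_simp ?(ltW p0)// mulr2n lerDl ltW.
rewrite ge0_integral_setU//; last first.
  by apply: lt_disjoint => x y; rewrite !in_itv/= => /andP[_ xr] /andP[ry _]; exact: lt_le_trans ry.
apply: lte_add_pinfty; last exact: h2.
by rewrite -integral_itv_obnd_cbnd; [exact: half_integral|exact: mS].
Qed.

End AngleLaw.

(** * Constant potential of the law of a ratio of cosines *)

Section RealLaw.
Context {R : realType} {L : fieldType} (v : absolute_value R L).
Hypothesis v_nontrivial : nontrivial_absv v.
Hypothesis L_locally_compact : locally_compact [set: valued v].
Variable phi : {rmorphism R -> L}.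
Hypothesis phi_bij : bijective phi.
Hypothesis phi_norm : forall x, v (phi x) = `|x|.
Local Notation X := (borel (P1 v)).
Local Notation U := (@circle_law R).
Local Notation V := (measurableTypeR R).

(** The bound is attained at [(1 : 1)] and [(1 : -1)]; it is the source of the shift by [ln 2]. *)
Lemma delta_le2 (x y : P1 v) : delta x y <= 2.
Proof.
elim/(@angle_point_ind _ _ v phi phi_bij): x => s.
elim/(@angle_point_ind _ _ v phi phi_bij): y => t.
rewrite (delta_angle_point phi_norm) ler_pdivrMr ?mulr_gt0 ?sup_norm_gt0//.
apply: le_trans (sin_max _) _.
by have := sup_norm_mul s t; lra.
Qed.

(* The equilibrium measure is the law of [(cos s : cos t)] for independent
   uniform angles [s] and [t]. *)
Definition law_point (z : V * V) : X := real_point v phi (cos z.1) (cos z.2).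

Lemma law_point_meas : measurable_fun setT law_point.
Proof.
apply: (real_point_meas phi_norm).
  exact: measurableT_comp cos_meas measurable_fst.
exact: measurableT_comp cos_meas measurable_snd.
Qed.

Variable mu : probability X R.
Hypothesis muE : forall A, mu A = (U \x U)%E (law_point @^-1` A).

Lemma law_integral (f : X -> \bar R) : measurable_fun setT f -> (forall x, 0 <= f x)%E ->
  (\int[mu]_x f x = \int[U]_s \int[U]_t f (law_point (s, t)))%E.
Proof.
move=> mf f0.
rewrite (@eq_measure_integral _ _ _ _ (pushforward (U \x U)%E law_point));
  [exact: law_point_meas|move=> mlp|by move=> ? A _ _; exact: muE].
rewrite ge0_integral_pushforward// preimage_setT fubini_tonelli1//=.
exact: measurableT_comp mf law_point_meas.
Qed.

Let sup_term (z : V * V) : \bar R := neglog (Num.max `|cos z.1| `|cos z.2|).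

Let max_le1 (s t : R) : 0 <= Num.max `|cos s| `|cos t| <= 1.
Proof. by rewrite le_max normr_ge0/= ge_max !cos_max. Qed.

Let sup_term_ge0 z : (0 <= sup_term z)%E.
Proof. by apply: neglog_ge0; case/andP: (max_le1 z.1 z.2). Qed.

Let acos_meas : measurable_fun setT (fun z : V * V => `|cos z.1|) /\
  measurable_fun setT (fun z : V * V => `|cos z.2|).
Proof.
split; apply: measurableT_comp => //.
  exact: measurableT_comp cos_meas measurable_fst.
exact: measurableT_comp cos_meas measurable_snd.
Qed.

Let sup_term_meas : measurable_fun setT sup_term.
Proof. by apply: neglog_meas; apply: measurable_maxr; [exact: acos_meas.1|exact: acos_meas.2]. Qed.

Definition sup_potential : \bar R := (\int[U]_s \int[U]_t sup_term (s, t))%E.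

Let const_integral (e : \bar R) : e \is a fin_num -> (\int[U]_t e = e)%E.
Proof. by move=> /fineK <-; exact: probability_integral_cst. Qed.

(** The larger of two absolute cosines is at least [|cos t| / 2], whose negative logarithm
    integrates to the circle potential seen from the angle [pi / 2]. *)
Lemma sup_potential_fin : sup_potential \is a fin_num.
Proof.
rewrite ge0_fin_numE; last first.
  by apply: integral_ge0 => s _; apply: integral_ge0 => t _.
apply: (@le_lt_trans _ _ (@circle_potential R)); last first.
  by rewrite -ge0_fin_numE ?circle_potential_fin// /circle_potential adde_ge0// integral_ge0// => s _;
    apply: neglog_ge0; exact: sin_max.
rewrite -[leRHS](const_integral circle_potential_fin).
have m2 : measurable_fun setT (fun t : V => neglog (`|cos (pi / 2) - cos t| / 2)).
  apply: neglog_meas; apply: measurable_funM => //; apply: measurableT_comp => //.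
  by apply: measurable_funB => //; exact: cos_meas.
apply: nn_integral_le.
- by move=> s; apply: integral_ge0 => t _.
- exact: (@integral_section_meas _ V _ V R U sup_term).
- exact: measurable_cst.
move=> s; rewrite -(circle_potentialE (pi / 2)); apply: nn_integral_le => //.
  by apply: (measurableT_comp sup_term_meas); exact: measurable_fun_pair.
move=> t; apply: le_neglog; rewrite cos_pihalf sub0r normrN divr_ge0//=.
apply: (@le_trans _ _ `|cos t|); last by rewrite le_max lexx orbT.
by rewrite ler_pdivrMr// ler_peMr// ler1n.
Qed.

Let numerator A B (z : V * V) : \bar R := neglog (`|A * cos z.2 - B * cos z.1| / 2).

Let numerator_meas A B : measurable_fun setT (numerator A B).
Proof.
apply: neglog_meas; apply: measurable_funM => //; apply: measurableT_comp => //.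
apply: measurable_funB; apply: measurable_funM => //.
  exact: measurableT_comp cos_meas measurable_snd.
exact: measurableT_comp cos_meas measurable_fst.
Qed.

Let half_num_le1 (A B s t : R) : Num.max `|A| `|B| = 1 ->
  0 <= `|A * cos s - B * cos t| / 2 <= 1.
Proof.
move=> AB; rewrite divr_ge0//= ler_pdivrMr// mul1r.
have A1 : `|A| <= 1 by rewrite -AB le_max lexx.
have B1 : `|B| <= 1 by rewrite -AB le_max lexx orbT.
apply: le_trans (ler_normB _ _) _; rewrite !normrM.
have h1 : `|A| * `|cos s| <= 1 by rewrite mulr_ile1 ?cos_max.
have h2 : `|B| * `|cos t| <= 1 by rewrite mulr_ile1 ?cos_max.
lra.
Qed.

Let numerator_ge0 A B z : Num.max `|A| `|B| = 1 -> (0 <= numerator A B z)%E.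
Proof. by move=> AB; apply: neglog_ge0; case/andP: (half_num_le1 z.2 z.1 AB). Qed.

(* [A / B * cos t] is the cosine of some angle. *)
Let circle_numerator (A B : R) t : `|A| <= 1 -> `|B| = 1 ->
  (\int[U]_s neglog (`|A * cos t - B * cos s| / 2)%R = @circle_potential R)%E.
Proof.
move=> A1 B1; have B2 : B * B = 1.
  by rewrite -expr2 -real_normK ?num_real// B1 expr1n.
rewrite -(circle_potentialE (acos (B * A * cos t))); apply: eq_integral => s _.
congr (neglog (_ / 2)); rewrite acosK; last first.
  rewrite in_itv/= -ler_norml !normrM B1 mul1r.
  by rewrite mulr_ile1 ?cos_max.
by rewrite -[LHS]mul1r -B1 -normrM mulrBr !mulrA B2 mul1r.
Qed.

(** The angle whose cosine has a coefficient of absolute value 1 is integrated first;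
    [circle_numerator] then gives a constant, whatever the other angle. *)
Let numerator_integral A B : Num.max `|A| `|B| = 1 ->
  (\int[U]_s \int[U]_t numerator A B (s, t) = @circle_potential R)%E.
Proof.
move=> AB; have AB0 z := numerator_ge0 z AB.
have A1 : `|A| <= 1 by rewrite -AB le_max lexx.
have B1 : `|B| <= 1 by rewrite -AB le_max lexx orbT.
have [e|e] : `|B| = 1 \/ `|A| = 1 by move: AB; case: leP => _ ->; [left|right].
  rewrite (@tonelli _ V _ V R U U)//.
  by under eq_integral do rewrite circle_numerator//; exact: const_integral circle_potential_fin.
rewrite -[RHS](const_integral circle_potential_fin); apply: eq_integral => s _.
rewrite -(circle_numerator s B1 e); apply: eq_integral => t _.
by rewrite /numerator/= distrC.
Qed.

Lemma neglog_delta_meas (x : P1 v) : measurable_fun setT (fun y : X => neglog (delta x y / 2)).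
Proof.
apply: neglog_meas; apply: measurable_funM => //; apply: continuous_borel.
exact: delta_continuous.
Qed.

(** The logarithm of [delta] splits into numerator and denominator, and for a normalized [x] each
    has a mean independent of [x]. The denominator stays on the left so that nothing infinite is
    subtracted. *)
Lemma law_potential (x : P1 v) :
  (\int[mu]_y neglog (delta x y / 2)%R + sup_potential = @circle_potential R)%E.
Proof.
have [A [B [AB0 AB ->]]] : exists A B, [/\ (A, B) != (0, 0), Num.max `|A| `|B| = 1 & x = real_point v phi A B].
  elim/(@angle_point_ind _ _ v phi phi_bij): x => t; have M0 := sup_norm_gt0 t.
  exists ((sup_norm t)^-1 * cos t), ((sup_norm t)^-1 * sin t); split.
  - have := cos_sin_neq0 t.
    by rewrite !xpair_eqE !mulf_eq0 invr_eq0 (gt_eqF M0).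
  - rewrite !normrM -maxr_pMr ?normr_ge0// normfV (gtr0_norm M0) -/(sup_norm t) mulVf//.
    by rewrite gt_eqF.
  - by rewrite real_point_scale ?cos_sin_neq0// invr_eq0 gt_eqF.
have k0 y : (0 <= neglog (delta (real_point v phi A B) y / 2)%R)%E.
  by apply: neglog_ge0; rewrite ler_pdivrMr// mul1r delta_le2.
have mk := neglog_delta_meas (real_point v phi A B).
rewrite law_integral// /sup_potential -nn_integralD//; last 4 first.
- by move=> s; apply: integral_ge0 => t _.
- by move=> s; apply: integral_ge0 => t _.
- apply: (@integral_section_meas _ V _ V R U (fun z => neglog (delta (real_point v phi A B) (law_point z) / 2))) => //.
  exact: measurableT_comp mk law_point_meas.
- exact: (@integral_section_meas _ V _ V R U sup_term).
rewrite -(numerator_integral AB); apply: eq_integral => s _.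
rewrite -nn_integralD//; last 2 first.
- by apply: (measurableT_comp mk); apply: (measurableT_comp law_point_meas); exact: measurable_fun_pair.
- by apply: (measurableT_comp sup_term_meas); exact: measurable_fun_pair.
apply: eq_integral => t _; rewrite /sup_term /numerator/=.
(* Here [law_point] is a default value, but both sides are [+oo]: the sup term and the numerator are
   logarithms of 0. *)
have [c0|c0] := eqVneq (cos s, cos t) (0, 0).
  move: c0 => [-> ->]; rewrite !mulr0 subrr normr0 maxxx mul0r !neglog0 addey// -ltNye.
  by apply: lt_le_trans (k0 _); exact: ltNyr.
rewrite -neglogM//; last by rewrite divr_ge0 ?delta_ge0//= ler_pdivrMr// mul1r delta_le2.
congr neglog; rewrite /law_point delta_real_point// AB mul1r mulrAC; congr (_ / 2).
rewrite mulfVK// gt_eqF// lt_max !normr_gt0; move: c0; rewrite xpair_eqE negb_and.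
by [].
Qed.

End RealLaw.

(** * The density of the real equilibrium law *)

Section CosineSubstitution.
Context {R : realType}.
Local Notation mu := (@lebesgue_measure R).
Local Notation V := (measurableTypeR R).

(** The substitution is made on compact subintervals, away from the ends, where the sine vanishes
    and the density of the cosine blows up; monotone convergence gives the open interval. *)
Lemma integral_cos (h : R -> R) :
  (forall x, -1 < x < 1 -> 0 <= h x) ->
  (forall x, -1 < x < 1 -> {for x, continuous h}) ->
  (\int[mu]_(s in `]0%R, (pi : R)[) (h (cos s))%:E =
   \int[mu]_(x in `](-1)%R, 1%R[) (h x / Num.sqrt (1 - x ^+ 2))%:E)%E.
Proof.
move=> h0 ch; have p0 := @pi_gt0 R.
pose st n : R := pi / n.+3%:R.
have st0 n : 0 < st n by rewrite divr_gt0.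
have st3 n : st n <= pi / 3 by rewrite ler_pM2l// lef_pV2 ?posrE// ler_nat.
have stS n : st n.+1 <= st n by rewrite ler_pM2l// lef_pV2 ?posrE// ler_nat.
have st_cvg : st @ \oo --> (0 : R).
  rewrite -(mulr0 (pi : R)); apply: cvgMr.
  have := @cvg_harmonic R; rewrite -(cvg_shiftn 2%N) /harmonic.
  by under eq_fun do rewrite addn2.
pose b n := pi - st n.
have stb n : st n < b n by have := st3 n; rewrite /b; lra.
have bpi n : b n < pi by rewrite /b; have := st0 n; lra.
have sin0p (s : R) : 0 < s < pi -> 0 < sin s by exact: sin_gt0_pi.
have cos01 (s : R) : 0 < s < pi -> -1 < cos s < 1.
  move=> /andP[s0 s1]; rewrite -(@cospi R) -(@cos0 R) !ltr_cos ?in_itv/= ?lexx ?(ltW p0) ?(ltW s0) ?(ltW s1)//.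
  by rewrite s0 s1.
have sq0 x : -1 < x < 1 -> 0 < 1 - x ^+ 2 :> R by move=> /andP[x0 x1]; nra.
pose G x := h x / Num.sqrt (1 - x ^+ 2).
have G0 x : -1 < x < 1 -> 0 <= G x.
  by move=> x1; rewrite divr_ge0 ?sqrtr_ge0// h0.
have cG x : -1 < x < 1 -> {for x, continuous G}.
  move=> x1; apply: cvgM; first exact: ch.
  apply: cvgV; first by rewrite gt_eqF// sqrtr_gt0 sq0.
  have c1 : {for x, continuous (fun x : R => 1 - x ^+ 2)}.
    by apply: cvgB; [exact: cvg_cst|exact: exprn_continuous].
  by apply: (continuous_comp c1); exact: sqrt_continuous.
have sinE (s : R) : 0 < s < pi -> Num.sqrt (1 - cos s ^+ 2) = sin s.
  by move=> s0; rewrite -sin2cos2 sqrtr_sqr gtr0_norm// sin0p.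
have ab n s : st n <= s <= b n -> 0 < s < pi.
  by move=> /andP[s0 s1]; rewrite (lt_le_trans (st0 n))//= (le_lt_trans s1).
have e01 n : 0 < st n < pi by apply: (ab n); rewrite lexx ltW.
have eb01 n : 0 < b n < pi by apply: (ab n); rewrite lexx ltW.
have dcos : derive1 (@cos R) = (fun x => - sin x).
  by apply/funext => x; rewrite derive1E derive_val.
have key n : (\int[mu]_(x in `[cos (b n), cos (st n)]) (G x)%:E =
    \int[mu]_(s in `[st n, b n]) (h (cos s))%:E)%E.
  rewrite (@integration_by_substitution_decreasing _ (@cos R) G (st n) (b n))//.
  - apply: eq_integral => s; rewrite inE/= in_itv/= => /ab s01; congr _%:E.
    rewrite -[LHS]/(h (cos s) / Num.sqrt (1 - cos s ^+ 2) * (- (derive1 (@cos R) s))) dcos opprK sinE//.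
    by rewrite divfK// gt_eqF// sin0p.
  - exact: ltW.
  - move=> x y; rewrite !in_itv/= => /ab/andP[x0 x1] /ab/andP[y0 y1].
    by rewrite ltr_cos// in_itv/= ltW// ltW.
  - by move=> x _; rewrite dcos; apply: cvgN; exact: continuous_sin.
  - rewrite dcos; apply/cvg_ex; exists (- sin (st n)); apply: cvg_at_right_filter.
    by apply: cvgN; exact: continuous_sin.
  - rewrite dcos; apply/cvg_ex; exists (- sin (b n)); apply: cvg_at_left_filter.
    by apply: cvgN; exact: continuous_sin.
  - split.
    + by move=> x _; exact: derivable_cos.
    + by apply: cvg_at_right_filter; exact: continuous_cos.
    + by apply: cvg_at_left_filter; exact: continuous_cos.
  - apply: continuous_in_subspaceT => x; rewrite inE/= in_itv/= => /andP[x0 x1]; apply: cG.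
    have /andP[h1 _] := cos01 _ (eb01 n); have /andP[_ h2] := cos01 _ (e01 n).
    by rewrite (lt_le_trans h1)//= (le_lt_trans x1).
have mG : measurable_fun (`](-1)%R, 1%R[ : set V) G.
  by apply: open_continuous_measurable_fun => // x; rewrite inE/= in_itv/=; exact: cG.
have mh : measurable_fun (`]0%R, (pi : R)[ : set V) (fun s => h (cos s)).
  apply: open_continuous_measurable_fun => // s; rewrite inE/= in_itv/= => s01.
  by apply: continuous_comp; [exact: continuous_cos|apply: ch; exact: cos01].
have cosb n : cos (b n) = - cos (st n) by rewrite /b cosB cospi sinpi mul0r addr0 mulN1r.
have cosS n : cos (st n) <= cos (st n.+1).
  have /andP[h1 h2] := e01 n; have /andP[h3 h4] := e01 n.+1.
  by rewrite leNgt ltr_cos ?in_itv/= ?(ltW h1) ?(ltW h2) ?(ltW h3) ?(ltW h4)// -leNgt.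
have cv1 : (\int[mu]_(s in `[st n, b n]) (h (cos s))%:E)%E @[n --> \oo] -->
    (\int[mu]_(s in \bigcup_n `[st n, b n]%classic) (h (cos s))%:E)%E.
  apply: ge0_nondecreasing_set_cvg_integral => //.
  - apply/nondecreasing_seqP => n; apply/subsetPset => x /=; rewrite !in_itv/= /b.
    by have := stS n => ? /andP[? ?]; apply/andP; split; lra.
  - move=> n; apply/measurable_EFinP; apply: measurable_funS mh => // x /=.
    by rewrite !in_itv/=; exact: ab.
  - move=> n x; rewrite /= in_itv/= lee_fin => /ab/cos01; exact: h0.
have cv2 : (\int[mu]_(x in `[cos (b n), cos (st n)]) (G x)%:E)%E @[n --> \oo] -->
    (\int[mu]_(x in \bigcup_n `[cos (b n), cos (st n)]%classic) (G x)%:E)%E.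
  have sub n x : cos (b n) <= x <= cos (st n) -> -1 < x < 1.
    move=> /andP[x0 x1].
    have /andP[h1 _] := cos01 _ (eb01 n); have /andP[_ h2] := cos01 _ (e01 n).
    by rewrite (lt_le_trans h1)//= (le_lt_trans x1).
  apply: ge0_nondecreasing_set_cvg_integral => //.
  - apply/nondecreasing_seqP => n; apply/subsetPset => x /=; rewrite !in_itv/= !cosb.
    by have := cosS n => ? /andP[? ?]; apply/andP; split; lra.
  - move=> n; apply/measurable_EFinP; apply: measurable_funS mG => // x /=.
    by rewrite !in_itv/=; exact: sub.
  - by move=> n x; rewrite /= in_itv/= lee_fin => /sub; exact: G0.
have cov (s : R) : 0 < s < pi -> exists n, st n <= s <= b n.
  move=> /andP[s0 s1]; pose d := Num.min s (pi - s).
  have d0 : 0 < d by rewrite lt_min s0 subr_gt0.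
  have /cvgrPdist_lt/(_ _ d0)[N _ hN] := st_cvg.
  exists N; have := hN N (leqnn _).
  rewrite sub0r normrN gtr0_norm// /d lt_min /b => /andP[? ?]; apply/andP; split; lra.
have -> : `]0%R, (pi : R)[%classic = \bigcup_n `[st n, b n]%classic :> set V.
  apply/seteqP; split=> [s|s [n _]]; rewrite /= !in_itv/=; last exact: ab.
  by move=> /cov[n sn]; exists n => //; rewrite /= in_itv.
have -> : `](-1)%R, 1%R[%classic = \bigcup_n `[cos (b n), cos (st n)]%classic :> set V.
  apply/seteqP; split=> [x|x [n _]]; rewrite /= !in_itv/=; last first.
    move=> /andP[x0 x1].
    have /andP[h1 _] := cos01 _ (eb01 n); have /andP[_ h2] := cos01 _ (e01 n).
    by rewrite (lt_le_trans h1)//= (le_lt_trans x1).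
  move=> /andP[x0 x1]; have x11 : -1 <= x <= 1 by rewrite !ltW.
  have s01 : 0 < acos x < pi by rewrite acos_gt0 ?acos_ltpi ?x1 ?x0 ?ltW.
  have [n /andP[s0 s1]] := cov _ s01; exists n => //; rewrite /= in_itv/=.
  have /andP[h1 h2] := e01 n; have /andP[h3 h4] := eb01 n; have /andP[h5 h6] := s01.
  rewrite -[x]acosK ?in_itv//= !leNgt !ltr_cos ?in_itv/= ?(ltW h1) ?(ltW h2) ?(ltW h3) ?(ltW h4) ?(ltW h5) ?(ltW h6)//.
  by rewrite -!leNgt s0 s1.
by move: cv2; rewrite (funext key) => cv2; exact: cvg_unique cv1 cv2.
Qed.

Lemma circle_even_integral (k : R -> \bar R) : (forall x, 0 <= k x)%E ->
  measurable_fun setT (fun s : V => k (cos s)) ->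
  (\int[@circle_law R]_s k (cos s) =
   (pi^-1)%:E * \int[mu]_(s in `]0%R, (pi : R)[) k (cos s))%E.
Proof.
move=> k0 mk; have p0 := @pi_gt0 R.
have mS (D : set V) : measurable_fun D (fun s : V => k (cos s)) by exact: measurable_funTS.
pose I := (\int[mu]_(s in `]0%R, (pi : R)[) k (cos s))%E.
have h1 : (\int[mu]_(s in `[0%R, (pi : R)[) k (cos s))%E = I.
  by rewrite -integral_itv_obnd_cbnd//; exact: mS.
have h2 : (\int[mu]_(s in `[(pi : R), (pi *+ 2)%R[) k (cos s))%E = I.
  rewrite integral_itv_bndo_bndc; last exact: mS.
  rewrite (@integral_affine_set _ (-1) (pi *+ 2) _ (fun s => k (cos s)))//.
  rewrite normrN1 mul1e (_ : [set x | _] = `[0, pi]%classic); last first.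
    by apply/seteqP; split=> x /=; rewrite !in_itv/= mulr2n mulN1r => /andP[? ?]; apply/andP; split; lra.
  under eq_integral do rewrite cosD2pi mulN1r cosN.
  by rewrite -integral_itv_bndo_bndc//; exact: mS.
rewrite /circle_law integral_uniform// -integral_itv_bndo_bndc; last exact: mS.
have -> : `[0, pi *+ 2[%classic = `[0, pi[ `|` `[pi, pi *+ 2[ :> set V.
  by rewrite -itv_bndbnd_setU// bnd_simp ?(ltW p0)// mulr2n lerDl ltW.
rewrite ge0_integral_setU//; last first.
  by apply: lt_disjoint => x y; rewrite !in_itv/= => /andP[_ xr] /andP[ry _]; exact: lt_le_trans ry.
rewrite [X in (_ * (X + _))%E]h1 [X in (_ * (_ + X))%E]h2.
rewrite -mule2n -mule_natl muleA -EFinM; congr (_%:E * _)%E.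
by rewrite subr0 -[pi *+ 2]mulr_natr invfM mulfVK.
Qed.

Lemma quarter_integral (k : R -> \bar R) : (forall x, 0 <= k x)%E ->
  (forall x, k (- x)%R = k x) -> measurable_fun setT (fun s : V => k (cos s)) ->
  (\int[mu]_(s in `]0%R, (pi : R)[) k (cos s) =
   2%:E * \int[mu]_(s in `]0%R, (pi / 2)%R[) k (cos s))%E.
Proof.
move=> k0 kN mk; have p0 := @pi_gt0 R.
have mS (D : set V) : measurable_fun D (fun s : V => k (cos s)) by exact: measurable_funTS.
pose I := (\int[mu]_(s in `]0%R, (pi / 2 : R)%R[) k (cos s))%E.
have h2 : (\int[mu]_(s in `[(pi / 2 : R)%R, (pi : R)[) k (cos s))%E = I.
  rewrite -integral_itv_obnd_cbnd; last exact: mS.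
  rewrite (@integral_affine_set _ (-1) pi _ (fun s => k (cos s)))//.
  rewrite normrN1 mul1e (_ : [set x | _] = `]0, pi / 2[%classic); last first.
    by apply/seteqP; split=> x /=; rewrite !in_itv/= mulN1r => /andP[? ?]; apply/andP; split; lra.
  by under eq_integral do rewrite cosDpi mulN1r cosN kN.
have -> : `]0, pi[%classic = `]0, pi / 2[ `|` `[pi / 2, pi[ :> set V.
  by rewrite -itv_bndbnd_setU// bnd_simp//; lra.
rewrite ge0_integral_setU//; last first.
  by apply: lt_disjoint => x y; rewrite !in_itv/= => /andP[_ xr] /andP[ry _]; exact: lt_le_trans ry.
by rewrite [X in (_ + X)%E]h2 mule_natl mule2n.
Qed.

End CosineSubstitution.

(** * The density of a ratio of cosines *)

Section RatioDensity.
Context {R : realType}.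
Local Notation mu := (@lebesgue_measure R).
Local Notation V := (measurableTypeR R).

Lemma density_N (y : R) : density_R (- y) = density_R y.
Proof.
rewrite /density_R mulrN invrN mulNr -mulrN; congr (_ * _).
(* At [y = 1] and [y = -1] the conventions [0^-1 = 0] and [ln 0 = 0] make both logarithms 0. *)
have [e1|e1] := eqVneq (y - 1) 0.
  have -> : y = 1 by apply/eqP; rewrite -subr_eq0 e1.
  by rewrite subrr invr0 mulr0 normr0 addNr mul0r normr0 ln0// oppr0.
have [e2|e2] := eqVneq (y + 1) 0.
  have -> : y = - 1 by apply/eqP; rewrite -addr_eq0 e2.
  by rewrite opprK subrr invr0 mulr0 normr0 addNr mul0r normr0 ln0// oppr0.
rewrite -lnV ?posrE ?normr_gt0 ?mulf_neq0 ?invr_eq0//; last first.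
  by rewrite -opprD oppr_eq0.
  by rewrite addrC -opprB oppr_eq0.
congr ln; rewrite -normfV invfM invrK.
rewrite (_ : - y + 1 = - (y - 1)); last by ring.
by rewrite (_ : - y - 1 = - (y + 1)); [rewrite invrN mulrNN mulrC|ring].
Qed.

Lemma density_ge0 (y : R) : 0 <= density_R y.
Proof.
wlog y0 : y / 0 <= y.
  by move=> H; have [/H//|/ltW y0] := leP 0 y; rewrite -density_N H// oppr_ge0.
rewrite /density_R mulr_ge0 ?invr_ge0 ?mulr_ge0 ?sqr_ge0 ?pi_ge0//.
have [->|y1] := eqVneq y 1; first by rewrite subrr invr0 mulr0 normr0 ln0.
have y10 : 0 < `|y - 1| by rewrite normr_gt0 subr_eq0.
rewrite ln_ge0// normrM normfV ler_pdivlMr// mul1r (ger0_norm (addr_ge0 y0 ler01)).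
by rewrite ler_norml; apply/andP; split; lra.
Qed.

Lemma density_meas : measurable_fun setT (@density_R R : V -> R).
Proof.
apply: measurable_funM.
  by apply: (measurableT_comp (@measurable_inv R)); exact: measurable_funM.
apply: (measurableT_comp (@measurable_ln R)); apply: measurableT_comp => //.
apply: measurable_funM; first exact: measurable_funD.
by apply: (measurableT_comp (@measurable_inv R)); exact: measurable_funB.
Qed.

(* The integrand is, up to a constant, the density at [y] of [cos s / cos t] for
   a uniform angle [s]. *)
Lemma ratio_density_integral (y : R) : y != 0 -> `|y| != 1 ->
  (\int[mu]_(t in [set t : R | ((0 < t < pi / 2) && (cos t * `|y| < 1))%R])
     (cos t / Num.sqrt (1 - (cos t * y) ^+ 2))%:E = (pi ^+ 2 / 2 * density_R y)%:E)%E.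
Proof.
wlog y0 : y / 0 < y.
  move=> H yn0 y1; have [y0|y0|//] := ltgtP 0 y; first exact: H.
    rewrite -density_N -(H (- y)) ?oppr_gt0 ?oppr_eq0 ?normrN//.
    by apply: eq_integral => t _; rewrite mulrN sqrrN.
  by move=> y0; rewrite -y0 eqxx in yn0.
move=> yn0; rewrite gtr0_norm// => y1; have p0 := @pihalf_gt0 R; have pp0 := @pi_gt0 R.
(* The domain of integration is []t0, pi / 2[], with [t0 = 0] for [y < 1] and [t0 = acos (1 / y)]
   for [1 < y], where the integrand is singular. In both cases the logarithm in the antiderivative
   starts at the same argument, the root of [|1 - y ^ 2|]. *)
have [t0 [t00 t01 c0 dom]] : exists t0 : R, [/\ 0 <= t0, t0 < pi / 2,
    y * sin t0 + Num.sqrt (1 - (cos t0 * y) ^+ 2) = Num.sqrt `|1 - y ^+ 2| &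
    forall t, (0 < t < pi / 2) && (cos t * y < 1) = (t0 < t < pi / 2)].
  have [yl|yg] := leP y 1.
    have yl1 : y < 1 by rewrite lt_neqAle y1.
    exists 0; split => //.
      by rewrite sin0 mulr0 add0r cos0 mul1r ger0_norm// subr_ge0 expr_le1// ltW.
    move=> t; case: (_ < _ < _) => //=.
    by apply: le_lt_trans yl1; rewrite ler_piMl ?cos_le1// ltW.
  have yV : 0 <= y^-1 < 1 by rewrite invr_ge0 ltW//= invf_lt1.
  have yV1 : -1 <= y^-1 <= 1.
    by case/andP: yV => h1 h2; rewrite (le_trans _ h1) ?lerN10//= ltW.
  have ca : cos (acos y^-1) = y^-1 by rewrite acosK// in_itv.
  have a0 : 0 <= acos y^-1 by exact: acos_ge0.
  have a1 : acos y^-1 < pi / 2.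
    rewrite ltNge; apply/negP => h.
    have : y^-1 <= 0.
      rewrite -ca -(@cos_pihalf R) leNgt ltr_cos ?in_itv/= ?a0 ?acos_lepi// -?leNgt//.
      by rewrite (ltW p0)/=; lra.
    by rewrite leNgt invr_gt0 y0.
  exists (acos y^-1); split => //.
    rewrite ca mulVf// expr1n subrr sqrtr0 addr0 sin_acos//.
    rewrite ler0_norm; last by rewrite subr_le0 expr_ge1// ltW.
    have -> : y * Num.sqrt (1 - y^-1 ^+ 2) = Num.sqrt (y ^+ 2) * Num.sqrt (1 - y^-1 ^+ 2).
      by rewrite sqrtr_sqr gtr0_norm.
    by rewrite -sqrtrM ?sqr_ge0//; congr Num.sqrt; rewrite exprVn; field.
  move=> t; have [tp|tp] := ltP t (pi / 2); last by rewrite !andbF.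
  rewrite !andbT; have [tn|tn] := leP t 0; first by apply/esym/negbTE; rewrite -leNgt (le_trans tn).
  have ht : t \in `[0, pi] by rewrite in_itv/= (ltW tn)/=; lra.
  have ha : acos y^-1 \in `[0, pi] by rewrite in_itv/= a0 acos_lepi.
  by rewrite /= -ltr_pdivlMr// div1r -{1}ca ltr_cos.
rewrite (_ : [set t | _] = `]t0, (pi / 2)%R[%classic); last first.
  by apply/seteqP; split=> t /=; rewrite in_itv/= dom.
have d1 : 0 < `|1 - y ^+ 2|.
  rewrite normr_gt0 subr_eq0 eq_sym sqrf_eq1 negb_or y1/= gt_eqF//.
  by rewrite (lt_trans _ y0)// ltrN10.
pose w (t : R) := Num.sqrt (1 - (cos t * y) ^+ 2).
(* The substitution [u = y * sin t] turns the integrand into [y^-1] times the reciprocal of the root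
   of [u ^ 2 + 1 - y ^ 2]. *)
pose F (t : R) := y^-1 * ln (y * sin t + w t).
have in01 t : t0 < t < pi / 2 -> [/\ 0 < cos t, 0 < sin t & 0 < 1 - (cos t * y) ^+ 2].
  move=> tt; have := tt; rewrite -dom => /andP[/andP[h1 h2] h3].
  have ct : 0 < cos t by apply: cos_gt0_pihalf; apply/andP; split; lra.
  split => //; first by apply: sin_gt0_pihalf; rewrite h1.
  by rewrite subr_gt0 expr_lt1// mulr_ge0// ltW.
have cw t : {for t, continuous w}.
  have c1 : {for t, continuous (fun t : R => 1 - (cos t * y) ^+ 2)}.
    apply: cvgB; first exact: cvg_cst.
    apply: (@continuous_comp _ _ _ (fun t : R => cos t * y) (fun x => x ^+ 2)).
      by apply: cvgM; [exact: continuous_cos|exact: cvg_cst].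
    exact: exprn_continuous.
  by apply: (continuous_comp c1); exact: sqrt_continuous.
have cin t : {for t, continuous (fun t => y * sin t + w t)}.
  by apply: cvgD; [apply: cvgM; [exact: cvg_cst|exact: continuous_sin]|exact: cw].
have cF t : 0 < y * sin t + w t -> {for t, continuous F}.
  move=> h; apply: cvgM; first exact: cvg_cst.
  by apply: (continuous_comp (cin t)); exact: continuous_ln.
have dF t : t0 < t < pi / 2 -> is_derive t 1 F (cos t / Num.sqrt (1 - (cos t * y) ^+ 2)).
  move=> /in01[ct st dt]; have wt : 0 < w t by rewrite sqrtr_gt0.
  have ut : 0 < y * sin t + w t by rewrite addr_gt0// mulr_gt0.
  have dc : is_derive t 1 (fun t : R => 1 - (cos t * y) ^+ 2) (2 * (cos t * y) * (sin t * y)).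
    have e1 : is_derive t 1 (fun t : R => cos t * y) (- sin t * y).
      have := is_deriveZ y (is_derive_cos t).
      rewrite (_ : y \*: cos = (fun t => cos t * y)); last by apply/funext => s; rewrite /= mulrC.
      by move=> e; apply: is_derive_eq e _; rewrite /GRing.scale/= mulrC.
    have e2 := is_deriveM e1 e1.
    have e3 := is_deriveB (is_derive_cst (1 : R) t 1) e2.
    by apply: is_derive_eq e3 _; rewrite /GRing.scale/=; ring.
  have dw : is_derive t 1 w ((2 * w t)^-1 * (2 * (cos t * y) * (sin t * y))).
    by apply: (@is_derive1_comp _ (@Num.sqrt R) (fun t : R => 1 - (cos t * y) ^+ 2)); exact: is_derive1_sqrt.
  have dl : is_derive t 1 (fun t => ln (y * sin t + w t))
      ((y * sin t + w t)^-1 * (y * cos t + (2 * w t)^-1 * (2 * (cos t * y) * (sin t * y)))).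
    have du := is_deriveD (is_deriveZ y (is_derive_sin t)) dw.
    have dln := is_derive1_ln ut.
    exact: (@is_derive1_comp _ (@ln R) (fun t => y * sin t + w t) _ _ _ dln du).
  have dd := is_deriveZ y^-1 dl.
  apply: is_derive_eq dd _; rewrite -/(w t) /GRing.scale/=.
  by field; rewrite !gt_eqF.
have F1 : F (pi / 2) = y^-1 * ln (y + 1).
  by rewrite /F /w sin_pihalf cos_pihalf mul0r expr0n/= subr0 sqrtr1 mulr1.
have F0 : F t0 = y^-1 * (ln `|1 - y ^+ 2| / 2).
  rewrite /F /w c0; congr (_ * _).
  have e : `|1 - y ^+ 2| = Num.sqrt `|1 - y ^+ 2| ^+ 2 by rewrite sqr_sqrtr// ltW.
  by rewrite [in RHS]e lnXn ?sqrtr_gt0// -[ln _ *+ 2]mulr_natr mulfK.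
have f0 t : t0 < t < pi / 2 -> 0 <= cos t / Num.sqrt (1 - (cos t * y) ^+ 2).
  by move=> /in01[ct _ _]; rewrite divr_ge0 ?sqrtr_ge0// ltW.
have cf t : t0 < t < pi / 2 -> {for t, continuous (fun t => cos t / Num.sqrt (1 - (cos t * y) ^+ 2))}.
  move=> /in01[ct st dt]; apply: cvgM; first exact: continuous_cos.
  by apply: cvgV; [rewrite gt_eqF// sqrtr_gt0|exact: cw].
have l0 : F x @[x --> t0^'+] --> F t0.
  by apply: cvg_at_right_filter; apply: cF; rewrite /w c0 sqrtr_gt0.
have l1 : F x @[x --> (pi / 2)^'-] --> F (pi / 2).
  apply: cvg_at_left_filter; apply: cF.
  by rewrite /w sin_pihalf cos_pihalf mul0r expr0n/= subr0 sqrtr1 mulr1 addr_gt0.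
rewrite (open_FTC t01 f0 cf dF l0 l1) F1 F0 -mulrBr; congr _%:E.
rewrite /density_R.
have yp : 0 < y + 1 by rewrite addr_gt0.
have ym : 0 < `|y - 1| by rewrite normr_gt0 subr_eq0.
have -> : `|1 - y ^+ 2| = (y + 1) * `|y - 1|.
  by rewrite -[y + 1 in RHS]gtr0_norm// -normrM -normrN; congr `|_|; ring.
rewrite normrM normfV (gtr0_norm yp) lnM ?posrE// ln_div ?posrE//.
move: (ln _) (ln _) pp0; move: (@pi R) => P A B P0.
by field; rewrite yn0 gt_eqF.
Qed.

End RatioDensity.

(** * The real equilibrium law in the affine coordinate *)

Section LawDensity.
Context {R : realType} {L : fieldType} (v : absolute_value R L).
Variable phi : {rmorphism R -> L}.
Hypothesis phi_bij : bijective phi.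
Hypothesis phi_norm : forall x, v (phi x) = `|x|.
Local Notation X := (borel (P1 v)).
Local Notation U := (@circle_law R).
Local Notation V := (measurableTypeR R).
Local Notation lam := (@lebesgue_measure R).
Variable mu : probability X R.
Hypothesis muE : forall A, mu A = (U \x U)%E (law_point v phi @^-1` A).

(** For fixed [t] the substitution [cos s = y * cos t] turns the integral over [s] into one over the
    ratio [y]; Tonelli then leaves the integral over [t] that [ratio_density_integral] computes. *)
Lemma law_density (f : X -> \bar R) (g : R -> R) : measurable_fun setT f ->
  (forall x, 0 <= f x)%E -> continuous g -> (forall x, f (real_point v phi x 1) = (g x)%:E) ->
  (\int[mu]_x f x = \int[lam]_y (g y * density_R y)%:E)%E.
Proof.
move=> mf f0 cg fg; have p0 := @pihalf_gt0 R; have pp0 := @pi_gt0 R.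
have g0 x : 0 <= g x by rewrite -lee_fin -fg.
have mfl : measurable_fun setT (fun z : V * V => f (law_point v phi z)).
  by apply: (measurableT_comp mf); exact: law_point_meas.
rewrite (law_integral phi_norm muE)// (@tonelli _ V _ V R U U (fun z => f (law_point v phi z)))//.
pose K (c : R) : \bar R := (\int[U]_s f (real_point v phi (cos s) c))%E.
have K0 c : (0 <= K c)%E by apply: integral_ge0.
have mfr (c : R) : measurable_fun setT (fun s : V => f (real_point v phi (cos s) c)).
  by apply: (measurableT_comp mf); apply: (real_point_meas phi_norm) => //; exact: cos_meas.
(* Homogeneous coordinates may change sign, and [s] may be shifted by [pi]. This evenness reduces
   [t] to []0, pi / 2[], where [cos t] is positive and the point at infinity does not occur. *)
have KN c : K (- c) = K c.
  have sN (a b : R) : real_point v phi (- a) (- b) = real_point v phi a b.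
    have [ab|ab] := eqVneq (a, b) (0, 0).
      by case: ab => -> ->; rewrite oppr0.
    have n1 : (-1 : R) != 0 by rewrite oppr_eq0 oner_eq0.
    by rewrite -(@real_point_scale _ _ v phi (-1) a b n1 ab) !mulN1r.
  rewrite /K -[LHS](@circle_shift _ (fun s => f (real_point v phi (cos s) (- c))) pi)//.
    by apply: eq_integral => s _; rewrite cosDpi sN.
  by move=> s; rewrite cosD2pi.
have mK : measurable_fun setT (fun t : V => K (cos t)).
  pose swp (z : V * V) := (z.2, z.1).
  apply: (@integral_section_meas _ V _ V R U (fun z => f (law_point v phi (swp z)))) => //.
  by apply: (measurableT_comp mfl); exact: measurable_swap.
rewrite [LHS](circle_even_integral K0 mK) (quarter_integral K0 KN mK).
pose T (z : V * V) : R := if (0 < z.1 < pi / 2) && (cos z.1 * `|z.2| < 1)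
  then cos z.1 / Num.sqrt (1 - (cos z.1 * z.2) ^+ 2) else 0.
have mc1 : measurable_fun setT (fun z : V * V => cos z.1).
  exact: measurableT_comp cos_meas measurable_fst.
have mT : measurable_fun setT T.
  apply: measurable_fun_if => //.
    apply: measurable_and; first by apply: measurable_and; apply: measurable_fun_ltr.
    apply: measurable_fun_ltr => //; apply: measurable_funM => //.
    by apply: measurableT_comp => //; exact: measurable_snd.
  apply: measurable_funTS; apply: measurable_funM => //.
  apply: (measurableT_comp (@measurable_inv R)).
  apply: (@measurableT_comp _ _ _ _ _ _ (@Num.sqrt R)).
    by apply: continuous_measurable_fun; exact: sqrt_continuous.
  by apply: measurable_funB => //; apply: measurable_funX; apply: measurable_funM.
have T0 z : 0 <= T z.
  rewrite /T; case: ifP => // /andP[/andP[h1 h2] _]; rewrite divr_ge0 ?sqrtr_ge0//.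
  by rewrite ltW// cos_gt0_pihalf//; apply/andP; split; lra.
have KE (t : R) : 0 < t < pi / 2 -> K (cos t) = ((pi^-1)%:E * \int[lam]_y (g y * T (t, y))%:E)%E.
  move=> /andP[t0 t1]; have ct : 0 < cos t by apply: cos_gt0_pihalf; apply/andP; split; lra.
  have -> : K (cos t) = (\int[U]_s (g (cos s / cos t))%:E)%E.
    apply: eq_integral => s _; rewrite -fg; congr f.
    rewrite -(@real_point_scale _ _ v phi (cos t) (cos s / cos t))//.
    - by rewrite mulr1 mulrC divfK// gt_eqF.
    - by rewrite gt_eqF.
    - by rewrite xpair_eqE oner_eq0 andbF.
  have ch (x : R) : {for x, continuous (fun x : R => g (x / cos t))}.
    apply: (@continuous_comp _ _ _ (fun x : R => x / cos t) g); last exact: cg.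
    by apply: cvgM; [exact: cvg_id|exact: cvg_cst].
  have mh : measurable_fun setT (fun x : V => g (x / cos t)).
    by apply: continuous_measurable_fun => x; exact: ch.
  rewrite (@circle_even_integral _ (fun c => (g (c / cos t))%:E)).
  - congr (_ * _)%E; rewrite (@integral_cos _ (fun x => g (x / cos t)))//.
    have mi : measurable_fun setT (fun x : V => (g (x / cos t) / Num.sqrt (1 - x ^+ 2))%:E).
      apply/measurable_EFinP; apply: measurable_funM => //.
      apply: (measurableT_comp (@measurable_inv R)).
      apply: (@measurableT_comp _ _ _ _ _ _ (@Num.sqrt R)).
        by apply: continuous_measurable_fun; exact: sqrt_continuous.
      by apply: measurable_funB => //; exact: measurable_funX.
    rewrite (@integral_affine_set _ (cos t) 0 _ (fun x => (g (x / cos t) / Num.sqrt (1 - x ^+ 2))%:E))//.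
    + rewrite gtr0_norm// integral_mkcond -nn_integralZ ?(ltW ct)//; first last.
      * apply/(measurable_restrictT _ _).1.
          rewrite (_ : [set x | _] = (fun x : V => cos t * x + 0) @^-1` `](-1)%R, 1%R[%classic)//.
          by rewrite -[X in measurable X]setTI; apply: affine_measurable.
        by apply: measurable_funTS; apply: (measurableT_comp mi); exact: affine_measurable.
      * by move=> y; rewrite patchE; case: ifP => // _; rewrite lee_fin divr_ge0 ?sqrtr_ge0.
      apply: eq_integral => y _; rewrite patchE /T/= t0 t1/=.
      have -> : (y \in [set x : R | `](-1)%R, 1%R[%classic (cos t * x + 0)]) = (cos t * `|y| < 1).
        rewrite -{2}[cos t]gtr0_norm// -normrM ltr_norml.
        by apply/idP/idP; rewrite inE/= in_itv/= addr0.
      case: ifP => _; last by rewrite mulr0 mule0.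
      rewrite addr0 mulrAC divff ?gt_eqF// mul1r -EFinM; congr _%:E.
      by rewrite mulrCA mulrA.
    + by rewrite gt_eqF.
    + by move=> x; rewrite lee_fin divr_ge0 ?sqrtr_ge0.
  - by move=> x; rewrite lee_fin.
  - by apply/measurable_EFinP; apply: (measurableT_comp mh); exact: cos_meas.
have mgT : measurable_fun setT (fun z : V * V => (g z.2 * T z)%:E).
  apply/measurable_EFinP; apply: measurable_funM => //.
  by apply: (@measurableT_comp _ _ _ _ _ _ g); [exact: continuous_measurable_fun|exact: measurable_snd].
have gT0 z : (0 <= (g z.2 * T z)%:E)%E by rewrite lee_fin mulr_ge0.
have -> : (\int[lam]_(s in `]0%R, (pi / 2)%R[) K (cos s) =
    (pi^-1)%:E * \int[lam]_t \int[lam]_y (g y * T (t, y))%:E)%E.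
  rewrite -nn_integralZ ?invr_ge0 ?(ltW pp0)//; last 2 first.
  - by move=> t; apply: integral_ge0 => y _; exact: (gT0 (t, y)).
  - exact: (@integral_section_meas _ V _ V R lam _ mgT).
  rewrite [LHS]integral_mkcond; apply: eq_integral => t _; rewrite patchE mem_setE in_itv/=.
  case: ifP => t01; first by rewrite KE.
  rewrite integral0_eq ?mule0// => y _; rewrite /T/= t01 mulr0//.
rewrite (@tonelli _ V _ V R lam lam (fun z => (g z.2 * T z)%:E))//.
have mI : measurable_fun setT (fun y : V => \int[lam]_t (g y * T (t, y))%:E)%E.
  have mgT' : measurable_fun setT (fun z : V * V => (g z.1 * T (z.2, z.1))%:E).
    exact: (measurableT_comp mgT (@measurable_swap _ _ V V)).
  by apply: (@integral_section_meas _ V _ V R lam _ mgT') => z; exact: (gT0 (z.2, z.1)).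
have I0 (y : V) : (0 <= \int[lam]_t (g y * T (t, y))%:E)%E.
  by apply: integral_ge0 => t _; exact: (gT0 (t, y)).
rewrite !muleA -!EFinM -nn_integralZ ?mulr_ge0 ?invr_ge0 ?(ltW pp0)//.
have mgd : measurable_fun setT (fun y : V => (g y * density_R y)%:E).
  apply/measurable_EFinP; apply: measurable_funM; last exact: density_meas.
  exact: continuous_measurable_fun.
apply: ge0_ae_eq_integral => //.
- exact: measurable_funeM.
- move=> y _; apply: mule_ge0; last exact: I0.
  by rewrite lee_fin ?mulr_ge0 ?invr_ge0 ?(ltW pp0).
- by move=> y _; rewrite lee_fin mulr_ge0// density_ge0.
(* [ratio_density_integral] excludes these three points, which form a null set. *)
exists ([set 0] `|` [set 1] `|` [set -1]); split.
- by apply: measurableU; [apply: measurableU|]; exact: measurable_set1.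
- by apply: countable_lebesgue_measure0; apply: finite_set_countable; rewrite !finite_setU; split; first split.
move=> y; apply: contra_notP => /= yN _.
have y0 : y != 0 by apply/eqP => e; apply: yN; left; left.
have y1 : y != 1 by apply/eqP => e; apply: yN; left; right.
have y2 : y != -1 by apply/eqP => e; apply: yN; right.
have y11 : `|y| != 1 by rewrite eqr_norml negb_and negb_or y1 y2.
have mTy : measurable_fun setT (fun t : V => (T (t, y))%:E).
  by apply/measurable_EFinP; apply: (measurableT_comp mT); exact: measurable_fun_pair.
under eq_integral do rewrite EFinM.
rewrite nn_integralZ//; last by move=> t; rewrite lee_fin.
have -> : (\int[lam]_t (T (t, y))%:E = (pi ^+ 2 / 2 * density_R y)%:E)%E.
  rewrite -ratio_density_integral// [RHS]integral_mkcond; apply: eq_integral => t _.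
  rewrite patchE /T/=; case: ifP => ht; first by rewrite mem_set.
  by rewrite memNset//= ht.
rewrite -!EFinM; congr _%:E; move: pp0; move: (@pi R) (density_R y) => P D P0.
by field; rewrite gt_eqF.
Qed.

(** Both sides are measures in [A]. On open sets they agree by monotone approximation with
    continuous functions, to which [law_density] applies. *)
Lemma law_measure (A : set X) : measurable A ->
  mu A = (\int[lam]_(x in [set x : R | A (real_point v phi x 1)]) (density_R x)%:E)%E.
Proof.
move=> mA.
have mrp : measurable_fun setT (fun x : V => real_point v phi x 1 : X).
  by apply: (real_point_meas phi_norm) => //; exact: measurable_id.
pose d0 (B : set V) : \bar R := (\int[lam]_(x in B) (density_R x)%:E)%E.
have md : measurable_fun setT (fun x : V => (@density_R R x)%:E).
  by apply/measurable_EFinP; exact: density_meas.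
have dge x : (0 <= (@density_R R x)%:E)%E by rewrite lee_fin density_ge0.
have d00 : d0 set0 = 0%E by rewrite /d0 integral_set0.
have d0ge B : (0 <= d0 B)%E by apply: integral_ge0.
have d0s : semi_sigma_additive d0 by exact: semi_sigma_additive_nng_induced.
pose dm : {measure set V -> \bar R} := HB.pack d0 (isMeasure.Build _ _ _ d0 d00 d0ge d0s).
have [m' m'E] := pushforward_measure_exists dm mrp.
suff -> : mu A = m' A by rewrite m'E.
apply: (@measure_unique _ R X (@open (P1 v)) (fun=> setT) erefl
  (@openI _) (fun=> openT) _ mu m' _ _ A mA).
- by rewrite bigcup_const//; exists 0%N.
- move=> O oO; have [f [cf f01 ndf lf]] := open_approx oO.
  have mO : measurable (O : set X) by exact: open_borel.
  have mf n : measurable_fun setT (fun p : X => (f n p)%:E).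
    by apply/measurable_EFinP; exact: continuous_borel.
  have f0 n (p : X) : 0 <= f n p by case/andP: (f01 n p).
  have E1 : mu O = limn (fun n => \int[mu]_p (f n p)%:E)%E.
    rewrite -monotone_convergence//.
    - rewrite -[in LHS](setIT O) -integral_indic//; apply: eq_integral => p _.
      by apply/esym/cvg_lim => //; apply: cvg_EFin; [exact: nearW|exact: lf].
    - by move=> n p _; rewrite lee_fin.
    - by move=> p _ n n' nn'; rewrite lee_fin; exact: ndf.
  pose fr n (x : V) : R := f n (real_point v phi x 1).
  have cfr n : continuous (fr n : R -> R).
    move=> x; apply: (@continuous_comp _ _ _ (fun x : R => real_point v phi x 1) (f n)).
      exact: real_chart_continuous.
    exact: cf.
  have E2 : m' O = limn (fun n => \int[lam]_x (fr n x * density_R x)%:E)%E.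
    rewrite -monotone_convergence//.
    - transitivity (d0 ((fun x => real_point v phi x 1) @^-1` O)); first exact: m'E.
      rewrite /d0 [LHS]integral_mkcond; apply: eq_integral => x _.
      apply/esym/cvg_lim => //; rewrite patchE (_ : (if _ then _ else _) = (\1_O (real_point v phi x 1) * density_R x)%:E); last first.
        rewrite indicE; have -> : (x \in (fun x0 => real_point v phi x0 1) @^-1` O) = (real_point v phi x 1 \in O).
          by apply/idP/idP; rewrite !inE.
        by case: (_ \in _); rewrite ?mul1r ?mul0r.
      apply: cvg_EFin; first exact: nearW.
      by apply: cvgM; [exact: lf|exact: cvg_cst].
    - move=> n; apply/measurable_EFinP; apply: measurable_funM; last exact: density_meas.
      exact: continuous_measurable_fun.
    - by move=> n x _; rewrite lee_fin mulr_ge0 ?density_ge0// /fr.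
    - by move=> x _ n n' nn'; rewrite lee_fin ler_wpM2r ?density_ge0//; exact: ndf.
  rewrite [LHS]E1 [RHS]E2; congr (limn _); apply/funext => n.
  by apply: law_density => // p; rewrite lee_fin.
- by move=> k; rewrite (le_lt_trans (probability_le1 _ _))// ltry.
Qed.

End LawDensity.

(** * Bounds for pi and zeta(3) *)

Section PiBounds.
Context {R : realType}.

Let sin_sum n (x : R) : R := \sum_(k < n) (-1) ^+ k * x ^+ k.*2.+1 / k.*2.+1`!%:R.
Let cos_sum n (x : R) : R := \sum_(k < n) (-1) ^+ k * x ^+ k.*2 / k.*2`!%:R.

Let monomial_derive n (c x : R) :
  is_derive x 1 (fun x : R => c * x ^+ n.+1 / n.+1`!%:R) (c * x ^+ n / n`!%:R).
Proof.
have d1 : is_derive x 1 (fun x : R => x ^+ n.+1) (n.+1%:R * x ^+ n).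
  have := is_deriveX n.+1 (is_derive_id x (1 : R)); rewrite exprfctE => h.
  by apply: is_derive_eq h _; rewrite /GRing.scale/= mulr1.
have d2 := is_deriveZ (c / n.+1`!%:R) d1.
rewrite (_ : (fun x : R => c * x ^+ n.+1 / n.+1`!%:R) = (c / n.+1`!%:R) \*: (fun x : R => x ^+ n.+1)); last first.
  by apply/funext => y; rewrite /= /GRing.scale/= mulrAC.
apply: is_derive_eq d2 _; rewrite /GRing.scale/= factS natrM.
have h : n`!%:R != 0 :> R by rewrite pnatr_eq0 -lt0n fact_gt0.
have h2 : n.+1%:R != 0 :> R by rewrite pnatr_eq0.
by move: n.+1%:R h2 => m h2; field; rewrite h h2.
Qed.

Let sin_sum_derive n (x : R) : is_derive x 1 (sin_sum n) (cos_sum n x).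
Proof.
elim: n => [|n ih].
  rewrite (_ : sin_sum 0 = cst 0); last by apply/funext => y; rewrite /sin_sum big_ord0.
  by rewrite /cos_sum big_ord0; exact: is_derive_cst.
rewrite (_ : sin_sum n.+1 = sin_sum n + (fun x : R => (-1) ^+ n * x ^+ n.*2.+1 / n.*2.+1`!%:R)); last first.
  by apply/funext => y; rewrite /sin_sum big_ord_recr.
rewrite (_ : cos_sum n.+1 x = cos_sum n x + (-1) ^+ n * x ^+ n.*2 / n.*2`!%:R); last first.
  by rewrite /cos_sum big_ord_recr.
exact: is_deriveD ih (monomial_derive _ _ _).
Qed.

Let cos_sum_derive n (x : R) : is_derive x 1 (cos_sum n.+1) (- sin_sum n x).
Proof.
elim: n => [|n ih].
  rewrite (_ : cos_sum 1 = cst 1); last first.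
    by apply/funext => y; rewrite /cos_sum big_ord1 expr0 mul1r expr0 divr1.
  by rewrite /sin_sum big_ord0 oppr0; exact: is_derive_cst.
rewrite (_ : cos_sum n.+2 = cos_sum n.+1 + (fun x : R => (-1) ^+ n.+1 * x ^+ n.*2.+2 / n.*2.+2`!%:R)); last first.
  by apply/funext => y; rewrite /cos_sum big_ord_recr.
rewrite (_ : - sin_sum n.+1 x = - sin_sum n x + (-1) ^+ n.+1 * x ^+ n.*2.+1 / n.*2.+1`!%:R); last first.
  by rewrite /sin_sum big_ord_recr/= opprD [in RHS]exprS mulN1r !mulNr.
exact: is_deriveD ih (monomial_derive _ _ _).
Qed.

Let nonneg_of_derive (f df : R -> R) : (forall x : R, is_derive x 1 f (df x)) -> f 0 = 0 ->
  (forall x, 0 <= x -> 0 <= df x) -> forall x, 0 <= x -> 0 <= f x.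
Proof.
move=> dF f0 df0 x x0.
have cf : continuous f.
  by move=> y; have [h _] := dF y; apply/differentiable_continuous/derivable1_diffP.
have [|c] := @MVT_segment _ f df 0 x x0 (fun y _ => dF y).
  exact: continuous_subspaceT.
rewrite in_itv/= f0 !subr0 => /andP[c0 _] ->.
by rewrite mulr_ge0// df0.
Qed.

(* Starting from [cos y <= 1], each inequality is the integral of the
   preceding one. *)
Lemma sin_taylor n (x : R) : 0 <= x -> 0 <= (-1) ^+ n.+1 * (sin x - sin_sum n.+1 x).
Proof.
have sin_sum0 m : sin_sum m 0 = 0.
  by rewrite /sin_sum big1// => k _; rewrite expr0n mulr0 mul0r.
have cos_sum0 m : cos_sum m.+1 0 = 1.
  rewrite /cos_sum big_ord_recl expr0 mul1r expr0 divr1 big1 ?addr0// => k _.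
  by rewrite expr0n mulr0 mul0r.
have cosP m : (forall y, 0 <= y -> 0 <= (-1) ^+ m * (sin y - sin_sum m y)) ->
    forall y, 0 <= y -> 0 <= (-1) ^+ m * (cos_sum m.+1 y - cos y).
  apply: nonneg_of_derive => [y|].
    have h := is_deriveZ ((-1) ^+ m) (is_deriveB (cos_sum_derive m y) (is_derive_cos y)).
    by apply: is_derive_eq h _; rewrite /GRing.scale/= opprK addrC.
  by rewrite cos_sum0 cos0 subrr mulr0.
have sinP m : (forall y, 0 <= y -> 0 <= (-1) ^+ m * (cos_sum m.+1 y - cos y)) ->
    forall y, 0 <= y -> 0 <= (-1) ^+ m.+1 * (sin y - sin_sum m.+1 y).
  apply: nonneg_of_derive => [y|].
    have h := is_deriveZ ((-1) ^+ m.+1) (is_deriveB (is_derive_sin y) (sin_sum_derive m.+1 y)).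
    by apply: is_derive_eq h _; rewrite /GRing.scale/= exprS mulN1r mulNr -mulrN opprB.
  by rewrite sin0 sin_sum0 subrr mulr0.
suff H m : forall y, 0 <= y -> 0 <= (-1) ^+ m * (cos_sum m.+1 y - cos y) by move=> x0; exact: (sinP n (H n) x x0).
elim: m => [|m ih]; last by apply: cosP; exact: sinP.
move=> y _; rewrite expr0 mul1r /cos_sum big_ord1 expr0 mul1r expr0 divr1 subr_ge0.
exact: cos_le1.
Qed.

Lemma sin_pi6 : sin (pi / 6) = 1 / 2 :> R.
Proof.
have p0 := @pi_gt0 R; set x := pi / 6.
have s0 : 0 < sin x by apply: sin_gt0_pi; rewrite /x; apply/andP; split; lra.
have c0 : 0 < cos x by apply: cos_gt0_pihalf; rewrite /x; apply/andP; split; lra.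
have e : sin (x + x) = cos x.
  rewrite -cosBpihalf -[RHS]cosN; congr cos.
  by rewrite /x; move: (@pi R) => p; field.
move: e; rewrite sinD => e.
have : cos x * (2 * sin x - 1) = 0 by rewrite mulrBr mulr1 -{2}e; ring.
by move/eqP; rewrite mulf_eq0 gt_eqF//= => /eqP h; lra.
Qed.

Let decimal (n : R) : R := 3 + 141 / 10 ^+ 3 + n / 10 ^+ 6.

(** On [[0, 4]] comparing [a] with [pi] amounts to comparing [sin (a / 6)] with [1 / 2], which
    Taylor polynomials decide: five terms bound the sine from above, four from below. *)
Lemma pi_bounds : decimal 592 < pi < decimal 593.
Proof.
have p0 := @pi_gt0 R; have p4 : (pi : R) < 4 by have := @pihalf_lt2 R; lra.
have mono (a : R) : 0 <= a <= 4 -> (a < pi) = (sin (a / 6) < 1 / 2).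
  move=> /andP[a0 a4]; have p2 := @pi_ge2 R.
  have a6 : a / 6 \in `[- (pi / 2), pi / 2]%R by rewrite in_itv/=; apply/andP; split; lra.
  have p6 : pi / 6 \in `[- (pi / 2), pi / 2 : R]%R by rewrite in_itv/=; apply/andP; split; lra.
  by rewrite -sin_pi6 ltr_sin// ltr_pM2r// invr_gt0.
have [d0 d1 d2 d3 d4] : [/\ 0.*2 = 0, 1.*2 = 2, 2.*2 = 4, 3.*2 = 6 & 4.*2 = 8]%N by [].
have factR m : m.+1`!%:R = m.+1%:R * m`!%:R :> R by rewrite factS natrM.
have sum4 (x : R) : sin_sum 4 x = x * (1 - x ^+ 2 / 6 * (1 - x ^+ 2 / 20 * (1 - x ^+ 2 / 42))).
  by rewrite /sin_sum !big_ord_recr big_ord0/= d0 d1 d2 d3 ?d4 !factR fact0; field.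
have sum5 (x : R) : sin_sum 5 x =
    x * (1 - x ^+ 2 / 6 * (1 - x ^+ 2 / 20 * (1 - x ^+ 2 / 42 * (1 - x ^+ 2 / 72)))).
  by rewrite /sin_sum !big_ord_recr big_ord0/= d0 d1 d2 d3 ?d4 !factR fact0; field.
have a1 : 0 <= decimal 592 / 6 by rewrite /decimal; lra.
have a2 : 0 <= decimal 593 / 6 by rewrite /decimal; lra.
have := @sin_taylor 4 _ a1; have := @sin_taylor 3 _ a2.
rewrite sum4 sum5 !exprS !expr0 !mulN1r !opprK !mulr1 !mul1r ?mulN1r !subr_ge0 oppr_ge0 subr_le0.
move=> h1 h2; apply/andP; split.
  by rewrite mono; [apply: le_lt_trans h2 _|]; rewrite /decimal; lra.
have h3 : ~~ (decimal 593 <= pi).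
  apply/negP; rewrite le_eqVlt => /predU1P[e|].
    by move: h1; have := sin_pi6; rewrite -e => ->; apply/negP; rewrite -ltNge /decimal; lra.
  rewrite mono; last by rewrite /decimal; lra.
  by apply/negP; rewrite -leNgt; apply: le_trans h1; rewrite /decimal; lra.
by rewrite ltNge.
Qed.

End PiBounds.

(** * The sum of inverse cubes by telescoping tails *)

Section ZetaThree.
Context {R : realType}.

Let z N : R := \sum_(1 <= n < N) n%:R ^- 3.
Let tail (c : R) (n : nat) : R := (2 * (n%:R ^+ 2 - n%:R + c))^-1.

Let tail_den c n : 0 < c -> 0 < n%:R ^+ 2 - n%:R + c :> R.
Proof.
move=> c0; rewrite ltr_wpDl// subr_ge0 expr2; case: n => [|n]; first by rewrite mul0r.
by rewrite ler_peMl// ler1n.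
Qed.

(* [c = 1 / 2] gives a lower and [c = 249 / 500] (for [10 <= n]) an upper bound
   for [n ^- 3]. *)
Let tail_step c n : 0 < c -> tail c n - tail c n.+1 =
  n%:R / ((n%:R ^+ 2 + c) ^+ 2 - n%:R ^+ 2).
Proof.
move=> c0; have h1 := tail_den n c0; have h2 := tail_den n.+1 c0.
have e : n.+1%:R ^+ 2 - n.+1%:R + c = n%:R ^+ 2 + n%:R + c :> R by rewrite -natr1; ring.
rewrite /tail e; rewrite e in h2.
have -> : (n%:R ^+ 2 + c) ^+ 2 - n%:R ^+ 2 = (n%:R ^+ 2 - n%:R + c) * (n%:R ^+ 2 + n%:R + c) :> R by ring.
by field; rewrite !gt_eqF.
Qed.

(** By [tail_step] the difference is [n / (n ^ 4 + (2 * c - 1) * n ^ 2 + c ^ 2)], so its comparison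
    with [n ^- 3] depends on the sign of [(2 * c - 1) * n ^ 2 + c ^ 2]. *)
Let cube_tail (c1 c2 : R) n : 0 < c2 -> c2 <= c1 -> 0 <= 2 * c1 - 1 -> (0 < n)%N ->
  c2 ^+ 2 <= (1 - 2 * c2) * n%:R ^+ 2 ->
  tail c1 n - tail c1 n.+1 <= n%:R ^- 3 <= tail c2 n - tail c2 n.+1.
Proof.
move=> c20 c12 c1h n0 c2h; have c10 : 0 < c1 by exact: lt_le_trans c12.
have N0 : 0 < n%:R :> R by rewrite ltr0n.
have den c : 0 < c -> 0 < (n%:R ^+ 2 + c) ^+ 2 - n%:R ^+ 2 :> R.
  move=> c0; have h1 := tail_den n c0; have h2 := tail_den n.+1 c0.
  have -> : (n%:R ^+ 2 + c) ^+ 2 - n%:R ^+ 2 = (n%:R ^+ 2 - n%:R + c) * (n%:R ^+ 2 + n%:R + c) :> R by ring.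
  by rewrite mulr_gt0// ltr_pwDr// addr_ge0// ?sqr_ge0// ltW.
rewrite !tail_step// -[n%:R ^- 3]mul1r.
have N3 : 0 < n%:R ^+ 3 :> R by rewrite exprn_gt0.
have e4 : n%:R * n%:R ^+ 3 = (n%:R ^+ 2) ^+ 2 :> R by ring.
have s0 : 0 <= n%:R ^+ 2 :> R by rewrite sqr_ge0.
apply/andP; split.
  rewrite mul1r ler_pdivrMr ?den// mulrC ler_pdivlMr// e4.
  by move: (n%:R ^+ 2) s0 c2h => s s0 c2h; nra.
rewrite mul1r ler_pdivlMr ?den// mulrC ler_pdivrMr// e4.
by move: (n%:R ^+ 2) s0 c2h => s s0 c2h; nra.
Qed.

Let z_tail N : (10 <= N)%N ->
  z 10 + tail (1 / 2) 10 - tail (1 / 2) N <= z N <= z 10 + tail (249 / 500) 10 - tail (249 / 500) N.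
Proof.
elim: N => // N ih; rewrite leq_eqVlt => /predU1P[<-|]; first by rewrite !addrK lexx.
rewrite ltnS => N10; have /andP[h1 h2] := ih N10.
have -> : z N.+1 = z N + N%:R ^- 3.
  by rewrite /z big_nat_recr//= (leq_trans _ N10).
have N10r : 10 <= N%:R :> R by rewrite ler_nat.
have /andP[h3 h4] : tail (1 / 2) N - tail (1 / 2) N.+1 <= N%:R ^- 3 <= tail (249 / 500) N - tail (249 / 500) N.+1.
  apply: cube_tail; [lra|lra|lra|by rewrite (leq_trans _ N10)|].
  by move: N10r; move: (N%:R : R) => n n10; nra.
apply/andP; split; lra.
Qed.

Let tail_ge0 c n : 0 < c -> 0 <= tail c n.
Proof. by move=> c0; rewrite invr_ge0 mulr_ge0// ltW// tail_den. Qed.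

Let z_nd : nondecreasing_seq z.
Proof.
apply/nondecreasing_seqP => -[|n]; first by rewrite /z !big_geq.
by rewrite [leRHS]/z big_nat_recr//= lerDl invr_ge0 exprn_ge0.
Qed.

Let z_ub N : z N <= z 10 + tail (249 / 500) 10.
Proof.
have c0 : 0 < 249 / 500 :> R by lra.
have [N10|N10] := leqP 10 N.
  have /andP[_ h] := z_tail N10; apply: le_trans h _.
  by have := tail_ge0 N c0; lra.
by apply: le_trans (z_nd (ltnW N10)) _; have := tail_ge0 10 c0; lra.
Qed.

Lemma zeta3_cvg : z @ \oo --> zeta3 R.
Proof.
apply: (nondecreasing_is_cvgn z_nd); exists (z 10 + tail (249 / 500) 10).
by move=> _ [n _ <-]; exact: z_ub.
Qed.

Lemma zeta3_bounds :
  z 10 + tail (1 / 2) 10 <= zeta3 R <= z 10 + tail (249 / 500) 10.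
Proof.
apply/andP; split; last first.
  apply: limr_le; first by apply: cvgP; exact: zeta3_cvg.
  by apply: nearW => n; exact: z_ub.
apply/ler_addgt0Pr => e e0; pose N := (10 + Num.truncn e^-1)%N.
have N10 : (10 <= N)%N by rewrite leq_addr.
have zN : z N <= zeta3 R.
  exact: (nondecreasing_cvgn_le z_nd (cvgP _ zeta3_cvg)).
have tN : tail (1 / 2) N <= e.
  have Ne : e^-1 <= N%:R.
    by apply: le_trans (ltW (truncnS_gt _)) _; rewrite ler_nat /N addSn ltnS leq_addl.
  have N2 : 10 <= N%:R :> R by rewrite ler_nat.
  have h12 : 0 < 1 / 2 :> R by rewrite divr_gt0.
  rewrite /tail -[e]invrK lef_pV2 ?posrE ?invr_gt0// ?mulr_gt0 ?tail_den//.
  by apply: le_trans Ne _; nra.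
have /andP[h _] := z_tail N10; lra.
Qed.

Let z10 : z 10 = 1 + 1 / 2 ^+ 3 + 1 / 3 ^+ 3 + 1 / 4 ^+ 3 + 1 / 5 ^+ 3 + 1 / 6 ^+ 3
  + 1 / 7 ^+ 3 + 1 / 8 ^+ 3 + 1 / 9 ^+ 3.
Proof. by rewrite /z; do 8 rewrite big_nat_recr//=; rewrite big_nat1 expr1n invr1 !div1r. Qed.

(** These bounds express the decimals [0.426278...]. They follow from nine terms of the series, a
    remainder between [1 / 181] and [1 / 181 + 10 ^ -6], and six decimals of [pi]. *)
Lemma energy_value_bounds :
  (426 / 10 ^+ 3 + 278 / 10 ^+ 6 : R) <= 7 * zeta3 R / (2 * pi ^+ 2)
    < 426 / 10 ^+ 3 + 279 / 10 ^+ 6.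
Proof.
have /andP[pl pu] := @pi_bounds R; have /andP[zl zu] := zeta3_bounds.
have e1 : (2 * (10 ^+ 2 - 10 + 1 / 2))^-1 = 1 / 181 :> R by field.
have e2 : (2 * (10 ^+ 2 - 10 + 249 / 500))^-1 <= 1 / 181 + 1 / 10 ^+ 6 :> R.
  have t0 : 0 < 2 * (10 ^+ 2 - 10 + 249 / 500) :> R by lra.
  by rewrite -[leLHS]mul1r ler_pdivrMr//; lra.
move: zl zu; rewrite z10 /tail e1 => zl /le_trans zu.
have {e2}zu := zu _ (lerD (lexx _) e2).
have p0 := @pi_gt0 R; have P0 : 0 < 2 * (pi : R) ^+ 2 by rewrite mulr_gt0// exprn_gt0.
move: (@pi R) pl pu p0 P0 => p pl pu p0 P0.
have sqr_lt (a b : R) : 0 <= a -> a < b -> a ^+ 2 < b ^+ 2.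
  by move=> a0 ab; rewrite !expr2 ltr_pM.
have {}pl : (3 + 141 / 10 ^+ 3 + 592 / 10 ^+ 6) ^+ 2 < p ^+ 2.
  by apply: sqr_lt; lra.
have {}pu : p ^+ 2 < (3 + 141 / 10 ^+ 3 + 593 / 10 ^+ 6) ^+ 2.
  by apply: sqr_lt; lra.
rewrite ler_pdivlMr// ltr_pdivrMr//.
move: (p ^+ 2) (zeta3 R) pl pu zl zu => s x {p0 P0} pl pu zl zu.
by apply/andP; split; lra.
Qed.

(** The even terms of the series make up one eighth of the whole. *)
Lemma odd_cubes_cvg : (fun N => \sum_(0 <= k < N) k.*2.+1%:R ^- 3 : R) @ \oo --> 7 / 8 * zeta3 R.
Proof.
have e N : \sum_(0 <= k < N) k.*2.+1%:R ^- 3 = z N.*2.+1 - z N.+1 / 8 :> R.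
  elim: N => [|N ih]; first by rewrite /z !big_geq// mul0r subrr.
  have zS n : z n.+2 = z n.+1 + n.+1%:R ^- 3 by rewrite /z big_nat_recr.
  rewrite big_nat_recr//= ih doubleS !zS.
  have -> : (N.*2.+2%:R : R) ^- 3 = N.+1%:R ^- 3 / 8.
    rewrite -doubleS -mul2n natrM exprMn invfM mulrC; congr (_ * _^-1).
    by ring.
  by rewrite mulrDl; ring.
rewrite (funext e); have -> : 7 / 8 * zeta3 R = zeta3 R - zeta3 R / 8 by field.
have sub (h : nat -> nat) : (forall n, (n <= h n)%N) -> z (h n) @[n --> \oo] --> zeta3 R.
  move=> hn; apply: (@cvg_comp _ _ _ h z); last exact: zeta3_cvg.
  by move=> A [N0 _ hA]; exists N0 => // n /= nN; apply: hA; exact: leq_trans (hn n).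
apply: cvgB; first by apply: sub => n; rewrite -addnn -addSn leq_addl.
by apply: cvgMl; apply: sub.
Qed.

End ZetaThree.

(** * The value of the real energy *)

Section LogSeries.
Context {R : realType}.

Let log_sum N (u : R) : R := \sum_(0 <= k < N) 2 * u ^+ k.*2.+1 / k.*2.+1%:R.

Let log_sum_derive N (u : R) : u ^+ 2 != 1 ->
  is_derive u 1 (log_sum N) (2 * (1 - u ^+ N.*2) / (1 - u ^+ 2)).
Proof.
move=> u1; have d0 : 1 - u ^+ 2 != 0 by rewrite subr_eq0 eq_sym.
elim: N => [|N ih].
  rewrite (_ : log_sum 0 = cst 0); last by apply/funext => y; rewrite /log_sum big_geq.
  by rewrite expr0 subrr mulr0 mul0r; exact: is_derive_cst.
rewrite (_ : log_sum N.+1 = log_sum N + (2 / N.*2.+1%:R) \*: (fun u : R => u ^+ N.*2.+1)); last first.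
  by apply/funext => y; rewrite /log_sum big_nat_recr//= /GRing.scale/= mulrAC.
have d1 : is_derive u 1 (fun u : R => u ^+ N.*2.+1) (N.*2.+1%:R * u ^+ N.*2).
  have := is_deriveX N.*2.+1 (is_derive_id u (1 : R)); rewrite exprfctE => h.
  by apply: is_derive_eq h _; rewrite /GRing.scale/= mulr1.
have h := is_deriveD ih (is_deriveZ (2 / N.*2.+1%:R) d1).
apply: is_derive_eq h _; rewrite /GRing.scale/= mulrA divfK ?pnatr_eq0//.
rewrite doubleS !exprS; field; exact: d0.
Qed.

Let log_ratio_derive (u : R) : -1 < u < 1 ->
  is_derive u 1 (fun u : R => ln (1 + u) - ln (1 - u)) (2 / (1 - u ^+ 2)).
Proof.
move=> /andP[u1 u2].
have d1 : is_derive u 1 (fun u : R => 1 + u) 1.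
  by apply: is_derive_eq (is_deriveD (is_derive_cst (1 : R) u 1) (is_derive_id u (1 : R))) _; rewrite add0r.
have d2 : is_derive u 1 (fun u : R => 1 - u) (-1).
  by apply: is_derive_eq (is_deriveB (is_derive_cst (1 : R) u 1) (is_derive_id u (1 : R))) _; rewrite sub0r.
have p1 : 0 < 1 + u by lra.
have p2 : 0 < 1 - u by lra.
have l1 := @is_derive1_comp _ (@ln R) (fun u => 1 + u) u _ _ (is_derive1_ln p1) d1.
have l2 := @is_derive1_comp _ (@ln R) (fun u => 1 - u) u _ _ (is_derive1_ln p2) d2.
apply: is_derive_eq (is_deriveB l1 l2) _.
have -> : 1 - u ^+ 2 = (1 + u) * (1 - u) by ring.
by rewrite /GRing.scale/=; field; rewrite !gt_eqF.
Qed.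

(** The mean value theorem on [[0, u]]: the derivative of the remainder at [c] is
    [2 * c ^ (2 * N) / (1 - c ^ 2)], which increases with [c], and the length [u] is less than 1. *)
Let log_sum_remainder N (u : R) : 0 < u < 1 ->
  0 <= ln ((1 + u) / (1 - u)) - log_sum N u <= 2 * (u ^+ 2) ^+ N / (1 - u ^+ 2).
Proof.
move=> /andP[u0 u1].
have sq (c : R) : 0 <= c <= u -> 0 < 1 - c ^+ 2.
  by move=> /andP[c0 cu]; rewrite subr_gt0 expr_lt1//; lra.
have dF (c : R) : 0 <= c <= u -> is_derive c 1
    ((fun u : R => ln (1 + u) - ln (1 - u)) - log_sum N) (2 * (c ^+ 2) ^+ N / (1 - c ^+ 2)).
  move=> cu; have c2 := sq _ cu; have /andP[cu1 cu2] := cu.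
  have h1 : is_derive c 1 (fun u : R => ln (1 + u) - ln (1 - u)) (2 / (1 - c ^+ 2)).
    by apply: log_ratio_derive; apply/andP; split; lra.
  have h2 : is_derive c 1 (log_sum N) (2 * (1 - c ^+ N.*2) / (1 - c ^+ 2)).
    by apply: log_sum_derive; rewrite lt_eqF// -subr_gt0.
  apply: is_derive_eq (is_deriveB h1 h2) _.
  by rewrite -exprM mul2n; field; rewrite gt_eqF.
have cF : {within `[0, u], continuous ((fun u : R => ln (1 + u) - ln (1 - u)) - log_sum N)}.
  apply: derivable_within_continuous => c; rewrite in_itv/= => cu.
  by have [] := dF c cu.
have dF' (c : R) : c \in `]0, u[ -> is_derive c 1
    ((fun u : R => ln (1 + u) - ln (1 - u)) - log_sum N) (2 * (c ^+ 2) ^+ N / (1 - c ^+ 2)).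
  by rewrite in_itv/= => /andP[c0 cu]; apply: dF; rewrite !ltW.
have [c] := MVT_segment (ltW u0) dF' cF.
rewrite in_itv/= => cu; have /andP[c0 cu'] := cu.
have l0 : log_sum N 0 = 0.
  by rewrite /log_sum big1// => k _; rewrite expr0n mulr0 mul0r.
have -> : ((fun u : R => ln (1 + u) - ln (1 - u)) - log_sum N) u -
    ((fun u : R => ln (1 + u) - ln (1 - u)) - log_sum N) 0 = ln ((1 + u) / (1 - u)) - log_sum N u.
  transitivity (ln (1 + u) - ln (1 - u) - log_sum N u - (ln (1 + 0) - ln (1 - 0) - log_sum N 0)); first by [].
  by rewrite l0 addr0 !subr0 subrr subr0 ln_div// posrE; lra.
move=> ->; have c2 := sq _ cu; have u2 : 0 < 1 - u ^+ 2 by apply: sq; lra.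
have e0 (x : R) : 0 <= 2 * (x ^+ 2) ^+ N by rewrite mulr_ge0// exprn_ge0// sqr_ge0.
apply/andP; split; first by rewrite mulr_ge0 ?divr_ge0 ?(ltW c2)// subr0 ltW.
rewrite subr0 -[leRHS]mulr1; apply: ler_pM; [by rewrite divr_ge0// ltW|by rewrite ltW| |by rewrite ltW].
have cu2 : c ^+ 2 <= u ^+ 2 by rewrite lerXn2r// nnegrE// ltW.
apply: ler_pM; [by []|by rewrite invr_ge0 ltW| |].
  by rewrite ler_pM2l// lerXn2r// nnegrE sqr_ge0.
by rewrite lef_pV2 ?posrE//; lra.
Qed.

Lemma log_ratio_series (u : R) : 0 < u < 1 ->
  (\sum_(0 <= k <oo) (2 * u ^+ k.*2.+1 / k.*2.+1%:R)%:E = (ln ((1 + u) / (1 - u)))%:E)%E.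
Proof.
move=> u01; have /andP[u0 u1] := u01.
apply/cvg_lim => //; rewrite (_ : (fun _ => _) = EFin \o (log_sum ^~ u)); last first.
  by apply/funext => N; rewrite /= sumEFin.
apply: cvg_EFin; first by apply: nearW.
rewrite (_ : _ \o _ = fun N => ln ((1 + u) / (1 - u)) - (ln ((1 + u) / (1 - u)) - log_sum N u)); last first.
  by apply/funext => N /=; rewrite opprB addrC subrK.
rewrite -[X in _ --> X]subr0; apply: cvgB; first exact: cvg_cst.
apply: (@squeeze_cvgr _ _ _ _ (cst 0) (geometric (2 / (1 - u ^+ 2)) (u ^+ 2))).
- by apply: nearW => N /=; rewrite mulrAC; exact: log_sum_remainder.
- exact: cvg_cst.
- by apply: cvg_geometric; rewrite ger0_norm ?sqr_ge0// expr_lt1// ltW.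
Qed.

End LogSeries.

(** * Moments of the logarithm on []1, +oo[] *)

Section LogMoments.
Context {R : realType}.

Let antiderivative m (y : R) : R := - (y^-1 ^+ m * (ln y / m%:R + m%:R ^- 2)).

Let antiderivative_derive m (y : R) : (0 < m)%N -> 0 < y ->
  is_derive y 1 (antiderivative m) (ln y * y ^- m.+1).
Proof.
case: m => // m _ y0; have yn : y != 0 by rewrite gt_eqF.
have dV : is_derive y 1 (fun y : R => y^-1) (- y ^- 2).
  have h := is_deriveV yn (is_derive_id y (1 : R)).
  by apply: is_derive_eq h _; rewrite /GRing.scale/= mulr1.
have dX := is_deriveX m.+1 dV; rewrite exprfctE in dX.
have h := is_deriveN (is_deriveM dX (is_deriveD (is_deriveZ m.+1%:R^-1 (is_derive1_ln y0))
  (is_derive_cst (m.+1%:R ^- 2 : R) y 1))).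
rewrite (_ : antiderivative m.+1 = - ((fun x : R => x^-1 ^+ m.+1) *
    (m.+1%:R^-1 \*: @ln R + cst (m.+1%:R ^- 2)))); last first.
  by apply/funext => z; rewrite /antiderivative [ln z / _]mulrC.
apply: is_derive_eq h _; rewrite /GRing.scale/= addr0.
have m0 : m.+1%:R != 0 :> R by rewrite pnatr_eq0.
transitivity (ln y * y^-1 ^+ m.+2); last by rewrite exprVn.
rewrite -[y ^- 2]exprVn.
suff E : - (y^-1 ^+ m.+1 * (m.+1%:R^-1 / y) + (m.+1%:R^-1 * ln y + m.+1%:R ^- 2) *
    (m.+1%:R * y^-1 ^+ m * - y^-1 ^+ 2)) = ln y * y^-1 ^+ m.+2 by exact: E.
move: m.+1%:R m0 (ln y) y^-1 => n n0 l w; rewrite !exprS; field; exact: n0.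
Qed.

Let antiderivative_cvg m : (0 < m)%N -> antiderivative m y @[y --> +oo] --> (0 : R).
Proof.
move=> m0; apply/cvgr0Pnorm_le => e e0; near=> y.
have y1 : 1 < y by near: y; apply: nbhs_pinfty_gt; rewrite num_real.
(* The antiderivative is at most [3 * Num.sqrt y / y] in absolute value, which is below [e] for such
   [y]. *)
have ye : (3 / e) ^+ 2 < y by near: y; apply: nbhs_pinfty_gt; rewrite num_real.
have y0 : 0 < y by lra.
have m1 : 1 <= m%:R :> R by rewrite ler1n.
have s0 : 0 < Num.sqrt y by rewrite sqrtr_gt0.
have s1 : 1 <= Num.sqrt y by rewrite -sqrtr1 ler_wsqrtr// ltW.
have sE : Num.sqrt y ^+ 2 = y by rewrite sqr_sqrtr// ltW.
have l0 : 0 <= ln y by rewrite ln_ge0// ltW.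
have l2 : ln y <= 2 * Num.sqrt y.
  by rewrite -{1}sE lnXn// mulr_natl lerMn2r/= ltW// ln_sublinear.
have b1 : 0 <= ln y / m%:R + m%:R ^- 2.
  by rewrite addr_ge0// ?divr_ge0// invr_ge0 exprn_ge0.
have b2 : ln y / m%:R + m%:R ^- 2 <= 3 * Num.sqrt y.
  have h1 : ln y / m%:R <= ln y by rewrite ler_pdivrMr ?ltr0n// ler_peMr.
  have h2 : m%:R ^- 2 <= 1 :> R by rewrite invf_le1 ?exprn_gt0 ?ltr0n// exprn_ege1.
  lra.
rewrite normrN ger0_norm ?mulr_ge0 ?exprn_ge0 ?invr_ge0 ?(ltW y0)//.
have b3 : y^-1 ^+ m <= y^-1.
  by rewrite -[leRHS]expr1 ler_wiXn2l// ?invr_ge0 ?(ltW y0)// invf_le1// ltW.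
apply: le_trans (ler_pM _ b1 b3 b2) _; first by rewrite exprn_ge0// invr_ge0 ltW.
have s3 : 3 / e < Num.sqrt y.
  rewrite ltNge; apply/negP => h; move: ye; rewrite -sE; apply/negP; rewrite -leNgt.
  by rewrite lerXn2r// nnegrE ?(ltW s0)// divr_ge0// ltW.
rewrite ler_pdivrMl//; move: s3; rewrite ltr_pdivrMr// => s3.
have -> : y * e = Num.sqrt y * (Num.sqrt y * e) by rewrite -{1}sE expr2 mulrA.
by rewrite mulrC ler_pM2l// ltW.
Unshelve. all: by end_near. Qed.

Lemma log_moment m : (0 < m)%N ->
  (\int[lebesgue_measure]_(y in `]1%R, +oo[) (ln y * y ^- m.+1)%:E = (m%:R ^- 2 : R)%:E)%E.
Proof.
move=> m0.
have cd (y : R) : 0 < y -> {for y, continuous (fun y : R => ln y * y ^- m.+1)}.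
  move=> y0; apply: cvgM; first exact: continuous_ln.
  by apply: cvgV; [rewrite gt_eqF// exprn_gt0|exact: exprn_continuous].
rewrite integral_itv_obnd_cbnd; last first.
  apply/measurable_EFinP/measurable_funTS; apply: measurable_funM; first exact: measurable_ln.
  by apply: measurableT_comp; [exact: measurable_inv|exact: exprn_measurable].
rewrite (@ge0_continuous_FTC2y _ _ (antiderivative m) 1 0).
- transitivity (0 - antiderivative m 1)%:E; first by [].
  by rewrite sub0r /antiderivative opprK ln1 mul0r add0r invr1 expr1n mul1r.
- by move=> y y1; rewrite mulr_ge0 ?ln_ge0// invr_ge0 exprn_ge0//; lra.
- apply: continuous_in_subspaceT => y; rewrite inE/= in_itv/= andbT => y1; apply: cd; lra.
- exact: antiderivative_cvg.
- by move=> y y1; have [] := antiderivative_derive m0 (lt_trans ltr01 y1).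
- apply: cvg_at_right_filter; have [h _] := antiderivative_derive m0 (@ltr01 R).
  by apply/differentiable_continuous/derivable1_diffP.
- move=> y; rewrite in_itv/= andbT => y1.
  by rewrite derive1E; have [_ ->] := antiderivative_derive m0 (lt_trans ltr01 y1).
Qed.

End LogMoments.

(** * The potential at infinity *)

Section EnergyIntegral.
Context {R : realType}.

Let half (y : R) : \bar R := (if 1 < y then ln y * density_R y else 0)%:E.

Let half_ge0 y : (0 <= half y)%E.
Proof.
rewrite /half lee_fin; case: ifP => // y1.
by rewrite mulr_ge0 ?density_ge0// ln_ge0// ltW.
Qed.

Let half_meas : measurable_fun [set: measurableTypeR R] half.
Proof.
apply/measurable_EFinP; apply: measurable_fun_ifT.
- exact: measurable_fun_ltr.
- apply: measurable_funM; [exact: measurable_ln|exact: density_meas].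
- exact: measurable_cst.
Qed.

Let half_series (y : R) : 1 < y -> half y =
  (\sum_(0 <= k <oo) (2 / (pi ^+ 2 * k.*2.+1%:R) * (ln y * y ^- k.*2.+2))%:E)%E.
Proof.
move=> y1; have y0 : 0 < y by lra.
have u01 : 0 < y^-1 < 1 by rewrite invr_gt0 y0/= invf_lt1.
have e : ln `|(y + 1) / (y - 1)| = ln ((1 + y^-1) / (1 - y^-1)).
  rewrite ger0_norm; last by rewrite divr_ge0//; lra.
  by congr ln; field; apply/andP; split; [rewrite gt_eqF//|]; lra.
rewrite /half y1 /density_R e mulrA EFinM -log_ratio_series// -nneseriesZl; last first.
  by move=> k _; rewrite lee_fin divr_ge0// mulr_ge0// exprn_ge0// invr_ge0 ltW.
apply: eq_eseriesr => k _; rewrite -EFinM; congr EFin.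
have p0 := @pi_gt0 R; have k0 : k.*2.+1%:R != 0 :> R by rewrite pnatr_eq0.
rewrite -[y ^- _]exprVn [y^-1 ^+ k.*2.+2]exprS; move: (@pi R) p0 k.*2.+1%:R k0 (y^-1 ^+ _) => p p0 n k0 w.
by field; rewrite k0 !gt_eqF.
Qed.

(** The term of index [k] is [2 / (pi ^ 2 * (2 * k + 1))] times the moment [(2 * k + 1) ^- 2], and
    the inverse odd cubes sum to [7 / 8] of [zeta3]. *)
Let half_integral : (\int[lebesgue_measure]_y half y = (7 * zeta3 R / (4 * pi ^+ 2))%:E)%E.
Proof.
transitivity (\int[lebesgue_measure]_(y in `]1%R, +oo[) half y)%E.
  rewrite [RHS]integral_mkcond; apply: eq_integral => y _.
  rewrite patchE; case: ifPn => // ; rewrite notin_setE/= in_itv/= andbT => /negP.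
  by rewrite /half => /negbTE ->.
transitivity (\int[@lebesgue_measure R]_(y in `]1%R, +oo[)
    \sum_(0 <= k <oo) ((2 / (pi ^+ 2 * k.*2.+1%:R))%:E * (ln y * y ^- k.*2.+2)%:E))%E.
  by apply: eq_integral => y; rewrite inE/= in_itv/= andbT => /half_series.
have c0 k : 0 <= 2 / (pi ^+ 2 * k.*2.+1%:R) :> R by rewrite divr_ge0// mulr_ge0// sqr_ge0.
have m1 k : measurable_fun (`]1%R, +oo[%classic : set (measurableTypeR R)) (fun y : measurableTypeR R => (ln y * y ^- k.*2.+2)%:E).
  apply/measurable_EFinP/measurable_funTS; apply: measurable_funM; first exact: measurable_ln.
  by apply: measurableT_comp; [exact: measurable_inv|exact: exprn_measurable].
have g0 k (y : R) : `]1%R, +oo[%classic y -> (0 <= (ln y * y ^- k.*2.+2)%:E)%E.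
  rewrite /= in_itv/= andbT => y1.
  by rewrite lee_fin mulr_ge0 ?ln_ge0 ?(ltW y1)// invr_ge0 exprn_ge0//; lra.
rewrite integral_nneseries//; last 2 first.
- by move=> k; apply: measurable_funeM; exact: m1.
- by move=> k y y1; rewrite mule_ge0 ?lee_fin ?c0// -lee_fin; exact: g0.
under eq_eseriesr => k _.
  rewrite ge0_integralZl_EFin//; last exact: g0.
  rewrite log_moment// -EFinM.
  over.
apply/cvg_lim => //; rewrite (_ : (fun _ => _) =
    EFin \o (fun N => 2 / pi ^+ 2 * \sum_(0 <= k < N) k.*2.+1%:R ^- 3)); last first.
  apply/funext => N; rewrite /= sumEFin mulr_sumr; congr EFin; apply: eq_bigr => k _.
  have p0 := @pi_gt0 R; have k0 : k.*2.+1%:R != 0 :> R by rewrite pnatr_eq0.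
  by move: (@pi R) p0 k.*2.+1%:R k0 => p p0 n k0; field; rewrite k0 gt_eqF.
apply: cvg_EFin; first exact: nearW.
rewrite (_ : 7 * zeta3 R / (4 * pi ^+ 2) = 2 / pi ^+ 2 * (7 / 8 * zeta3 R)); last first.
  by have p0 := @pi_gt0 R; move: (@pi R) p0 => p p0; field; rewrite gt_eqF.
by apply: cvgMr; exact: odd_cubes_cvg.
Qed.

Lemma log_density_integral :
  (\int[lebesgue_measure]_y (ln (Num.max 1 `|y|) * density_R y)%:E =
    (7 * zeta3 R / (2 * pi ^+ 2))%:E)%E.
Proof.
transitivity (\int[lebesgue_measure]_y (half y + half (-1 * y + 0)%R))%E.
  apply: eq_integral => y _; rewrite /half mulN1r addr0 density_N -EFinD; congr EFin.
  have [y1|y1] := ltP 1 y.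
    rewrite ifF ?addr0; last by apply/negbTE; rewrite -leNgt; lra.
    by rewrite ger0_norm ?max_r//; lra.
  have [y2|y2] := ltP 1 (- y).
    by rewrite add0r ler0_norm ?max_r//; lra.
  by rewrite max_l ?ln1 ?mul0r ?addr0// ler_norml; apply/andP; split; lra.
have hm : measurable_fun [set: measurableTypeR R] (fun y => half (-1 * y + 0)).
  by apply: measurableT_comp half_meas _; exact: affine_measurable.
rewrite ge0_integralD//.
have := @integral_affine R (-1) 0 half _ half_meas half_ge0.
rewrite normrN normr1 mul1e oppr_eq0 oner_eq0 => <- //.
rewrite half_integral -EFinD; congr EFin.
have p0 := @pi_gt0 R; move: (@pi R) p0 => p p0; field; rewrite gt_eqF//.
Qed.

End EnergyIntegral.

(** * The real equilibrium measure *)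

Section RealEquilibrium.
Context {R : realType} {L : fieldType} (v : absolute_value R L).
Hypothesis v_nontrivial : nontrivial_absv v.
Hypothesis L_locally_compact : locally_compact [set: valued v].
Variable phi : {rmorphism R -> L}.
Hypothesis phi_bij : bijective phi.
Hypothesis phi_norm : forall x, v (phi x) = `|x|.

Let neglog_half (a : R) : 0 <= a -> (neglog (a / 2) = neglog a + (ln 2)%:E)%E.
Proof.
rewrite le_eqVlt => /predU1P[<-|a0]; first by rewrite mul0r neglog0.
by rewrite !neglogE ?divr_gt0// ln_div ?posrE// -EFinD; congr EFin; ring.
Qed.

Let infinity : P1 v := real_point v phi 1 0.

Let delta_infinity (a b : R) : (a, b) != (0, 0) ->
  delta infinity (real_point v phi a b) = `|b| / Num.max `|a| `|b|.
Proof.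
move=> ab; rewrite delta_real_point ?xpair_eqE ?oner_eq0//.
by rewrite mul1r mul0r subr0 normr1 normr0 max_l// mul1r.
Qed.

Let delta_infinity_le1 p : delta infinity p <= 1.
Proof.
elim/(@angle_point_ind _ _ v phi phi_bij): p => t.
have c0 := cos_sin_neq0 t; rewrite /angle_point delta_infinity//.
rewrite ler_pdivrMr ?mul1r ?le_max ?lexx ?orbT//.
by rewrite lt_max !normr_gt0; move: c0; rewrite xpair_eqE negb_and.
Qed.

Theorem real_equilibrium : exists mu : probability (borel (P1 v)) R,
  [/\ minimizes_energy mu,
      forall nu : probability (borel (P1 v)) R,
        minimizes_energy nu -> same_measure nu mu &
      forall nu : nat -> probability (borel (P1 v)) R,
        energy (nu n) @[n --> \oo] --> energy mu -> weakly_converges nu mu] /\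
  (forall A : set (borel (P1 v)), measurable A ->
      mu A = (\int[lebesgue_measure]_(x in
        [set x : R | A (hpoint v (phi x) 1)]) (density_R x)%:E)%E) /\
  energy mu = (7 * zeta3 R / (2 * pi ^+ 2))%:E.
Proof.
have [mu muE] := pushforward_probability (@circle_law R \x @circle_law R)%E (law_point_meas phi_norm).
exists mu; set c := 7 * zeta3 R / (2 * pi ^+ 2).
have ln2 : 0 <= ln 2 :> R by rewrite ln_ge0// ler1n.
have halfE x y : (- lne (delta x y)%:E + (ln 2)%:E = neglog (delta x y / 2)%R :> \bar R)%E.
  by rewrite neglog_half// delta_ge0.
(* In the affine coordinate the distance from infinity to [x] is [1 / max 1 |x|], so the potential
   there is the integral of [ln (max 1 |x|)] against the density, up to the shift. *)
have infinity_potential : (\int[mu]_y neglog (delta infinity y / 2)%R = (c + ln 2)%:E)%E.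
  under eq_integral do rewrite neglog_half ?delta_ge0//.
  have m0 : measurable_fun setT (fun y : borel (P1 v) => neglog (delta infinity y)).
    by apply: neglog_meas; apply: continuous_borel; exact: delta_continuous.
  have k0 (y : borel (P1 v)) : (0 <= neglog (delta infinity y))%E by exact/neglog_ge0/delta_infinity_le1.
  rewrite ge0_integralD//.
  rewrite probability_integral_cst EFinD; congr (_ + _)%E.
  rewrite -[RHS]log_density_integral; apply: (law_density phi_norm muE) => //.
    move=> x; apply: (@continuous_comp _ _ _ (fun x : R => Num.max 1 `|x|) (@ln R)).
      by apply: (@continuous_max _ _ (cst 1) (fun x : R => `|x|)); [exact: cvg_cst|exact: norm_continuous].
    by apply: continuous_ln; rewrite lt_max ltr01.
  move=> x; rewrite delta_infinity ?xpair_eqE ?oner_eq0 ?andbF// normr1 mul1r maxC.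
  rewrite neglogE ?invr_gt0 ?lt_max ?ltr01// lnV ?opprK// posrE lt_max ltr01//.
(* [law_potential] at [x] and at infinity has the same right-hand side; the common summand
   [sup_potential] is finite and cancels. *)
have potential x : (\int[mu]_y (- lne (delta x y)%:E + (ln 2)%:E) = (c + ln 2)%:E)%E.
  under eq_integral do rewrite halfE.
  rewrite -infinity_potential.
  have := law_potential phi_bij phi_norm muE infinity.
  rewrite -(law_potential phi_bij phi_norm muE x) => /esym.
  by move: (@sup_potential_fin R); case: (@sup_potential R) => // s _ /(congr1 (fun z => z - s%:E)%E); rewrite !addeK.
have k_ge0 (z : borel (P1 v) * borel (P1 v)) : (0 <= - lne (delta z.1 z.2)%:E + (ln 2)%:E)%E.
  by rewrite halfE; apply: neglog_ge0; rewrite ler_pdivrMr// mul1r (delta_le2 phi_bij).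
split; last split.
- exact: (@kernel_minimizer _ _ v v_nontrivial L_locally_compact _ _ arc_measure (arc_kernel phi)
    (arc_kernel_ge0 phi) (arc_kernel_meas phi) (arc_kernel_bnd v phi) (angle_weight phi)
    (ln 2) (ln 2) c mu ln2 (angle_weight_ge0 phi_bij phi_norm) (angle_weight_le phi_bij phi_norm)
    (angle_weight_meas phi) k_ge0 (arc_gram phi_bij phi_norm) potential (arc_mollifier phi_bij phi_norm)).
- by move=> A mA; rewrite (law_measure phi_norm muE mA) /real_point rmorph1.
- exact: (@energy_minimizer _ _ v _ _ arc_measure (arc_kernel phi)
    (arc_kernel_ge0 phi) (arc_kernel_meas phi) (arc_kernel_bnd v phi) (angle_weight phi)
    (ln 2) (ln 2) c mu ln2 (angle_weight_ge0 phi_bij phi_norm) (angle_weight_le phi_bij phi_norm)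
    (angle_weight_meas phi) k_ge0 (arc_gram phi_bij phi_norm) potential).
Qed.

End RealEquilibrium.

Theorem theorem1p1 (R : realType) (L : fieldType) (v : absolute_value R L)
  (v_nontrivial : nontrivial_absv v)
  (L_locally_compact : locally_compact [set: valued v])
  (L_not_closed : ~ GRing.closed_field_axiom L)
  (v_modulus : is_haar_modulus v) :
  exists mu : probability (borel (P1 v)) R,
    ([/\ minimizes_energy mu,
         forall nu : probability (borel (P1 v)) R,
           minimizes_energy nu -> same_measure nu mu &
         forall nu : nat -> probability (borel (P1 v)) R,
           energy (nu n) @[n --> \oo] --> energy mu ->
           weakly_converges nu mu]) /\
    (forall phi : {rmorphism R -> L}, bijective phi ->
       (forall x : R, v (phi x) = `|x|) ->
       [/\ forall A : set (borel (P1 v)), measurable A ->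
             mu A = (\int[lebesgue_measure]_(x in
               [set x : R | A (hpoint v (phi x) 1)]) (density_R x)%:E)%E,
           energy mu = (7 * zeta3 R / (2 * pi ^+ 2))%:E &
           (426 / 10 ^+ 3 + 278 / 10 ^+ 6 : R) <= 7 * zeta3 R / (2 * pi ^+ 2)
             < 426 / 10 ^+ 3 + 279 / 10 ^+ 6]) /\
    (nonarchimedean v ->
       [/\ PGL2_invariant mu,
           forall nu : probability (borel (P1 v)) R,
             PGL2_invariant nu -> same_measure nu mu &
           exists q : nat, (residue_field v #= `I_q)%card /\
             energy mu = (q%:R * ln q%:R / (q%:R ^+ 2 - 1))%:E]).
Proof.
have [na|arch] := pselect (nonarchimedean v).
  have [mu [muA muC]] := nonarchimedean_equilibrium v_nontrivial L_locally_compact v_modulus na.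
  (* The real clause is vacuous here: a norm-preserving [phi] would give [v (1 + 1) = 2], against
     the ultrametric inequality. *)
  exists mu; split => //; split => // phi _ phi_norm; exfalso.
  have := na 1 1; rewrite -(rmorph1 phi) -rmorphD !phi_norm normr1 maxxx leNgt => /negP; apply.
  by rewrite ger0_norm// ltrDl.
have [m m_haar m_mod] := v_modulus.
have [phi [phi_bij phi_norm]] := archimedean_real v_nontrivial L_locally_compact m_haar m_mod arch.
have [mu [muA _]] := real_equilibrium v_nontrivial L_locally_compact phi_bij phi_norm.
have [mu_min mu_unique _] := muA; exists mu; split => //; split => // psi psi_bij psi_norm.
(* The formulas are claimed for every norm-preserving isomorphism [psi], not only for the [phi] from
   which [mu] was built. The measure built from [psi] is also a minimizer, hence equal to [mu]. *)
have [nu [[nu_min _ _] [nu_law nu_energy]]] := real_equilibrium v_nontrivial L_locally_compact psi_bij psi_norm.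
split; last exact: energy_value_bounds.
- by move=> A mA; rewrite -(mu_unique nu nu_min A mA) nu_law.
- by rewrite -nu_energy; apply/le_anti; rewrite mu_min nu_min.
Qed.
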